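(* Assume in addition (case (B)) that $\mu$ changes sign in $[0,\zeta]$, and denote by $\xi'$ its unique zero in $(0,\zeta)$. Let $v_{\epsilon,\alpha}$ and $u_{\epsilon,\alpha}$ be respectively a global minimizer and an odd minimizer. Then, as $\epsilon\to0$ and $\alpha\to\alpha_0>0$, each of $v_{\epsilon,\alpha}$ and $u_{\epsilon,\alpha}$ has three zeros $\bar x_1(\epsilon,\alpha)<\bar x_2(\epsilon,\alpha)<\bar x_3(\epsilon,\alpha)$ such that: (i) as $\epsilon\to0$ and $\alpha\to\alpha_0\in(0,\sqrt2)$, $\bar x_1(\epsilon,\alpha)$ approaches $-\xi$ or $-\xi'$ (i.e. its distance to the set $\{-\xi,-\xi'\}$ tends to $0$), $\bar x_2(\epsilon,\alpha)\to0$, and $\bar x_3(\epsilon,\alpha)$ approaches $\xi'$ or $\xi$ (i.e. its distance to the set $\{\xi',\xi\}$ tends to $0$); (ii) as $\epsilon\to0$ and $\alpha\to\alpha_0\in(\sqrt2,\infty)$, $\bar x_1(\epsilon,\alpha)\to-\zeta$, $\bar x_2(\epsilon,\alpha)\to0$, and $\bar x_3(\epsilon,\alpha)\to\zeta$.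
   Context: Standing assumptions: $\mu\in C^1(\mathbb R)\cap L^\infty(\mathbb R)$ is even; there is $\zeta>0$ with $\mu'<0$ on $(\zeta,\infty)$ and $\mu'>0$ on $(0,\zeta)$; $\mu(\xi)=0$ for a unique $\xi>\zeta$; $f=-\mu'/2$, $f\in L^{4/3}(\mathbb R)$, $f$ is differentiable at $0$ and $f'(0)<0$. For $\epsilon>0$ and $\alpha\ge 0$, and $u\in H^1(\mathbb R)$ (real-valued), $$E(u)=\int_{\mathbb R}\Big(\frac{\epsilon}{2}|u'|^2-\frac{1}{2\epsilon}\mu(x)u^2+\frac{1}{4\epsilon}u^4-\alpha f(x)u\Big)dx.$$ A global minimizer is $v=v_{\epsilon,\alpha}\in H^1(\mathbb R)$ with $E(v)=\min_{H^1(\mathbb R)}E$; an odd minimizer is $u=u_{\epsilon,\alpha}\in H^1_{\mathrm{odd}}(\mathbb R)$ (the odd functions in $H^1(\mathbb R)$) with $E(u)=\min_{H^1_{\mathrm{odd}}(\mathbb R)}E$. (Both exist and are classical $C^2$ solutions of $\epsilon^2w''+\mu w-w^3+\epsilon\alpha f=0$.) The assertion on the number of zeros ''as $\epsilon\to0$ and $\alpha\to\alpha_0$'' means: for all $\epsilon>0$ small enough and $\alpha$ close enough to $\alpha_0$. *)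

(* Defs.v *)
From HB Require Import structures.
From mathcomp Require Import all_boot all_order all_algebra.
From mathcomp Require Import all_classical all_reals all_analysis.

Set Implicit Arguments.
Unset Strict Implicit.
Unset Printing Implicit Defensive.

Import Order.TTheory GRing.Theory Num.Theory.
Import numFieldNormedType.Exports.

Local Open Scope ring_scope.
Local Open Scope classical_set_scope.

Notation leb R := (@lebesgue_measure R).

Definition C1 (R : realType) (g : R -> R) : Prop :=
  (forall x, derivable g x 1) /\ continuous (derive1 g).

Definition test_function (R : realType) (phi : R -> R) : Prop :=
  C1 phi /\ exists M : R, forall x, M < `|x| -> phi x = 0.

Definition is_weak_derivative (R : realType) (u g : R -> R) : Prop :=
  forall phi : R -> R, test_function phi ->
    \int[leb R]_x (u x * derive1 phi x) = - \int[leb R]_x (g x * phi x).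

(* Elements of H^1 are honest functions here, not almost-everywhere classes. *)
Definition H1 (R : realType) : set (R -> R) :=
  [set u | u \in Lfun (leb R) 2%:E /\
     exists2 g : R -> R, g \in Lfun (leb R) 2%:E & is_weak_derivative u g].

Definition H1_odd (R : realType) : set (R -> R) :=
  [set u | H1 u /\ forall x, u (- x) = - u x].

(* A chosen square-integrable weak derivative; it is determined up to a null
   set, hence its choice does not affect the energy. *)
Definition weak_derivative (R : realType) (u : R -> R) : R -> R :=
  xget (fun=> 0)
    [set g : R -> R | g \in Lfun (leb R) 2%:E /\ is_weak_derivative u g].

Definition forcing (R : realType) (mu : R -> R) : R -> R :=
  fun x => - derive1 mu x / 2.

Definition energy (R : realType) (mu : R -> R) (eps alpha : R) (u : R -> R)
    : R :=
  \int[leb R]_x (eps / 2 * `|weak_derivative u x| ^+ 2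
                 - (2 * eps)^-1 * mu x * u x ^+ 2
                 + (4 * eps)^-1 * u x ^+ 4
                 - alpha * forcing mu x * u x).

Definition minimizes (R : realType) (K : set (R -> R)) (E : (R -> R) -> R)
    (u : R -> R) : Prop :=
  K u /\ forall w, K w -> E u <= E w.

(* Zeros only make sense for the continuous representative of a class in H^1,
   whence the continuity requirement. *)
Definition global_minimizer (R : realType) (mu : R -> R) (eps alpha : R)
    (v : R -> R) : Prop :=
  minimizes (@H1 R) (energy mu eps alpha) v /\ continuous v.

Definition odd_minimizer (R : realType) (mu : R -> R) (eps alpha : R)
    (u : R -> R) : Prop :=
  minimizes (@H1_odd R) (energy mu eps alpha) u /\ continuous u.

(* Pairs (eps, alpha) with eps -> 0, eps > 0, and alpha -> alpha0. *)
Definition small_eps_near (R : realType) (alpha0 : R) : set_system (R * R) :=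
  filter_prod (0 : R)^'+ (nbhs alpha0).

Definition exactly_three_zeros (R : realType) (w : R -> R) (x1 x2 x3 : R)
    : Prop :=
  [/\ x1 < x2, x2 < x3 &
      forall x, w x = 0 <-> [\/ x = x1, x = x2 | x = x3]].

(* The minima below are the distances to {- xi, - xi'} and {xi', xi}. *)
Definition three_zeros_asymptotics (R : realType) (zeta xi xi' alpha0 : R)
    (w : R -> R -> R -> R) : Prop :=
  exists x1 x2 x3 : R -> R -> R,
  [/\ \forall p \near small_eps_near alpha0,
        exactly_three_zeros (w p.1 p.2)
          (x1 p.1 p.2) (x2 p.1 p.2) (x3 p.1 p.2),
      alpha0 < Num.sqrt 2 ->
      [/\ Num.min `|x1 p.1 p.2 - (- xi)| `|x1 p.1 p.2 - (- xi')|
            @[p --> small_eps_near alpha0] --> (0 : R),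
          x2 p.1 p.2 @[p --> small_eps_near alpha0] --> (0 : R) &
          Num.min `|x3 p.1 p.2 - xi'| `|x3 p.1 p.2 - xi|
            @[p --> small_eps_near alpha0] --> (0 : R)] &
      Num.sqrt 2 < alpha0 ->
      [/\ x1 p.1 p.2 @[p --> small_eps_near alpha0] --> - zeta,
          x2 p.1 p.2 @[p --> small_eps_near alpha0] --> (0 : R) &
          x3 p.1 p.2 @[p --> small_eps_near alpha0] --> zeta]].

(* Main.v *)
(* A minimizer, global or odd, minimizes the energy on [0, +oo[ among the
   functions with the same value at 0, and testing this minimality with hat
   functions makes it of class C^2. Replacing it by its opposite between two
   zeros only changes the force term, and it cannot touch zero from the side to
   which f pushes it. As f < 0 on (0, zeta) and f > 0 beyond, and as for small
   eps the minimizer is negative at each point of (0, xi') and positive at each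
   point beyond xi, it has exactly one zero z to the right of a small
   neighbourhood of 0, by symmetry exactly one to the left, and one inside.

   Away from z the minimizer is close to sqrt mu in absolute value. The
   transition at z costs (2 sqrt 2 / 3) mu(z)^(3/2), by the inequality
   eps/2 v'^2 + (v^2 - mu)^2 / (4 eps) >= |mu - v^2| |v'| / sqrt 2, whereas moving
   it from z to z' by a change of sign changes the energy of the force by
   alpha times the integral of |mu'| sqrt mu between z and z', that is by
   (2 alpha / 3) |mu(z')^(3/2) - mu(z)^(3/2)|: a loss when mu(z') < mu(z) and a
   gain when mu(z') > mu(z). Moving the transition to a zero of mu is therefore
   profitable when alpha < sqrt 2, and moving it to the maximum point zeta of mu
   is profitable when alpha > sqrt 2. *)

Require Import Defs.
From HB Require Import structures.
From mathcomp Require Import all_boot all_order all_algebra.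
From mathcomp Require Import all_classical all_reals all_analysis.
From mathcomp Require Import measurable_realfun ess_sup_inf ring lra.
Import Order.TTheory GRing.Theory Num.Theory.
Import numFieldNormedType.Exports.
Local Open Scope ring_scope.
Local Open Scope classical_set_scope.

Set Implicit Arguments.
Unset Strict Implicit.
Unset Printing Implicit Defensive.

(** * Interval integrals and primitives *)

Section integrable_kit.
Context {R : realType}.
Implicit Types (F G : R -> R) (D : set R) (a b c k : R).

(** Minimality is available on [[0, +oo[] only, with the value at the origin fixed. The estimates
    are therefore made there, for a notion of local solution ([lsol]) on intervals away from the
    origin, and the left half of [v] is read as the right half of [- v (- x)], a minimizer too since
    [mu] is even and [f] odd. The two halves have opposite values at 0, whose sign tells which of
    them carries the middle zero.

    The limit is joint in [eps] and [alpha], so each threshold on [eps] must be uniform for [alpha]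
    in a compact interval. No limit problem is used: a bound [K] is fixed, then a tolerance [kap],
    then [eps], and a comparison of energies ends in an inequality such as
    $(\sqrt2-\alpha)\mu(z)^{3/2}\le cK^2\,kap$, absurd for small [kap]. The bound [K] starts from
    the nonpositive energy of a minimizer: Young's inequality with exponents 4/3 and 4 bounds the
    $L^4$ norm, hence the value at suitable points, and a maximum principle bounds the values
    between them.

    For $\alpha>\sqrt2$ a transition of optimal cost must be built at [zeta], whence the hyperbolic
    tangent. *)

Definition itg D F := (leb R).-integrable D (EFin \o F).

Lemma itg_measurable D F : itg D F -> measurable_fun D F.
Proof. by move=> /measurable_int /measurable_EFinP. Qed.

Lemma itgD D F G : measurable D -> itg D F -> itg D G ->
  itg D (fun x => F x + G x).
Proof. by move=> mD; exact: integrableD. Qed.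

Lemma itgZ D F k : measurable D -> itg D F -> itg D (fun x => k * F x).
Proof. by move=> mD; exact: integrableZl. Qed.

Lemma itgB D F G : measurable D -> itg D F -> itg D G ->
  itg D (fun x => F x - G x).
Proof. by move=> mD; exact: integrableB. Qed.

Lemma itgS D D' F : measurable D -> measurable D' -> D' `<=` D ->
  itg D F -> itg D' F.
Proof. by move=> mD mD' DD'; apply: (@integrableS _ _ _ (leb R) D D'). Qed.

Lemma eq_itg D F G : {in D, F =1 G} -> measurable D -> itg D F -> itg D G.
Proof.
move=> FG mD; apply: eq_integrable => // x xD /=; by rewrite FG.
Qed.

Lemma le_itg D F G : measurable D -> measurable_fun D F ->
  (forall x, D x -> `|F x| <= G x) -> itg D G -> itg D F.
Proof.
move=> mD mF FG; apply: le_integrable => //; first exact/measurable_EFinP.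
by move=> x Dx /=; rewrite lee_fin (le_trans (FG x Dx))// ler_norm.
Qed.

Lemma itg_normr D F : measurable D -> itg D F -> itg D (fun x => `|F x|).
Proof.
move=> mD iF; apply: (@le_itg D _ (fun x => `|F x|)) => //.
- by apply: measurableT_comp => //; exact: itg_measurable.
- by move=> x _; rewrite normr_id.
- exact: integrable_norm.
Qed.

Lemma itg_cst a b k : itg `[a, b] (fun=> k).
Proof.
apply: continuous_compact_integrable; first exact: segment_compact.
exact: continuous_subspaceT (@cst_continuous _ _ k).
Qed.

Lemma itg_cont a b F : continuous F -> itg `[a, b] F.
Proof.
move=> cF; apply: continuous_compact_integrable; first exact: segment_compact.
exact: continuous_subspaceT.
Qed.

Lemma itgM D F G k : measurable D -> measurable_fun D F ->
  (forall x, D x -> `|F x| <= k) -> itg D G -> itg D (fun x => F x * G x).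
Proof.
move=> mD mF Fk iG; apply: (@le_itg _ _ (fun x => k * `|G x|)) => //.
- by apply: measurable_funM => //; exact: itg_measurable.
- by move=> x Dx; rewrite normrM ler_wpM2r// Fk.
- by apply: itgZ => //; exact: itg_normr.
Qed.

Lemma itg_mkcond D F : measurable D ->
  itg D F <-> itg setT (fun x => if x \in D then F x else 0).
Proof.
move=> mD; apply: iff_trans (integrable_mkcond (mu := leb R) (EFin \o F) mD) _.
rewrite /itg.
have -> : (EFin \o F) \_ D = EFin \o (fun x => if x \in D then F x else 0).
  by apply/funext => x; rewrite /patch/=; case: ifP.
by [].
Qed.

Lemma itg_setU D D' F : measurable D -> measurable D' ->
  itg D F -> itg D' F -> itg (D `|` D') F.
Proof.
move=> mD mD' iF iF'.
have mU : measurable (D `|` D') by exact: measurableU.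
have i1 := (itg_mkcond F mD).1 iF.
have i2 := (itg_mkcond F mD').1 iF'.
apply: (@le_itg _ _ (fun x => `|if x \in D then F x else 0| +
                              `|if x \in D' then F x else 0|)) => //.
- by apply/measurable_funU => //; split; exact: itg_measurable.
- move=> x [Dx|Dx].
    by rewrite (mem_set Dx) lerDl.
  by rewrite [x \in D'](mem_set Dx) lerDr.
- by apply: (@itgS setT) => //; apply: itgD => //; apply: itg_normr.
Qed.

Lemma measurable_if F G c : measurable_fun setT F -> measurable_fun setT G ->
  measurable_fun setT (fun x : R => if c <= x then F x else G x).
Proof.
move=> mF mG; apply: (measurable_fun_ifT (g := F) (h := G) (f := fun x => c <= x)) => //.
exact: measurable_fun_ler.
Qed.

End integrable_kit.

Section reflection.
Context {R : realType}.
Implicit Types F : R -> R.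

Lemma ge0_integral_opp (f : R -> \bar R) : measurable_fun setT f ->
  (forall x, 0 <= f x)%E ->
  (\int[leb R]_x f (- x)%R = \int[leb R]_x f x)%E.
Proof.
move=> mf f0.
pose opp : measurableTypeR R -> measurableTypeR R := -%R.
have mopp : measurable_fun setT opp by exact: oppr_measurable.
have E := @ge0_integral_pushforward _ _ _ _ R opp mopp (leb R) setT f measurableT mf
  (fun x _ => f0 x).
rewrite preimage_setT in E; rewrite -[LHS]E.
by apply: eq_measure_integral => A mA _; exact: lebesgue_measureN.
Qed.

Lemma measurable_opp F : measurable_fun setT F ->
  measurable_fun setT (fun x : R => F (- x)).
Proof. by move=> mF; exact: (measurableT_comp mF (@oppr_measurable R setT)). Qed.

Lemma integral_opp F : measurable_fun setT F ->
  (\int[leb R]_x (F (- x)%R)%:E = \int[leb R]_x (F x)%:E)%E.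
Proof.
move=> mF; have mF' : measurable_fun setT (EFin \o F) by exact/measurable_EFinP.
rewrite integralE [RHS]integralE; congr (_ - _)%E.
- have E := ge0_integral_opp (measurable_funepos mF') (fun x => funepos_ge0 _ x).
  by apply: etrans E; apply: eq_integral => x _; rewrite !funeposE.
- have E := ge0_integral_opp (measurable_funeneg mF') (fun x => funeneg_ge0 _ x).
  by apply: etrans E; apply: eq_integral => x _; rewrite !funenegE.
Qed.

Lemma itg_opp F : itg setT F -> itg setT (fun x => F (- x)).
Proof.
move=> iF; have mF := itg_measurable iF; apply/integrableP; split.
  by apply/measurable_EFinP; exact: measurable_opp.
move/integrableP : iF => [_]; apply: le_lt_trans.
have mF' : measurable_fun setT (fun x : R => (`|F x|)%:E).
  by apply/measurable_EFinP; exact: measurableT_comp.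
by rewrite (ge0_integral_opp mF').
Qed.

Lemma Rintegral_opp F : measurable_fun setT F ->
  \int[leb R]_x F (- x) = \int[leb R]_x F x.
Proof. by move=> mF; rewrite /Rintegral integral_opp. Qed.

End reflection.

Section interval_integral.
Context {R : realType}.
Implicit Types (F G : R -> R) (a b c k : R).

Lemma Rint_if D F : measurable D ->
  \int[leb R]_(x in D) F x = \int[leb R]_x (if x \in D then F x else 0).
Proof. by move=> mD; rewrite Rintegral_mkcond; apply: eq_Rintegral => x _. Qed.

Lemma Rint_cat a b c F : a <= b -> b <= c -> itg `[a, c] F ->
  \int[leb R]_(x in `[a, c]) F x =
  \int[leb R]_(x in `[a, b]) F x + \int[leb R]_(x in `[b, c]) F x.
Proof.
move=> ab bc iF.
have := @Rintegral_itvB R F (BLeft a) (BRight c) b iF.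
rewrite !bnd_simp => /(_ ab bc) E.
have <- : \int[leb R]_(x in `]b, c]) F x = \int[leb R]_(x in `[b, c]) F x.
  apply: Rintegral_itv_obnd_cbnd; apply: itgS iF => //.
  by move=> x /=; rewrite !in_itv/= => /andP[bx ->]; rewrite (le_trans ab (ltW bx)).
by rewrite -E addrC subrK.
Qed.

Lemma itg_cat a b c F : a <= b -> b <= c -> itg `[a, b] F -> itg `[b, c] F ->
  itg `[a, c] F.
Proof.
move=> ab bc i1 i2.
have -> : `[a, c]%classic = `[a, b]%classic `|` `[b, c]%classic.
  apply/seteqP; split => x /=; rewrite !in_itv/=.
    by move=> /andP[ax xc]; case: (leP x b) => xb; [left|right]; rewrite ?ax ?xc ?(ltW xb).
  case=> /andP[h1 h2]; first by rewrite h1 (le_trans h2).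
  by rewrite h2 (le_trans ab).
exact: itg_setU.
Qed.

Lemma Rint_pt a F : \int[leb R]_(x in `[a, a]) F x = 0.
Proof. by rewrite set_itv1 Rintegral_set1. Qed.

Lemma Rint_cst a b k : a <= b -> \int[leb R]_(x in `[a, b]) k = k * (b - a).
Proof.
move=> ab; rewrite Rintegral_cst//; congr (_ * _).
have /= := @lebesgue_measure_itv R (Interval (BLeft a) (BRight b)).
rewrite lte_fin => E; rewrite [leb R `[a, b]%classic]E.
by case: ltgtP ab => //= -> _; rewrite subrr.
Qed.

Lemma Rint_le a b F G : itg `[a, b] F -> itg `[a, b] G ->
  (forall x, a <= x <= b -> F x <= G x) ->
  \int[leb R]_(x in `[a, b]) F x <= \int[leb R]_(x in `[a, b]) G x.
Proof.
by move=> iF iG FG; apply: le_Rintegral => // x /=; rewrite in_itv/= => /FG.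
Qed.

Lemma eq_Rint a b F G : (forall x, a <= x <= b -> F x = G x) ->
  \int[leb R]_(x in `[a, b]) F x = \int[leb R]_(x in `[a, b]) G x.
Proof. by move=> FG; apply: eq_Rintegral => x; rewrite inE/= in_itv/= => /FG. Qed.

Lemma eq_itg_itv a b F G : (forall x, a <= x <= b -> F x = G x) ->
  itg `[a, b] F -> itg `[a, b] G.
Proof. by move=> FG; apply: eq_itg => // x; rewrite inE/= in_itv/= => /FG. Qed.

Lemma RintZ a b F k : itg `[a, b] F ->
  \int[leb R]_(x in `[a, b]) (k * F x) = k * \int[leb R]_(x in `[a, b]) F x.
Proof. by move=> iF; rewrite RintegralZl. Qed.

Lemma RintD a b F G : itg `[a, b] F -> itg `[a, b] G ->
  \int[leb R]_(x in `[a, b]) (F x + G x) =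
  \int[leb R]_(x in `[a, b]) F x + \int[leb R]_(x in `[a, b]) G x.
Proof. by move=> iF iG; rewrite RintegralD. Qed.

Lemma RintB a b F G : itg `[a, b] F -> itg `[a, b] G ->
  \int[leb R]_(x in `[a, b]) (F x - G x) =
  \int[leb R]_(x in `[a, b]) F x - \int[leb R]_(x in `[a, b]) G x.
Proof. by move=> iF iG; rewrite RintegralB. Qed.

Lemma Rint_derive F f a b : a <= b ->
  (forall x, a <= x <= b -> is_derive x 1 F (f x)) ->
  {within `[a, b], continuous f} ->
  \int[leb R]_(x in `[a, b]) f x = F b - F a.
Proof.
rewrite le_eqVlt => /predU1P[<- _ _|ab dF cf]; first by rewrite Rint_pt subrr.
have cF x : a <= x <= b -> {for x, continuous F}.
  by move=> /dF [/derivable1_diffP/differentiable_continuous].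
rewrite /Rintegral (@continuous_FTC2 _ f F)//.
- split.
  + by move=> x; rewrite in_itv/= => /andP[ax xb]; have [] := dF x _; rewrite ?ltW.
  + by apply: cvg_at_right_filter; apply: cF; rewrite lexx ltW.
  + by apply: cvg_at_left_filter; apply: cF; rewrite lexx ltW.
- move=> x; rewrite in_itv/= => /andP[ax xb]; rewrite derive1E.
  by have xab : a <= x <= b; [rewrite !ltW|have [_ ->] := dF x xab].
Qed.

End interval_integral.

Section primitives.
Context {R : realType}.
Implicit Types (F G W : R -> R) (a b c k x y : R).

(** Local absolute continuity, written as the integral identity itself: unlike [is_derive], it
    survives pasting at a corner and asks for no pointwise derivative. *)
Definition prim W G := forall a b, a <= b ->
  itg `[a, b] G /\ W b - W a = \int[leb R]_(x in `[a, b]) G x.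

Lemma sub_co a b : `[a, b[ `<=` `[a, b].
Proof. by move=> x /=; rewrite !in_itv/= => /andP[-> /ltW]. Qed.

(** Agreement on a half-open interval is what [paste] provides: at the gluing point it takes the
    right-hand function, so the left piece may deviate there. *)
Lemma eq_itg_co a b F G : (forall x, a <= x < b -> F x = G x) ->
  itg `[a, b] F -> itg `[a, b] G.
Proof.
move=> FG iF; case: (ltP b a) => [ba|ab].
  by rewrite set_itv_ge ?bnd_simp -?ltNge//; exact: integrable_set0.
have -> : `[a, b]%classic = `[a, b[%classic `|` [set b].
  by rewrite setUitv1// bnd_simp.
apply: itg_setU => //.
  apply: (@eq_itg _ _ F) => //; first by move=> x; rewrite inE/= in_itv/= => /FG.
  apply: itgS iF => //; exact: sub_co.
apply: (@le_itg _ _ _ (fun=> `|G b|)) => //; first exact: measurable_fun_set1.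
  by move=> x ->.
rewrite -set_itv1; exact: itg_cst.
Qed.

Lemma eq_Rint_co a b F G : (forall x, a <= x < b -> F x = G x) ->
  itg `[a, b] F ->
  \int[leb R]_(x in `[a, b]) F x = \int[leb R]_(x in `[a, b]) G x.
Proof.
move=> FG iF; have iG := eq_itg_co FG iF.
have sub : `[a, b[ `<=` `[a, b] by exact: sub_co.
rewrite -Rintegral_itv_bndo_bndc; last exact: itgS iF.
rewrite -Rintegral_itv_bndo_bndc; last exact: itgS iG.
by apply: eq_Rintegral => x; rewrite inE/= in_itv/= => /FG.
Qed.

Lemma prim_itg W G a b : prim W G -> itg `[a, b] G.
Proof.
move=> p; case: (leP a b) => [/p[]//|ba].
by rewrite set_itv_ge ?bnd_simp -?ltNge//; exact: integrable_set0.
Qed.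

Lemma prim_eq W G a b : prim W G -> a <= b ->
  W b - W a = \int[leb R]_(x in `[a, b]) G x.
Proof. by move=> p /p[]. Qed.

Lemma prim_measurable W G : prim W G -> measurable_fun setT G.
Proof.
move=> p.
have -> : [set: R] = \bigcup_(n in [set: nat]) `[- n%:R, n%:R]%classic.
  apply/esym/seteqP; split => // x _.
  exists (Num.truncn `|x|).+1 => //=; rewrite in_itv/= -ler_norml.
  by rewrite ltW// truncnS_gt.
apply/measurable_fun_bigcup => //= n.
by apply: itg_measurable; exact: prim_itg p.
Qed.

Lemma prim_continuous W G : prim W G -> continuous W.
Proof.
move=> p x.
have iG := @prim_itg _ _ (x - 1) (x + 1) p.
have /parameterized_integral_continuous : x - 1 <= x + 1 by lra.
move=> /(_ _ iG) cG.
have cW : {within `[x - 1, x + 1], continuous W}.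
  apply: (@subspace_eq_continuous _ _ _ (fun y => W (x - 1) + parameterized_integral (leb R) (x - 1) y G)).
    move=> y; rewrite inE/= in_itv/= => /andP[xy _].
    rewrite /from_subspace /parameterized_integral -(prim_eq p xy); ring.
  by move=> y; apply: cvgD; [exact: cvg_cst|exact: cG].
apply: (within_continuous_continuous _ cW); first by lra.
by rewrite in_itv/=; lra.
Qed.

Lemma primD W1 G1 W2 G2 : prim W1 G1 -> prim W2 G2 ->
  prim (fun x => W1 x + W2 x) (fun x => G1 x + G2 x).
Proof.
move=> p1 p2 a b ab; have [i1 e1] := p1 _ _ ab; have [i2 e2] := p2 _ _ ab.
split; first exact: itgD.
by rewrite RintegralD// -e1 -e2; ring.
Qed.

Lemma primZ k W G : prim W G -> prim (fun x => k * W x) (fun x => k * G x).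
Proof.
move=> p a b ab; have [i e] := p _ _ ab; split; first exact: itgZ.
by rewrite RintegralZl// -e; ring.
Qed.

Lemma prim_derive W G : (forall x, is_derive x 1 W (G x)) -> continuous G -> prim W G.
Proof.
move=> dW cG a b ab; split; first exact: itg_cont.
by rewrite (@Rint_derive _ W)//; exact: continuous_subspaceT.
Qed.

Lemma prim_cst k : prim (fun=> k) (fun=> 0).
Proof. by move=> a b ab; split; [exact: itg_cst|rewrite Rint_cst// subrr mul0r]. Qed.

Lemma prim_affine k c : prim (fun x => k * x + c) (fun=> k).
Proof. by move=> a b ab; split; [exact: itg_cst|rewrite Rint_cst//; ring]. Qed.

Definition paste c F G := fun x : R => if c <= x then G x else F x.

Lemma prim_paste c W1 G1 W2 G2 : prim W1 G1 -> prim W2 G2 -> W1 c = W2 c ->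
  prim (paste c W1 W2) (paste c G1 G2).
Proof.
move=> p1 p2 W12.
have right a b : c <= a -> a <= b -> itg `[a, b] (paste c G1 G2) /\
    paste c W1 W2 b - paste c W1 W2 a = \int[leb R]_(x in `[a, b]) paste c G1 G2 x.
  move=> ca ab; have [i e] := p2 _ _ ab.
  have E x : a <= x <= b -> G2 x = paste c G1 G2 x.
    by move=> /andP[ax _]; rewrite /paste (le_trans ca ax).
  split; first exact: eq_itg_itv i.
  by rewrite -(eq_Rint E) -e /paste ca (le_trans ca ab).
have left a b : b <= c -> a <= b -> itg `[a, b] (paste c G1 G2) /\
    paste c W1 W2 b - paste c W1 W2 a = \int[leb R]_(x in `[a, b]) paste c G1 G2 x.
  move=> bc ab; have [i e] := p1 _ _ ab.
  have E x : a <= x < b -> G1 x = paste c G1 G2 x.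
    by move=> /andP[_ xb]; rewrite /paste leNgt (lt_le_trans xb bc).
  split; first exact: eq_itg_co i.
  have glW x : x <= c -> paste c W1 W2 x = W1 x.
    by rewrite /paste le_eqVlt => /predU1P[->|xc]; [rewrite lexx|rewrite leNgt xc].
  by rewrite -(eq_Rint_co E)// -e !glW// (le_trans ab).
move=> a b ab; case: (leP c a) => [ca|ac]; first exact: right.
case: (leP b c) => [bc|cb]; first exact: left.
have [i1 e1] := left a c (lexx c) (ltW ac).
have [i2 e2] := right c b (lexx c) (ltW cb).
have i := itg_cat (ltW ac) (ltW cb) i1 i2.
split=> //; rewrite (Rint_cat (ltW ac) (ltW cb) i) -e1 -e2; ring.
Qed.

Lemma Rint_opp a b F : itg `[- b, - a] F ->
  itg `[a, b] (fun x => F (- x)) /\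
  \int[leb R]_(x in `[a, b]) F (- x) = \int[leb R]_(x in `[- b, - a]) F x.
Proof.
move=> iF; have i := (itg_mkcond F (measurable_itv _)).1 iF.
have E : (fun x => if - x \in `[- b, - a]%classic then F (- x) else 0) =
         (fun x => if x \in `[a, b]%classic then F (- x) else 0).
  apply/funext => x; suff -> : (- x \in `[- b, - a]%classic) = (x \in `[a, b]%classic) by [].
  by apply/idP/idP; rewrite !inE/= !in_itv/= !lerN2 andbC.
split; first by apply/itg_mkcond => //; rewrite -E; exact: itg_opp i.
by rewrite Rint_if// [RHS]Rint_if// -(Rintegral_opp (itg_measurable i)) E.
Qed.

Lemma prim_opp W G : prim W G -> prim (fun x => - W (- x)) (fun x => G (- x)).
Proof.
move=> p a b ab; have ba : - b <= - a by rewrite lerN2.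
have [i e] := p _ _ ba; have [i' e'] := Rint_opp i.
by split=> //; rewrite e' -e; ring.
Qed.

Lemma prim_abs_le W G a b : prim W G -> a <= b ->
  `|W b - W a| <= \int[leb R]_(x in `[a, b]) `|G x|.
Proof.
move=> p ab; have [i ->] := p _ _ ab; exact: le_normr_Rintegral.
Qed.

End primitives.

(** * Square-integrable functions and the pairs that represent $H^1$ *)

Section square_integrable.
Context {R : realType}.
Implicit Types (F G W : R -> R) (a b c k x y : R).

Definition sqi F := measurable_fun setT F /\ itg setT (fun x => F x ^+ 2).

Lemma sqiP F : F \in Lfun (leb R) 2%:E <-> sqi F.
Proof.
split=> [F2|[mF iF]].
  split; last exact: Lfun2_integrable_sqr.
  by move: F2; rewrite inE => /andP[]; rewrite !inE.
rewrite inE; apply/andP; split; rewrite inE//=.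
rewrite /finite_norm unlock /Lnorm poweR_lty//.
move/integrableP : iF => [_]; apply: le_lt_trans.
rewrite le_eqVlt; apply/orP; left; apply/eqP.
by apply: eq_integral => x _ /=; rewrite powR_mulrn// normrX.
Qed.

Lemma sqiZ k F : sqi F -> sqi (fun x => k * F x).
Proof.
move=> [mF iF]; split; first exact: measurable_funM.
apply: (@eq_itg _ _ (fun x => k ^+ 2 * F x ^+ 2)) => //; last exact: itgZ.
by move=> x _; ring.
Qed.

Lemma sqi_opp F : sqi F -> sqi (fun x => F (- x)).
Proof.
by move=> [mF iF]; split; [exact: measurable_opp|exact: (itg_opp iF)].
Qed.

Lemma itg_paste c F G : itg setT F -> itg setT G -> itg setT (paste c F G).
Proof.
move=> iF iG; apply: (@le_itg _ _ _ (fun x => `|F x| + `|G x|)) => //.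
- apply: measurable_if; exact: itg_measurable.
- by move=> x _; rewrite /paste; case: ifP => _; rewrite ?lerDl ?lerDr.
- by apply: itgD => //; exact: itg_normr.
Qed.

Lemma sqi_paste c F G : sqi F -> sqi G -> sqi (paste c F G).
Proof.
move=> [mF iF] [mG iG]; split; first exact: measurable_if.
have -> : (fun x => paste c F G x ^+ 2) =
    paste c (fun x => F x ^+ 2) (fun x => G x ^+ 2).
  by apply/funext => x; rewrite /paste; case: ifP.
exact: itg_paste.
Qed.

Lemma sqi0 : sqi (fun=> 0).
Proof.
split; first exact: measurable_cst.
apply: (@eq_itg _ _ (fun=> 0)) => //; first by move=> x _; rewrite expr0n.
exact: integrable0.
Qed.

Lemma Rint_subset D F : measurable D -> itg setT F -> (forall x, 0 <= F x) ->
  \int[leb R]_(x in D) F x <= \int[leb R]_x F x.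
Proof.
move=> mD iF F0; rewrite Rint_if//; apply: le_Rintegral => //.
  exact/(itg_mkcond F mD)/(itgS _ _ _ iF).
by move=> x _; case: ifP.
Qed.

(** An element of $H^1$ given by its continuous representative together with an explicit derivative,
    so that competitors come with their derivative instead of the one selected by
    [weak_derivative]. *)
Record H1p W G : Prop := { H1p_prim : prim W G; H1p_fun : sqi W; H1p_der : sqi G }.

(** Since $|G|\le 1+G^2$, the oscillation of [W] over an interval of length 1 is at most [1 + B]. A
    value above [1 + B + (A + 1)] would thus keep $|W|\ge A+1$ on such an interval, and the integral
    of $W^2$ there would exceed its total [A]. *)
Lemma H1p_bounded W G : H1p W G -> exists N, forall x, `|W x| <= N.
Proof.
move=> [p [mW iW] [mG iG]].
set A := \int[leb R]_x (W x ^+ 2); set B := \int[leb R]_x (G x ^+ 2).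
have A0 : 0 <= A by apply: Rintegral_ge0 => x _; exact: sqr_ge0.
have B0 : 0 <= B by apply: Rintegral_ge0 => x _; exact: sqr_ge0.
exists (1 + B + (A + 1)) => x; rewrite leNgt; apply/negP => Nx.
have osc y : x <= y <= x + 1 -> A + 1 <= `|W y|.
  move=> /andP[xy yx].
  have h : `|W y - W x| <= 1 + B.
    apply: le_trans (prim_abs_le p xy) _.
    have iGxy : itg `[x, y] (fun x => G x ^+ 2) by apply: itgS iG.
    apply: (@le_trans _ _ (\int[leb R]_(t in `[x, y]) (1 + G t ^+ 2))).
      apply: Rint_le.
      - by apply: itg_normr => //; exact: prim_itg p.
      - by apply: itgD => //; exact: itg_cst.
      - move=> t _; rewrite -(real_normK (num_real (G t))).
        by have := sqr_ge0 (`|G t| - 1); nra.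
    rewrite RintegralD//; last exact: itg_cst.
    rewrite Rint_cst// mul1r; apply: lerD; first by lra.
    by apply: Rint_subset => // t; exact: sqr_ge0.
  have := lerB_dist (W x) (W y); rewrite distrC; lra.
have : (A + 1) ^+ 2 <= A.
  have -> : (A + 1) ^+ 2 = (A + 1) ^+ 2 * (x + 1 - x) by ring.
  rewrite -Rint_cst; last by lra.
  have sub := @Rint_subset `[x, x + 1] (fun t => W t ^+ 2) (measurable_itv _) iW (fun t => sqr_ge0 _).
  apply: le_trans _ sub.
  apply: Rint_le; [exact: itg_cst|exact: itgS iW|].
  move=> t /osc h; rewrite -[leRHS]real_normK ?num_real//.
  by rewrite ler_sqr ?nnegrE//; lra.
by nra.
Qed.

(** The difference of the two derivatives has integral zero over every interval; by Lebesgue's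
    differentiation theorem it vanishes at almost every point. *)
Lemma prim_ae_unique W G G' : prim W G -> prim W G' ->
  {ae leb R, forall x, G x = G' x}.
Proof.
move=> p p'.
pose h x := G x - G' x.
have ih a b : itg `[a, b] h.
  by apply: itgB => //; [exact: prim_itg p|exact: prim_itg p'].
have mh : measurable_fun setT h.
  by apply: measurable_funB; [exact: prim_measurable p|exact: prim_measurable p'].
have h0 a b : a <= b -> \int[leb R]_(x in `[a, b]) h x = 0.
  move=> ab; have [i e] := p _ _ ab; have [i' e'] := p' _ _ ab.
  by rewrite RintegralB// -e -e' subrr.
have loch : locally_integrable setT h.
  split => //; first exact: openT.
  move=> K _ cK; have [M [_ /(_ (M + 1))]] := compact_bounded cK.
  rewrite ltrDl ltr01 => /(_ isT) KM.
  have sub : K `<=` `[- (M + 1), M + 1] by move=> x /KM /=; rewrite in_itv/= ler_norml.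
  have mK : measurable K by exact: compact_measurable.
  by have /integrableP[] := itgS (measurable_itv _) mK sub (ih (- (M + 1)) (M + 1)).
have := lebesgue_differentiation loch.
apply: filterS; first exact: (ae_filter_ringOfSetsType (leb R)).
move=> x hx.
have x1 : x < x + 1 by rewrite ltrDl.
have [] := FTC1_lebesgue_pt x1 (ih (x - 1) (x + 1)) _ hx.
  by rewrite lte_fin; lra.
move=> _; rewrite /h => e; apply/eqP; rewrite -subr_eq0 -e.
rewrite derive1E (_ : (fun _ => _) = cst 0) ?derive_cst//.
apply/funext => y; case: (leP (x - 1) y) => [|yx]; first exact: h0.
by rewrite set_itv_ge ?bnd_simp -?ltNge// Rintegral_set0.
Qed.

End square_integrable.

(** * Weak derivatives *)

Section weak_derivatives.
Context {R : realType}.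
Implicit Types (F G W : R -> R) (a b c k x y : R).

Lemma derive1P F x : derivable F x 1 -> is_derive x 1 F (derive1 F x).
Proof. by move=> dF; rewrite derive1E; split. Qed.

Lemma derive1_eq F x k : is_derive x 1 F k -> derive1 F x = k.
Proof. by move=> [_ <-]; rewrite derive1E. Qed.

Lemma ae_eq_Rintegral D F G : measurable D -> measurable_fun D F ->
  measurable_fun D G -> {ae leb R, forall x, D x -> F x = G x} ->
  \int[leb R]_(x in D) F x = \int[leb R]_(x in D) G x.
Proof.
move=> mD mF mG FG; congr fine; apply: ae_eq_integral => //; try exact/measurable_EFinP.
apply: filterS FG; first exact: (ae_filter_ringOfSetsType (leb R)).
by move=> x h Dx; rewrite h.
Qed.

Lemma itg_EFin D F : measurable D -> itg D F ->
  (\int[leb R]_(x in D) (F x)%:E = (\int[leb R]_(x in D) F x)%:E)%E.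
Proof. by move=> mD iF; rewrite fineK//; exact: integrable_fin_num. Qed.

(** Fubini on the half-plane [y <= x]. With [A] the derivative of a test function and [B] that of an
    absolutely continuous function, this is integration by parts. *)
Lemma triangle_fubini (A B : R -> R) : itg setT A -> itg setT B ->
  \int[leb R]_x (A x * \int[leb R]_y (if y <= x then B y else 0)) =
  \int[leb R]_y (B y * \int[leb R]_x (if y <= x then A x else 0)).
Proof.
move=> iA iB.
have mA := itg_measurable iA; have mB := itg_measurable iB.
pose f (p : measurableTypeR R * measurableTypeR R) :=
  (if p.2 <= p.1 then A p.1 * B p.2 else 0 : R).
have mf : measurable_fun setT f.
  apply: measurable_fun_ifT => //.
  - by apply: measurable_fun_ler; [exact: measurable_snd|exact: measurable_fst].
  - apply: measurable_funM.
    + exact: (measurableT_comp mA measurable_fst).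
    + exact: (measurableT_comp mB measurable_snd).
have iBx x : itg setT (fun y => if y <= x then B y else 0).
  apply: (@le_itg _ _ _ (fun y => `|B y|)) => //.
  - apply: measurable_fun_ifT => //.
    by apply: measurable_fun_ler; [exact: measurable_id|exact: measurable_cst].
  - by move=> y _; case: ifP => // _; rewrite normr0.
  - exact: itg_normr.
have iAy y : itg setT (fun x => if y <= x then A x else 0).
  apply: (@le_itg _ _ _ (fun x => `|A x|)) => //.
  - apply: measurable_fun_ifT => //.
    by apply: measurable_fun_ler; [exact: measurable_cst|exact: measurable_id].
  - by move=> x _; case: ifP => // _; rewrite normr0.
  - exact: itg_normr.
have intf : (leb R \x leb R)%E.-integrable setT (EFin \o f).
  apply/integrable12ltyP; first exact/measurable_EFinP.
  apply: (@le_lt_trans _ _ (\int[leb R]_x (`|A x| * \int[leb R]_y `|B y|)%:E)%E).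
    apply: ge0_le_integral => //.
    - by move=> x _; exact: integral_ge0.
    - apply: (measurable_fun_fubini_tonelli_F (abse \o (EFin \o f))) => //=.
      by apply: measurableT_comp => //; exact/measurable_EFinP.
    - apply/measurable_EFinP; apply: measurable_funM => //.
      exact: measurableT_comp.
    - move=> x _.
      apply: (@le_trans _ _ (\int[leb R]_y (`|A x| * `|B y|)%:E)%E).
        apply: ge0_le_integral => //.
        + apply: measurableT_comp => //; apply/measurable_EFinP.
          exact: (measurableT_comp mf (measurable_pair1 x)).
        + apply/measurable_EFinP; apply: measurable_funM => //.
          exact: measurableT_comp.
        + move=> y _; rewrite lee_fin /f/=; case: ifP => _; first by rewrite normrM.
          by rewrite normr0 mulr_ge0.
      rewrite itg_EFin//; last by apply: itgZ => //; exact: itg_normr.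
      by rewrite RintegralZl//; exact: itg_normr.
  rewrite itg_EFin ?ltry//.
  apply: (@eq_itg _ _ (fun x => (\int[leb R]_y `|B y|) * `|A x|)) => //.
    by move=> x _; rewrite mulrC.
  by apply: itgZ => //; exact: itg_normr.
have in1 x : (\int[leb R]_y (if (y <= x)%R then A x * B y else 0)%:E =
    (A x * \int[leb R]_y (if y <= x then B y else 0))%:E)%E.
  rewrite itg_EFin//; last first.
    apply: (@eq_itg _ _ (fun y => A x * (if y <= x then B y else 0))) => //.
      by move=> y _; case: ifP => _; rewrite ?mulr0.
    exact: itgZ.
  congr EFin; rewrite -(RintegralZl (A x) measurableT (iBx x)).
  by congr fine; apply: eq_integral => y _; case: ifP => _; rewrite ?mulr0.
have in2 y : (\int[leb R]_x (if (y <= x)%R then A x * B y else 0)%:E =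
    (B y * \int[leb R]_x (if y <= x then A x else 0))%:E)%E.
  rewrite itg_EFin//; last first.
    apply: (@eq_itg _ _ (fun x => B y * (if y <= x then A x else 0))) => //.
      by move=> x _; case: ifP => _; rewrite ?mulr0// mulrC.
    exact: itgZ.
  congr EFin; rewrite -(RintegralZl (B y) measurableT (iAy y)).
  by congr fine; apply: eq_integral => x _; case: ifP => _; rewrite ?mulr0// mulrC.
have E := Fubini intf.
apply: (congr1 fine).
under eq_integral do rewrite -in1.
by under [RHS]eq_integral do rewrite -in2.
Qed.

Lemma itg_support K F : itg `[- K, K] F -> (forall x, K < `|x| -> F x = 0) ->
  itg setT F /\ \int[leb R]_x F x = \int[leb R]_(x in `[- K, K]) F x.
Proof.
move=> iF F0.
have E : (fun x => if x \in `[- K, K]%classic then F x else 0) = F.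
  apply/funext => x; case: ifPn => // /negP; rewrite inE/= in_itv/= -ler_norml.
  by move=> /negP; rewrite -ltNge => /F0.
have mI : measurable `[- K, K]%classic by [].
by rewrite [RHS]Rint_if// E; split => //; move/(itg_mkcond F mI) : iF; rewrite E.
Qed.

Lemma test_function_support phi : test_function phi ->
  exists2 K : R, 0 < K & forall x, K <= `|x| -> phi x = 0 /\ derive1 phi x = 0.
Proof.
move=> [_ [M phi0]]; exists (`|M| + 1); first by rewrite ltr_wpDl.
move=> x Kx; have Mx : M < `|x|.
  by rewrite (lt_le_trans _ Kx)// (le_lt_trans (ler_norm M))// ltrDl.
split; first exact: phi0.
apply: derive1_eq; apply: (@near_eq_is_derive _ _ _ (cst 0)).
  have : \forall y \near x, M < `|y|.
    have /cvgrPdist_lt/(_ (`|x| - M)) := @norm_continuous R R x.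
    rewrite subr_gt0 => /(_ Mx); apply: filterS => y /=.
    have := ler_norm (`|x| - `|y|); lra.
  by apply: filterS => y /phi0.
Qed.

(** Integration by parts through [triangle_fubini]: on the support of [phi] the two inner integrals
    are [W x - W (- K)] and [- phi y], and the constant [W (- K)] disappears because the integral of
    [phi'] is zero. *)
Lemma prim_weak W G : prim W G -> is_weak_derivative W G.
Proof.
move=> p phi tphi; have [K K0 phiK] := test_function_support tphi.
have [[dphi cphi'] _] := tphi.
have dphi1 x : is_derive x 1 phi (derive1 phi x) by exact: derive1P.
have cphi : continuous phi.
  by move=> x; apply/differentiable_continuous/derivable1_diffP.
have cW := prim_continuous p.
have NK : - K <= K by lra.
have iphi' : itg setT (derive1 phi).
  apply: (itg_support (K := K) _ _).1; first exact: itg_cont.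
  by move=> x /ltW/phiK[].
have int_phi' a b : a <= b -> \int[leb R]_(x in `[a, b]) derive1 phi x = phi b - phi a.
  by move=> ab; exact: (Rint_derive ab (fun x _ => dphi1 x) (continuous_subspaceT cphi')).
have phiKK : phi K = 0 by apply: (phiK K _).1; rewrite gtr0_norm.
have phiNK : phi (- K) = 0 by apply: (phiK (- K) _).1; rewrite normrN gtr0_norm.
have mI : measurable `[- K, K]%classic by [].
(* [G] is only locally integrable, so it is cut off to an interval outside which [phi] and its
   derivative vanish. *)
pose B y := if y \in `[- K, K]%classic then G y else 0.
have iB : itg setT B by apply/(itg_mkcond G mI); exact: prim_itg p.
have := triangle_fubini iphi' iB.
have -> : (fun x => derive1 phi x * \int[leb R]_y (if y <= x then B y else 0)) =
    (fun x => W x * derive1 phi x - W (- K) * derive1 phi x).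
  apply/funext => x; case: (leP K `|x|) => [/phiK[_ ->]|]; first by rewrite !mulr0 mul0r subrr.
  rewrite ltr_norml => /andP[Kx xK].
  suff -> : \int[leb R]_y (if y <= x then B y else 0) = W x - W (- K) by ring.
  rewrite (prim_eq p (ltW Kx)) [RHS]Rint_if//; apply: eq_Rintegral => y _.
  rewrite /B; case: ifPn => yx.
    congr (if _ then _ else _); apply/idP/idP; rewrite !inE/= !in_itv/=.
      by move=> /andP[-> _].
    by move=> /andP[-> _]; rewrite (le_trans yx (ltW xK)).
  by rewrite ifF//; apply/negbTE/negP; rewrite inE/= in_itv/= (negbTE yx) andbF.
have -> : (fun y => B y * \int[leb R]_x (if y <= x then derive1 phi x else 0)) =
    (fun y => - (G y * phi y)).
  apply/funext => y; rewrite /B; case: ifPn; last first.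
    move=> /negP; rewrite inE/= in_itv/= -ler_norml => /negP; rewrite -ltNge => /ltW /phiK[-> _].
    by rewrite mul0r mulr0 oppr0.
  rewrite inE/= in_itv/= => /andP[Ky yK].
  suff -> : \int[leb R]_x (if y <= x then derive1 phi x else 0) = - phi y by ring.
  have -> : - phi y = phi K - phi y by rewrite phiKK sub0r.
  rewrite -int_phi'// [RHS]Rint_if//; apply: eq_Rintegral => x _.
  case: ifPn => yx; case: ifPn => //.
  - move=> /negP; rewrite inE/= in_itv/= yx/= => /negP; rewrite -ltNge => Kx.
    by apply: (phiK x _).2; rewrite (le_trans (ltW Kx))// ler_norm.
  - by rewrite inE/= in_itv/= (negbTE yx).
have iWphi : itg setT (fun x => W x * derive1 phi x).
  apply: (itg_support (K := K) _ _).1.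
    by apply: itg_cont => x; apply: cvgM; [exact: cW|exact: cphi'].
  by move=> x /ltW/phiK[_ ->]; rewrite mulr0.
have iGphi : itg setT (fun x => G x * phi x).
  apply: (itg_support (K := K) _ _).1; last by move=> x /ltW/phiK[-> _]; rewrite mulr0.
  have [N phiN] : exists N, forall x, - K <= x <= K -> `|phi x| <= N.
    have := compact_bounded (continuous_compact (continuous_subspaceT cphi) (segment_compact (a := - K) (b := K))).
    move=> [N [_ /(_ (N + 1))]]; rewrite ltrDl ltr01 => /(_ isT) h.
    by exists (N + 1) => x xK; apply: h; exists x => //=; rewrite in_itv.
  apply: (@eq_itg _ _ (fun x => phi x * G x)) => //; first by move=> x _; rewrite mulrC.
  apply: (@itgM _ _ _ _ N) => //; last exact: prim_itg p.
    by apply: measurable_funTS; exact: continuous_measurable_fun.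
rewrite RintegralB//; last exact: itgZ.
rewrite RintegralZl//.
have -> : \int[leb R]_x derive1 phi x = 0.
  rewrite (itg_support (K := K) _ _).2; last by move=> x /ltW/phiK[].
    by rewrite int_phi'// phiKK phiNK subrr.
  exact: itg_cont.
rewrite mulr0 subr0 => ->.
rewrite -[RHS]mulN1r -RintegralZl//; apply: eq_Rintegral => x _; by rewrite mulN1r.
Qed.

End weak_derivatives.

(** * Functions with vanishing weak derivative *)

Section du_Bois_Reymond.
Context {R : realType}.
Implicit Types (F G W : R -> R) (a b c d k x y t : R).

Lemma derD F G x a b : is_derive x 1 F a -> is_derive x 1 G b ->
  is_derive x 1 (fun x => F x + G x) (a + b).
Proof. exact: is_deriveD. Qed.

Lemma derB F G x a b : is_derive x 1 F a -> is_derive x 1 G b ->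
  is_derive x 1 (fun x => F x - G x) (a - b).
Proof. exact: is_deriveB. Qed.

Lemma derN F x a : is_derive x 1 F a -> is_derive x 1 (fun x => - F x) (- a).
Proof. exact: is_deriveN. Qed.

Lemma derM F G x a b : is_derive x 1 F a -> is_derive x 1 G b ->
  is_derive x 1 (fun x => F x * G x) (a * G x + F x * b).
Proof.
move=> dF dG; have := is_deriveM dF dG.
by rewrite -[_ *: b]/(_ * b) -[_ *: a]/(_ * a) addrC (mulrC _ a).
Qed.

Lemma derZ k F x a : is_derive x 1 F a -> is_derive x 1 (fun x => k * F x) (k * a).
Proof. exact: is_deriveZ. Qed.

Lemma derC k x : is_derive x 1 (fun=> k) 0.
Proof. exact: is_derive_cst. Qed.

Lemma derI x : is_derive x 1 (fun x => x) 1.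
Proof. exact: is_derive_id. Qed.

Lemma der_comp F G x a b : is_derive (G x) 1 F a -> is_derive x 1 G b ->
  is_derive x 1 (fun x => F (G x)) (a * b).
Proof. exact: is_derive1_comp. Qed.

Lemma contD F G : continuous F -> continuous G -> continuous (fun x => F x + G x).
Proof. by move=> cF cG x; apply: cvgD; [exact: cF|exact: cG]. Qed.

Lemma contB F G : continuous F -> continuous G -> continuous (fun x => F x - G x).
Proof. by move=> cF cG x; apply: cvgB; [exact: cF|exact: cG]. Qed.

Lemma contM F G : continuous F -> continuous G -> continuous (fun x => F x * G x).
Proof. by move=> cF cG x; apply: cvgM; [exact: cF|exact: cG]. Qed.

Lemma contC k : continuous (fun _ : R => k).
Proof. exact: cst_continuous. Qed.

Lemma contI : continuous (fun x : R => x).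
Proof. by move=> x; exact: cvg_id. Qed.

Lemma contX F n : continuous F -> continuous (fun x => F x ^+ n).
Proof.
move=> cF; elim: n => [|n IHn]; first exact: contC.
have -> : (fun x => F x ^+ n.+1) = (fun x => F x * F x ^+ n) by apply/funext => x; rewrite exprS.
exact: contM.
Qed.

Lemma cont_derive F G : (forall x, is_derive x 1 F (G x)) -> continuous F.
Proof.
by move=> dF x; have [d _] := dF x; apply/differentiable_continuous/derivable1_diffP.
Qed.

(** The derivative of the squared positive part is read off a quadratic remainder bound, which holds
    at 0 as elsewhere and is checked by cases on signs. *)
Lemma is_derive_quad F x d C : (forall h, `|F (x + h) - F x - d * h| <= C * h ^+ 2) ->
  is_derive x 1 F d.
Proof.
move=> FC.
have C0 : 0 <= C by have := le_trans (normr_ge0 _) (FC 1); rewrite expr1n mulr1.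
have cv : h^-1 *: (F (h *: (1 : R) + x) - F x) @[h --> 0^'] --> d.
  apply/cvgrPdist_le => e e0.
  have ec : 0 < e / (C + 1) by rewrite divr_gt0//; lra.
  near=> h.
  have h0 : h != 0 by near: h; exact: nbhs_dnbhs_neq.
  have he : `|h| <= e / (C + 1) by near: h; exact: dnbhs0_le.
  rewrite /= [X in F (X + _)]mulr1 (addrC h).
  have -> : d - h^-1 *: (F (x + h) - F x) = - h^-1 * (F (x + h) - F x - d * h).
    by rewrite -[_ *: _]/(h^-1 * (F (x + h) - F x)); field.
  rewrite normrM normrN normfV mulrC ler_pdivrMr ?normr_gt0//.
  apply: le_trans (FC h) _; rewrite -(real_normK (num_real h)).
  move: he; rewrite ler_pdivlMr; last by lra.
  have := normr_ge0 h; nra.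
by split; [apply/cvg_ex; exists d|exact/cvg_lim].
Unshelve. all: by end_near. Qed.

(** The square of the positive part. A second difference of it is the $C^1$ step [smooth_step],
    rising from 0 to [d ^+ 2]; its derivative [tent] is a hat of height [d] supported in
    [[x0 - d, x0 + d]]. *)
Definition psq (s : R) := s * Num.max s 0.

Definition smooth_step x0 d t :=
  (psq (t - x0 + d) - 2 * psq (t - x0) + psq (t - x0 - d)) / 2.

Definition tent x0 d t :=
  Num.max (t - x0 + d) 0 - 2 * Num.max (t - x0) 0 + Num.max (t - x0 - d) 0.

Lemma is_derive_step x0 d t : is_derive t 1 (smooth_step x0 d) (tent x0 d t).
Proof.
have D c : is_derive t 1 (fun t : R => psq (t + c)) (2 * Num.max (t + c) 0).
  apply: (@is_derive_quad _ _ _ 1) => h; rewrite /psq mul1r ler_norml.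
  by case: (leP (t + h + c) 0) => h1; case: (leP (t + c) 0) => h2; apply/andP; split; nra.
have -> : smooth_step x0 d = fun t : R => 2^-1 * (psq (t + (- x0 + d)) + (- 2) * psq (t + (- x0)) + psq (t + (- x0 - d))).
  by apply/funext => s; rewrite /smooth_step !addrA; ring.
have := derZ 2^-1 (derD (derD (D (- x0 + d)) (derZ (- 2) (D (- x0)))) (D (- x0 - d))).
suff -> : forall a b c, 2^-1 * (2 * a + - 2 * (2 * b) + 2 * c) = a - 2 * b + c :> R.
  by rewrite /tent -!addrA.
by move=> a b c; field.
Qed.

Lemma continuous_tent x0 d : continuous (tent x0 d).
Proof.
have C c : continuous (fun t : R => Num.max (t + c) (0 : R)).
  move=> t; apply: (@continuous_max _ _ (fun t => t + c) (cst 0) t).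
    by apply: cvgD; [exact: cvg_id|exact: cvg_cst].
  exact: cvg_cst.
move=> t; rewrite /tent.
apply: (@cvgD _ _ _ _ _ (fun t => Num.max (t - x0 + d) 0 - 2 * Num.max (t - x0) 0)).
  apply: cvgB; last by apply: cvgM; [exact: cvg_cst|exact: C].
  under eq_fun do rewrite -addrA; rewrite -addrA; exact: C.
under eq_fun do rewrite -addrA; rewrite -addrA; exact: C.
Qed.

Lemma tent_ge0 x0 d t : 0 <= d -> 0 <= tent x0 d t.
Proof.
move=> d0; rewrite /tent.
by case: (leP (t - x0 + d) 0) => h1; case: (leP (t - x0) 0) => h2;
  case: (leP (t - x0 - d) 0) => h3; lra.
Qed.

Lemma tent_out x0 d t : 0 <= d -> d <= `|t - x0| -> tent x0 d t = 0.
Proof.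
move=> d0; rewrite /tent ler_normr => /orP h.
by case: (leP (t - x0 + d) 0) => h1; case: (leP (t - x0) 0) => h2;
  case: (leP (t - x0 - d) 0) => h3; case: h => h; lra.
Qed.

Lemma step_left x0 d t : 0 <= d -> t <= x0 - d -> smooth_step x0 d t = 0.
Proof.
move=> d0 h; rewrite /smooth_step /psq.
by rewrite !max_r; [ring|lra..].
Qed.

Lemma step_right x0 d t : 0 <= d -> x0 + d <= t -> smooth_step x0 d t = d ^+ 2.
Proof.
move=> d0 h; rewrite /smooth_step /psq.
by rewrite !max_l; [field|lra..].
Qed.

Lemma averages_gap (e D a b p q : R) : 0 < e -> 0 < D -> a - b = 4 * e ->
  q <= (b + e) * D -> (a - e) * D <= p -> p - q = 0 -> False.
Proof.
move=> e0 D0 ab qb pa pq; have := mulr_gt0 e0 D0.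
have E : (b + e) * D = (a - e) * D - 2 * (e * D).
  have -> : b = a - 4 * e by lra.
  by ring.
by rewrite E in qb; lra.
Qed.

(** Testing with the difference of two steps, at [x] and at [y], equates the averages of [u] against
    two tents of equal mass. If [u y < u x], tents narrow enough for [u] to vary by less than a
    quarter of the gap contradict this. Only monotonicity is concluded; applied to [u] and to its
    opposite it gives constancy. *)
Lemma weak_derivative_zero_const (u : R -> R) : continuous u ->
  (forall phi, test_function phi -> \int[leb R]_x (u x * derive1 phi x) = 0) ->
  forall x y, x <= y -> u x <= u y.
Proof.
move=> cu u0 x y xy; rewrite leNgt; apply/negP => uyx.
set e := (u x - u y) / 4; have e0 : 0 < e by rewrite divr_gt0// subr_gt0.
have near_u z : exists2 d, 0 < d & forall t, `|t - z| < d -> `|u t - u z| < e.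
  have /cvgrPdist_lt/(_ e e0) := cu z.
  move=> /nbhs_ballP[d /= d0 h]; exists d => // t tz.
  by rewrite distrC; apply: h; rewrite /ball/= distrC.
have [d1 d10 h1] := near_u x; have [d2 d20 h2] := near_u y.
pose d := Num.min d1 d2.
have d0 : 0 < d by rewrite lt_min d10.
have hx t : `|t - x| < d -> u x - e <= u t.
  rewrite lt_min => /andP[/h1 + _]; rewrite ltr_norml => /andP[]; lra.
have hy t : `|t - y| < d -> u t <= u y + e.
  rewrite lt_min => /andP[_ /h2]; rewrite ltr_norml => /andP[]; lra.
pose phi t := smooth_step x d t - smooth_step y d t.
have dphi t : is_derive t 1 phi (tent x d t - tent y d t).
  by have := is_derive_step x d t; have := is_derive_step y d t => D1 D2; exact: is_deriveB.
have dphiE : derive1 phi = fun t => tent x d t - tent y d t.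
  by apply/funext => t; exact: derive1_eq.
have tphi : test_function phi.
  split.
    split; first by move=> t; have [] := dphi t.
    by rewrite dphiE => t; apply: cvgB; exact: continuous_tent.
  exists (`|x| + `|y| + d) => t; rewrite lter_normr => /orP[ht|ht]; rewrite /phi.
    rewrite !step_right ?subrr ?ltW//; have := ler_norm x; have := ler_norm y;
    have := normr_ge0 x; have := normr_ge0 y; move: ht; clear; lra.
  rewrite !step_left ?subrr ?ltW//; have := ler_norm (- x); have := ler_norm (- y);
  rewrite !normrN; have := normr_ge0 x; have := normr_ge0 y; move: ht; clear; lra.
have := u0 _ tphi; rewrite dphiE.
have cut z : continuous (fun t => u t * tent z d t).
  by move=> t; apply: cvgM; [exact: cu|exact: continuous_tent].
pose K := `|x| + `|y| + d.
have Kxy z : z = x \/ z = y -> - K <= z - d /\ z + d <= K.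
  rewrite /K; have := ler_norm x; have := ler_norm y; have := ler_norm (- x); have := ler_norm (- y).
  rewrite !normrN; have := normr_ge0 x; have := normr_ge0 y.
  by move: d0; clear=> ? ? ? ? ? ? ? [->|->]; split; lra.
have supp z : z = x \/ z = y -> forall t, K < `|t| -> tent z d t = 0.
  move=> /Kxy[zK Kz] t Kt; apply: tent_out; first exact: ltW.
  by rewrite ler_normr; apply/orP; move: Kt; rewrite lter_normr => /orP[] Kt; [left|right]; move: zK Kz Kt; clear; lra.
have tot z : z = x \/ z = y -> \int[leb R]_(t in `[- K, K]) tent z d t = d ^+ 2.
  move=> /Kxy[zK Kz].
  have NKK : - K <= K by lra.
  rewrite (Rint_derive NKK (fun t _ => is_derive_step z d t) (continuous_subspaceT (@continuous_tent z d))).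
  by rewrite (step_right (ltW d0) Kz) (step_left (ltW d0) zK) subr0.
have sx := supp x (or_introl erefl); have sy := supp y (or_intror erefl).
have tx := tot x (or_introl erefl); have ty := tot y (or_intror erefl).
have ix z : z = x \/ z = y -> itg setT (fun t => u t * tent z d t) /\
    \int[leb R]_t (u t * tent z d t) = \int[leb R]_(t in `[- K, K]) (u t * tent z d t).
  move=> zz; apply: itg_support; first exact: itg_cont.
  by move=> t Kt; rewrite supp// mulr0.
have [i1 e1] := ix x (or_introl erefl); have [i2 e2] := ix y (or_intror erefl).
under eq_Rintegral do rewrite mulrBr.
rewrite RintegralB// e1 e2.
have itent z : itg `[- K, K] (tent z d) by apply: itg_cont; exact: continuous_tent.
have : (u x - e) * d ^+ 2 <= \int[leb R]_(t in `[- K, K]) (u t * tent x d t).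
  rewrite -tx -(RintZ _ (itent x)); apply: Rint_le; [exact: itgZ|exact: itg_cont|].
  move=> t _; case: (ltP `|t - x| d) => [/hx ut|dt]; last first.
    by rewrite tent_out ?mulr0// ltW.
  by rewrite ler_wpM2r// tent_ge0// ltW.
have : \int[leb R]_(t in `[- K, K]) (u t * tent y d t) <= (u y + e) * d ^+ 2.
  rewrite -ty -(RintZ _ (itent y)); apply: Rint_le; [exact: itg_cont|exact: itgZ|].
  move=> t _; case: (ltP `|t - y| d) => [/hy ut|dt]; last first.
    by rewrite tent_out ?mulr0// ltW.
  by rewrite ler_wpM2r// tent_ge0// ltW.
have : 0 < d ^+ 2 by rewrite exprn_gt0.
have : u x - u y = 4 * e by rewrite /e; field.
move=> h3 h4 h5 h6 h7; exact: (averages_gap e0 h4 h3 h5 h6 h7).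
Qed.

Lemma sqi_itg F a b : sqi F -> itg `[a, b] F.
Proof.
move=> [mF iF]; apply: (@le_itg _ _ _ (fun x => 1 + F x ^+ 2)) => //.
- exact: measurable_funTS.
- move=> x _; rewrite -(real_normK (num_real (F x))).
  by have := sqr_ge0 (`|F x| - 1); nra.
- by apply: itgD => //; [exact: itg_cst|exact: itgS iF].
Qed.

(** Integrals over reversed intervals are zero, so at most one of the two terms of the witness is
    nonzero and the formula is valid on both sides of the origin. *)
Lemma prim_exists G : (forall a b, itg `[a, b] G) -> exists W, prim W G.
Proof.
move=> iG.
exists (fun x => \int[leb R]_(t in `[0, x]) G t - \int[leb R]_(t in `[x, 0]) G t).
have z x y : y <= x -> \int[leb R]_(t in `[x, y]) G t = 0.
  rewrite le_eqVlt => /predU1P[->|yx]; first by rewrite Rint_pt.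
  by rewrite set_itv_ge ?bnd_simp -?ltNge// Rintegral_set0.
move=> a b ab; split=> //.
case: (leP 0 a) => a0.
  have b0 := le_trans a0 ab.
  by rewrite (z a 0)// (z b 0)// !subr0 (Rint_cat a0 ab)//; ring.
rewrite (z 0 a) ?(ltW a0)//; case: (leP 0 b) => b0.
  by rewrite (z b 0)// (Rint_cat (ltW a0) b0 (iG _ _)); ring.
by rewrite (z 0 b) ?(ltW b0)// (Rint_cat ab (ltW b0) (iG _ _)); ring.
Qed.

(** The difference between [w] and a primitive [W] of [g] has zero weak derivative; it and its
    opposite are nondecreasing, hence it is constant. *)
Lemma weak_prim (w g : R -> R) : continuous w -> (forall a b, itg `[a, b] g) ->
  is_weak_derivative w g -> prim w g.
Proof.
move=> cw ig wg; have [W p] := prim_exists ig.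
have cW := prim_continuous p.
have z0 phi : test_function phi -> \int[leb R]_x ((w x - W x) * derive1 phi x) = 0 /\
    \int[leb R]_x ((W x - w x) * derive1 phi x) = 0.
  move=> tphi; have [K K0 phiK] := test_function_support tphi.
  have [[_ cphi'] _] := tphi.
  have i (f : R -> R) : continuous f -> itg setT (fun x => f x * derive1 phi x).
    move=> cf; apply: (itg_support (K := K) _ _).1.
      by apply: itg_cont => x; apply: cvgM; [exact: cf|exact: cphi'].
    by move=> x /ltW/phiK[_ ->]; rewrite mulr0.
  have e1 := wg _ tphi; have e2 := prim_weak p tphi.
  split; under eq_Rintegral do rewrite mulrBl; rewrite RintegralB ?e1 ?e2 ?subrr//; exact: i.
have cB (f g' : R -> R) : continuous f -> continuous g' -> continuous (fun x => f x - g' x : R).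
  by move=> cf cg x; apply: cvgB; [exact: cf|exact: cg].
have h1 := weak_derivative_zero_const (cB _ _ cw cW) (fun phi tphi => (z0 phi tphi).1).
have h2 := weak_derivative_zero_const (cB _ _ cW cw) (fun phi tphi => (z0 phi tphi).2).
move=> a b ab; have [i <-] := p _ _ ab; split=> //.
by have := h1 _ _ ab; have := h2 _ _ ab; lra.
Qed.

End du_Bois_Reymond.

(** * Minimality on the half-line *)

Section energy_of_pairs.
Context {R : realType}.
Variable mu : R -> R.
Hypothesis mu_C1 : C1 mu.
Hypothesis mu_even : forall x, mu (- x) = mu x.
Variable M : R.
Hypothesis mu_le : forall x, `|mu x| <= M.
Notation f := (forcing mu).
Hypothesis f_L43 : itg setT (fun x => `|f x| `^ (4 / 3)).
Implicit Types (F G W v g w : R -> R) (a b c d k x y t eps al : R).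

Lemma mu_derive x : is_derive x 1 mu (derive1 mu x).
Proof. by have [d _] := mu_C1; exact: derive1P. Qed.

Lemma mu_continuous : continuous mu.
Proof.
by have [d _] := mu_C1; move=> x; apply/differentiable_continuous/derivable1_diffP.
Qed.

Lemma f_continuous : continuous f.
Proof.
have [_ c] := mu_C1; move=> x; apply: cvgM; last exact: cvg_cst.
by apply: cvgN; exact: c.
Qed.

Lemma f_odd x : f (- x) = - f x.
Proof.
rewrite /forcing; suff -> : derive1 mu (- x) = - derive1 mu x by ring.
have D : is_derive x 1 (fun y => mu (- y)) (derive1 mu (- x) * - 1).
  exact: (der_comp (mu_derive (- x)) (derN (derI x))).
have := derive1_eq D; have -> : (fun y => mu (- y)) = mu by exact/funext.
by move=> ->; ring.
Qed.

Definition density eps al w g x :=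
  eps / 2 * `|g x| ^+ 2 - (2 * eps)^-1 * mu x * w x ^+ 2
  + (4 * eps)^-1 * w x ^+ 4 - al * f x * w x.

(** Writing [a] as a cube turns Young's inequality with exponents 4/3 and 4 into polynomial
    inequalities. *)
Lemma cube_root a : 0 <= a -> exists s, [/\ 0 <= s, s ^+ 3 = a & s ^+ 4 = a `^ (4 / 3)].
Proof.
move=> a0; exists (a `^ (3^-1)); split; first exact: powR_ge0.
- by rewrite -powR_mulrn ?powR_ge0// -powRrM mulVf ?powRr1.
- by rewrite -powR_mulrn ?powR_ge0// -powRrM mulrC.
Qed.

(** The duality between $L^{4/3}$ and $L^4$ that makes the force term integrable for every element
    of $H^1$. *)
Lemma young43 a b : 0 <= a -> 0 <= b -> a * b <= a `^ (4 / 3) + b ^+ 4.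
Proof.
move=> /cube_root[s [s0 <- <-]] b0.
have s3 : 0 <= s ^+ 3 by exact: exprn_ge0.
have b3 : 0 <= b ^+ 3 by exact: exprn_ge0.
have s4 : s ^+ 4 = s ^+ 3 * s by rewrite exprSr.
have b4 : b ^+ 4 = b ^+ 3 * b by rewrite exprSr.
case: (leP b s) => h; first by nra.
have : s ^+ 3 <= b ^+ 3 by rewrite lerXn2r ?nnegrE// ltW.
nra.
Qed.

Lemma pow4_itg w g : H1p w g -> itg setT (fun x => w x ^+ 4).
Proof.
move=> H; have [N wN] := H1p_bounded H; have [_ [mw iw] _] := H.
apply: (@eq_itg _ _ (fun x => w x ^+ 2 * w x ^+ 2)) => //.
  by move=> x _; ring.
apply: (@itgM _ _ _ _ (N ^+ 2)) => //; first exact: measurable_funX.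
move=> x _; rewrite normrX ler_sqr ?nnegrE//.
exact: le_trans (normr_ge0 _) (wN x).
Qed.

Lemma f_mul_itg w g : H1p w g -> itg setT (fun x => f x * w x).
Proof.
move=> H; have [_ [mw iw] _] := H.
apply: (@le_itg _ _ _ (fun x => `|f x| `^ (4 / 3) + w x ^+ 4)) => //.
- by apply: measurable_funM => //; apply: continuous_measurable_fun; exact: f_continuous.
- move=> x _; rewrite normrM; have := young43 (normr_ge0 (f x)) (normr_ge0 (w x)).
  by rewrite -normrX (ger0_norm (exprn_even_ge0 _ _)).
- by apply: itgD => //; exact: pow4_itg H.
Qed.

Lemma density_itg eps al w g : H1p w g -> itg setT (density eps al w g).
Proof.
move=> H; have [p [mw iw] [mg ig]] := H.
have i1 : itg setT (fun x => eps / 2 * `|g x| ^+ 2).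
  apply: itgZ => //; apply: (@eq_itg _ _ (fun x => g x ^+ 2)) => // x _.
  by rewrite real_normK ?num_real.
have i2 : itg setT (fun x => (2 * eps)^-1 * mu x * w x ^+ 2).
  apply: (@eq_itg _ _ (fun x => (2 * eps)^-1 * (mu x * w x ^+ 2))) => //.
    by move=> x _; rewrite mulrA.
  apply: itgZ => //; apply: (@itgM _ _ _ _ M) => //.
  by apply: continuous_measurable_fun; exact: mu_continuous.
have i4 : itg setT (fun x => al * f x * w x).
  apply: (@eq_itg _ _ (fun x => al * (f x * w x))) => //.
    by move=> x _; rewrite mulrA.
  by apply: itgZ => //; exact: f_mul_itg H.
by apply: itgB => //; apply: itgD => //; [exact: itgB|apply: itgZ => //; exact: pow4_itg H].
Qed.

Lemma H1p_H1 w g : H1p w g -> H1 w.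
Proof.
move=> [p sw sg]; split; first exact/sqiP.
by exists g; [exact/sqiP|exact: prim_weak].
Qed.

Lemma H1_H1p w : H1 w -> continuous w -> exists g, H1p w g.
Proof.
move=> [/sqiP sw [g /sqiP sg wg]] cw; exists g; split=> //.
by apply: weak_prim => // a b; exact: sqi_itg.
Qed.

(** Any two derivatives of [w] agree almost everywhere, so the energy may be computed with the
    derivative at hand. *)
Lemma energyE eps al w g : H1p w g -> energy mu eps al w = \int[leb R]_x density eps al w g x.
Proof.
move=> H; have [p sw sg] := H.
have [/sqiP sg' wg'] : (weak_derivative w \in Lfun (leb R) 2%:E) /\
    is_weak_derivative w (weak_derivative w).
  apply: (@xgetPex _ (fun=> 0)
    [set g : R -> R | g \in Lfun (leb R) 2%:E /\ is_weak_derivative w g]).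
  by exists g; split; [exact/sqiP|exact: prim_weak].
have cw := prim_continuous p.
have H' : H1p w (weak_derivative w).
  by split=> //; apply: weak_prim => // a b; exact: sqi_itg.
apply: ae_eq_Rintegral => //.
- by apply: itg_measurable; exact: (density_itg eps al H').
- by apply: itg_measurable; exact: density_itg.
have [p' _ _] := H'; have := prim_ae_unique p' p.
apply: filterS; first exact: (ae_filter_ringOfSetsType (leb R)).
by move=> x h _; rewrite /density h.
Qed.

Lemma H1p_paste c W1 G1 W2 G2 : H1p W1 G1 -> H1p W2 G2 -> W1 c = W2 c ->
  H1p (paste c W1 W2) (paste c G1 G2).
Proof.
move=> [p1 s1 t1] [p2 s2 t2] e; split; [exact: prim_paste|exact: sqi_paste|exact: sqi_paste].
Qed.

Definition refl W := fun x : R => - W (- x).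

Lemma H1p_refl W G : H1p W G -> H1p (refl W) (fun x => G (- x)).
Proof.
move=> [p s t]; split; [exact: prim_opp| |exact: sqi_opp].
have -> : refl W = fun x => (- 1) * W (- x) by apply/funext => x; rewrite mulN1r.
exact/sqiZ/sqi_opp.
Qed.

Lemma density_refl eps al W G x :
  density eps al (refl W) (fun x => G (- x)) x = density eps al W G (- x).
Proof. by rewrite /density /refl mu_even f_odd; ring. Qed.

Lemma density_paste eps al c W1 G1 W2 G2 x :
  density eps al (paste c W1 W2) (paste c G1 G2) x =
  paste c (density eps al W1 G1) (density eps al W2 G2) x.
Proof. by rewrite /density /paste; case: ifP. Qed.

Lemma energy_refl eps al W G : H1p W G -> energy mu eps al (refl W) = energy mu eps al W.
Proof.
move=> H; rewrite (energyE _ _ H) (energyE _ _ (H1p_refl H)).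
rewrite -(Rintegral_opp (itg_measurable (density_itg eps al H))).
by apply: eq_Rintegral => x _; rewrite density_refl.
Qed.

Lemma Rint_split c F : itg setT F ->
  \int[leb R]_x F x = \int[leb R]_(x in `]-oo, c[) F x + \int[leb R]_(x in `[c, +oo[) F x.
Proof.
move=> iF.
have E : `]-oo, c[%classic `|` `[c, +oo[%classic = [set: R].
  apply/seteqP; split => // x _ /=; rewrite !in_itv/= andbT.
  by case: (leP c x); [right|left].
rewrite -[in LHS]E Rintegral_setU ?E//.
apply/disj_setPS => x [/=]; rewrite !in_itv/= andbT => xc.
by rewrite leNgt xc.
Qed.

Lemma Rint_paste c F1 F2 : itg setT F1 -> itg setT F2 ->
  \int[leb R]_x paste c F1 F2 x =
  \int[leb R]_(x in `]-oo, c[) F1 x + \int[leb R]_(x in `[c, +oo[) F2 x.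
Proof.
move=> i1 i2; rewrite (Rint_split c (itg_paste c i1 i2)); congr (_ + _).
- apply: eq_Rintegral => x; rewrite inE/= in_itv/= /paste => xc.
  by rewrite leNgt xc.
- by apply: eq_Rintegral => x; rewrite inE/= in_itv/= /paste andbT => ->.
Qed.

Lemma Rint_refl_half F : itg setT F ->
  \int[leb R]_(x in `]-oo, 0[) F (- x) = \int[leb R]_(x in `[0, +oo[) F x.
Proof.
move=> iF.
rewrite -(Rintegral_itv_obnd_cbnd (r := 0)); last exact: itgS iF.
rewrite Rint_if// [RHS]Rint_if//.
have i : itg setT (fun x => if x \in `]0, +oo[%classic then F x else 0).
  by apply/(itg_mkcond F) => //; exact: itgS iF.
rewrite -(Rintegral_opp (itg_measurable i)); apply: eq_Rintegral => x _.
by congr (if _ then _ else _); apply/idP/idP; rewrite !inE/= !in_itv/= oppr_gt0 andbT.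
Qed.

(* Shared by global and odd minimizers: an odd function is determined by its
   restriction to the half-line, so that the odd extensions of the pairs with
   value [v 0] at the origin are admissible competitors. *)
Record half_minimal eps al v g : Prop := {
  hm_pair : H1p v g;
  hm_energy : \int[leb R]_x density eps al v g x <= 0;
  hm_min : forall W G, H1p W G -> W 0 = v 0 ->
    \int[leb R]_(x in `[0, +oo[) density eps al v g x <=
    \int[leb R]_(x in `[0, +oo[) density eps al W G x }.

Lemma H1p0 : H1p (fun=> 0 : R) (fun=> 0 : R).
Proof. split; [exact: prim_cst|exact: sqi0|exact: sqi0]. Qed.

Lemma energy0 eps al : energy mu eps al (fun=> 0) = 0.
Proof.
rewrite (energyE _ _ H1p0) (_ : density eps al _ _ = fun=> 0).
  by rewrite Rintegral_cst// mul0r.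
by apply/funext => x; rewrite /density normr0; ring.
Qed.

(** The competitor keeps [v] on the left of the origin and takes [W] on the right; equality at 0
    makes the gluing admissible, and the left parts of the two energies cancel. *)
Lemma global_half_minimal eps al v : global_minimizer mu eps al v ->
  exists g, half_minimal eps al v g.
Proof.
move=> [[Hv vmin] cv]; have [g H] := H1_H1p Hv cv; exists g; split=> //.
  by rewrite -energyE// -(energy0 eps al); apply: vmin; exact: H1p_H1 H1p0.
move=> W G HW W0.
have HP : H1p (paste 0 v W) (paste 0 g G) by exact: H1p_paste.
have := vmin _ (H1p_H1 HP).
rewrite (energyE _ _ HP) (energyE _ _ H).
under [leRHS]eq_Rintegral do rewrite density_paste.
rewrite Rint_paste; [|exact: density_itg|exact: density_itg].
by rewrite (Rint_split 0 (density_itg eps al H)) lerD2l.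
Qed.

(** This is what allows the left half of [v] to be treated as a right half: evenness of [mu] and
    oddness of [f] make the energy invariant under [refl]. *)
Lemma global_minimizer_refl eps al v : global_minimizer mu eps al v ->
  global_minimizer mu eps al (refl v).
Proof.
move=> [[Hv vmin] cv]; have [g H] := H1_H1p Hv cv; split; last first.
  by move=> x; apply: cvgN; apply: (continuous_comp (f := -%R)); [exact: opp_continuous|exact: cv].
split; first exact: H1p_H1 (H1p_refl H).
by move=> w /vmin h; rewrite (energy_refl _ _ H).
Qed.

Lemma energy_odd_ext eps al W G : H1p W G -> W 0 = 0 ->
  exists G2, H1p (paste 0 (refl W) W) G2 /\
  energy mu eps al (paste 0 (refl W) W) =
    2 * \int[leb R]_(x in `[0, +oo[) density eps al W G x.
Proof.
move=> H W0; have Hr := H1p_refl H.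
have HP : H1p (paste 0 (refl W) W) (paste 0 (fun x => G (- x)) G).
  by apply: H1p_paste => //; rewrite /refl oppr0 W0 oppr0.
exists (paste 0 (fun x => G (- x)) G); split=> //.
rewrite (energyE _ _ HP).
under eq_Rintegral do rewrite density_paste.
rewrite Rint_paste; [|exact: density_itg|exact: density_itg].
under eq_Rintegral do rewrite density_refl.
by rewrite (Rint_refl_half (density_itg eps al H)); ring.
Qed.

Lemma odd_half_minimal eps al u : odd_minimizer mu eps al u ->
  exists g, half_minimal eps al u g.
Proof.
move=> [[[Hu uodd] umin] cu]; have [g H] := H1_H1p Hu cu; exists g.
have u0 : u 0 = 0 by have := uodd 0; rewrite oppr0; lra.
have ru : refl u = u by apply/funext => x; rewrite /refl uodd opprK.
split=> //.
  rewrite -energyE// -(energy0 eps al); apply: umin; split; first exact: H1p_H1 H1p0.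
  by move=> x; rewrite oppr0.
move=> W G HW; rewrite u0 => W0.
have [G2 [HP eP]] := energy_odd_ext eps al HW W0.
have [_ [_ eu]] := energy_odd_ext eps al H u0.
have pu : paste 0 (refl u) u = u by apply/funext => x; rewrite ru /paste; case: ifP.
rewrite pu in eu.
have : energy mu eps al u <= energy mu eps al (paste 0 (refl W) W).
  apply: umin; split; first exact: H1p_H1 HP.
  move=> x; rewrite /paste /refl; have [->|x0] := eqVneq x 0.
    by rewrite oppr0 lexx W0 oppr0.
  by case: (ltgtP 0 x) x0 => // hx _; rewrite oppr_ge0 ?opprK; case: ifP => //; lra.
by rewrite eu eP; lra.
Qed.

End energy_of_pairs.

(** * Competitors on a bounded interval, and the first variation *)

Section local_minimality.
Context {R : realType}.
Variable mu : R -> R.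
Hypothesis mu_C1 : C1 mu.
Variable M : R.
Hypothesis mu_le : forall x, `|mu x| <= M.
Notation f := (forcing mu).
Hypothesis f_L43 : itg setT (fun x => `|f x| `^ (4 / 3)).
Implicit Types (F G W v g w : R -> R) (a b c d k x y t eps al : R).
Notation dens := (density mu).

Lemma sqi_patch a b v W : sqi v -> measurable_fun setT W ->
  itg `[a, b] (fun x => W x ^+ 2) -> sqi (paste b (paste a v W) v).
Proof.
move=> [mv iv] mW iW; have mP : measurable_fun setT (paste b (paste a v W) v).
  by apply: measurable_if => //; exact: measurable_if.
split=> //.
apply: (@le_itg _ _ _ (fun x => v x ^+ 2 + (if x \in `[a, b]%classic then W x ^+ 2 else 0))) => //.
- exact: measurable_funX.
- move=> x _; rewrite normrX real_normK ?num_real// /paste.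
  have v2 := sqr_ge0 (v x); have W2 := sqr_ge0 (W x).
  case: (leP b x) => bx; first by case: ifP; lra.
  case: (leP a x) => ax; last by case: ifP; lra.
  by rewrite mem_set/=; [lra|rewrite in_itv/= ax ltW].
- by apply: itgD => //; apply/(itg_mkcond (fun x => W x ^+ 2)).
Qed.

(** [W] is extended by [v] outside [[a, b]]. As [0 <= a], the value at the origin is unchanged (by
    [W a = v a] when [a = 0]), so the extension is admissible in [hm_min]. *)
Lemma local_min eps al v g W G a b : half_minimal mu eps al v g ->
  0 <= a -> a <= b -> prim W G -> itg `[a, b] (fun x => G x ^+ 2) ->
  W a = v a -> W b = v b ->
  \int[leb R]_(x in `[a, b]) dens eps al v g x <=
  \int[leb R]_(x in `[a, b]) dens eps al W G x.
Proof.
move=> [H _ hmin] a0 ab pW iG Wa Wb; have [pv sv sg] := H.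
have cW := prim_continuous pW.
pose W' := paste b (paste a v W) v; pose G' := paste b (paste a g G) g.
have pin : paste a v W b = v b by rewrite /paste ab.
have H' : H1p W' G'.
  split.
  - by apply: prim_paste => //; exact: prim_paste.
  - apply: sqi_patch => //; first exact: continuous_measurable_fun.
    by apply: itg_cont; exact: contX.
  - by apply: sqi_patch => //; exact: prim_measurable pW.
have W'0 : W' 0 = v 0.
  rewrite /W' /paste; case: (leP b 0) => // b0; case: (leP a 0) => // a0'.
  by have <- : a = 0 by apply/eqP; rewrite eq_le a0 a0'.
have i := density_itg mu_C1 mu_le f_L43 eps al H.
have i' := density_itg mu_C1 mu_le f_L43 eps al H'.
have := hmin _ _ H' W'0; rewrite -subr_ge0.
rewrite -RintegralB//; last 2 first.
- exact: itgS i'.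
- exact: itgS i.
have iab : itg `[a, b] (fun x => dens eps al W' G' x) by exact: itgS i'.
have E x : a <= x < b -> dens eps al W' G' x = dens eps al W G x.
  move=> /andP[ax xb]; have xb' : (b <= x) = false by rewrite leNgt xb.
  by rewrite /density /W' /G' /paste xb' ax.
rewrite -(eq_Rint_co E iab) -subr_ge0 -RintB//; last exact: itgS i.
pose h x := dens eps al W' G' x - dens eps al v g x.
have ih : itg setT h by exact: itgB.
have ih' : itg `[a, b] h by exact: itgS ih.
rewrite -(Rintegral_itv_bndo_bndc (r := b) (f := h)); last first.
  by apply: itgS ih' => //; exact: sub_co.
rewrite Rint_if// [X in _ -> _ <= X]Rint_if//.
rewrite (_ : (fun x => if x \in `[0, +oo[%classic then _ else _) =
  (fun x => if x \in `[a, b[%classic then h x else 0))//.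
apply/funext => x.
case: ifPn => [|/negP]; rewrite inE/= in_itv/= ?andbT => x0; last first.
  rewrite ifF//; apply/negbTE/negP; rewrite inE/= in_itv/= => /andP[ax _].
  by apply: x0; rewrite (le_trans a0).
case: ifPn => // /negP; rewrite inE/= in_itv/= => /negP nx.
rewrite /density /W' /G' /paste.
case: (leP b x) => bx; first by rewrite subrr.
case: (leP a x) => ax; last by rewrite subrr.
by rewrite ax bx in nx.
Qed.

(** Changing the sign of [v] beyond its zero [a] alters the density by [2 * al * (f x * v x)] there
    and by nothing elsewhere. *)
Lemma flip_infinity eps al v g a : half_minimal mu eps al v g -> 0 < al -> 0 <= a -> v a = 0 ->
  ~ (forall x, a < x -> f x * v x < 0).
Proof.
move=> [H _ hmin] al0 a0 va fv; have [pv sv sg] := H.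
have HN : H1p (fun x => (- 1) * v x) (fun x => (- 1) * g x).
  by split; [exact: primZ|exact: sqiZ|exact: sqiZ].
have H' : H1p (paste a v (fun x => (- 1) * v x)) (paste a g (fun x => (- 1) * g x)).
  by apply: H1p_paste => //; rewrite va mulr0.
have i := density_itg mu_C1 mu_le f_L43 eps al H.
have i' := density_itg mu_C1 mu_le f_L43 eps al H'.
have e0 : paste a v (fun x => (- 1) * v x) 0 = v 0.
  rewrite /paste; case: (leP a 0) => // a0'.
  by have <- : a = 0 by [apply/eqP; rewrite eq_le a0 a0']; rewrite va mulr0.
have := hmin _ _ H' e0; rewrite -subr_ge0.
rewrite -RintegralB//; [|exact: itgS i'|exact: itgS i].
set h := (fun x => _ - _).
have hE x : h x = if a <= x then 2 * al * (f x * v x) else 0.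
  rewrite /h density_paste /paste; case: ifP => // ax; last by rewrite subrr.
  by rewrite /density normrM normrN1 mul1r; ring.
have h_le x : h x <= 0.
  rewrite hE; case: ifP => //; rewrite le_eqVlt => /predU1P[<-|/fv fvx].
    by rewrite va !mulr0.
  by rewrite pmulr_rle0 ?mulr_gt0//; exact: ltW.
have ih : itg setT h by exact: itgB.
have cfv : continuous (fun x => f x * v x).
  by move=> x; apply: cvgM; [exact: f_continuous|exact: prim_continuous pv x].
(* The change of density is nonpositive everywhere; its strict negativity is measured on the compact
   interval [[a + 1, a + 2]], where the product of [f] and [v] has a negative maximum. *)
have a12 : a + 1 <= a + 2 by lra.
have [c cab cmax] := EVT_max a12 (continuous_subspaceT (A := `[a + 1, a + 2]%classic) cfv).
have fc : f c * v c < 0.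
  by apply: fv; move: cab; rewrite in_itv/= => /andP[]; lra.
apply/negP; rewrite -ltNge.
have : \int[leb R]_(x in `[0, +oo[) h x <= \int[leb R]_(x in `[a + 1, a + 2]) h x.
  rewrite Rint_if// [leRHS]Rint_if//; apply: le_Rintegral => //.
  - by apply/(itg_mkcond h) => //; exact: itgS ih.
  - by apply/(itg_mkcond h) => //; exact: itgS ih.
  - move=> x _; case: ifPn => [|/negP]; rewrite inE/= in_itv/= ?andbT => x0.
      by case: ifP.
    rewrite ifF//; apply/negbTE/negP; rewrite inE/= in_itv/= => /andP[ax _].
    by apply: x0; lra.
move=> /le_lt_trans; apply.
apply: (@le_lt_trans _ _ (\int[leb R]_(x in `[a + 1, a + 2]) (2 * al * (f c * v c)))).
  apply: Rint_le; [exact: itgS ih|exact: itg_cst|].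
  move=> x /andP[x1 x2]; rewrite hE ifT; last by lra.
  by rewrite ler_pM2l ?mulr_gt0//; apply: cmax; rewrite in_itv/= x1.
rewrite Rint_cst; last by lra.
by rewrite pmulr_llt0; [rewrite pmulr_rlt0 ?mulr_gt0|lra].
Qed.

(** For [t = - Num.sg L * s] with [s = |L| / (4 N)], which is at most 1, the terms of higher degree
    are at most [s ^+ 2 * N = s * |L| / 4], whereas the linear one is [- s * |L|]. *)
Lemma quartic_linear_part (L Q C D : R) :
  (forall t, 0 <= t * L + t ^+ 2 * Q + t ^+ 3 * C + t ^+ 4 * D) -> L = 0.
Proof.
move=> h; apply/eqP; case: eqP => // /eqP L0.
pose N := 1 + `|L| + `|Q| + `|C| + `|D|.
have N1 : 1 <= N.
  by rewrite /N; have := normr_ge0 L; have := normr_ge0 Q; have := normr_ge0 C; have := normr_ge0 D; lra.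
have N0 : 0 < N by lra.
pose s := `|L| / (4 * N).
have nL : 0 < `|L| by rewrite normr_gt0.
have s0 : 0 < s by rewrite divr_gt0//; lra.
have s1 : s <= 1.
  rewrite ler_pdivrMr; last by lra.
  by rewrite /N; have := normr_ge0 Q; have := normr_ge0 C; have := normr_ge0 D; lra.
have sN : s * N = `|L| / 4 by rewrite /s; field; rewrite gt_eqF.
have := h (- Num.sg L * s).
have sg2 : Num.sg L ^+ 2 = 1 by rewrite sqr_sg L0.
have -> : - Num.sg L * s * L = - (s * `|L|) by rewrite normrEsg; ring.
have -> : (- Num.sg L * s) ^+ 2 = s ^+ 2.
  by rewrite exprMn sqrrN sg2 mul1r.
have -> : (- Num.sg L * s) ^+ 3 = - Num.sg L * s ^+ 3.
  have -> : (- Num.sg L * s) ^+ 3 = - Num.sg L * s ^+ 3 * Num.sg L ^+ 2 by ring.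
  by rewrite sg2 mulr1.
have -> : (- Num.sg L * s) ^+ 4 = s ^+ 4.
  have -> : (- Num.sg L * s) ^+ 4 = s ^+ 4 * (Num.sg L ^+ 2) ^+ 2 by ring.
  by rewrite sg2 expr1n mulr1.
have s2 : 0 < s ^+ 2 by rewrite exprn_gt0.
have s3 : s ^+ 3 <= s ^+ 2 by rewrite exprSr ler_piMr// ltW.
have s4 : s ^+ 4 <= s ^+ 2.
  have -> : s ^+ 4 = s ^+ 2 * s ^+ 2 by ring.
  by rewrite ler_piMr ?(ltW s2)// exprn_ile1// ltW.
have s30 : 0 <= s ^+ 3 by rewrite exprn_ge0// ltW.
have s40 : 0 <= s ^+ 4 by rewrite exprn_ge0// ltW.
have bQ : s ^+ 2 * Q <= s ^+ 2 * `|Q| by rewrite ler_wpM2l ?ler_norm// ltW.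
have bC : - Num.sg L * s ^+ 3 * C <= s ^+ 2 * `|C|.
  apply: le_trans (ler_norm _) _; rewrite (normrM _ C) (normrM (- Num.sg L)) normrN normr_sg L0 mul1r.
  by rewrite (ger0_norm s30) ler_wpM2r.
have bD : s ^+ 4 * D <= s ^+ 2 * `|D|.
  apply: le_trans (ler_norm _) _; by rewrite (normrM _ D) (ger0_norm s40) ler_wpM2r.
have : s ^+ 2 * N = s * (`|L| / 4) by rewrite -sN; ring.
have sL : 0 < s * `|L| by rewrite mulr_gt0.
have : s ^+ 2 * (`|Q| + `|C| + `|D|) <= s ^+ 2 * N.
  by rewrite ler_pM2l// /N; lra.
rewrite !mulrDr; lra.
Qed.

(** The nonlinearity of the Euler-Lagrange equation, in the form
    $\epsilon^2v''=-\mathtt{reaction}$. *)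
Definition reaction eps al v x := mu x * v x - v x ^+ 3 + eps * al * f x.

Lemma reaction_continuous eps al v : continuous v -> continuous (reaction eps al v).
Proof.
move=> cv; have cmu := mu_continuous mu_C1; have cf := f_continuous mu_C1.
apply: contD; first by apply: contB; [exact: contM|exact: contX].
by apply: contM => //; exact: contC.
Qed.

End local_minimality.

(** * Regularity *)

Section regularity.
Context {R : realType}.
Variable mu : R -> R.
Hypothesis mu_C1 : C1 mu.
Variable M : R.
Hypothesis mu_le : forall x, `|mu x| <= M.
Notation f := (forcing mu).
Hypothesis f_L43 : itg setT (fun x => `|f x| `^ (4 / 3)).
Implicit Types (F G W v g w : R -> R) (a b c d k x y t eps al : R).
Notation dens := (density mu).

Lemma antiderivative (k_ : R -> R) : continuous k_ ->
  exists F : R -> R, forall x, is_derive x 1 F (k_ x).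
Proof.
move=> ck; have [W p] := prim_exists (fun a b => itg_cont a b ck).
exists W => x.
have x1 : x < x + 1 by lra.
have [] := continuous_FTC1_closed x1 (itg_cont (x - 1) (x + 1) ck) _ (ck x).
  by lra.
set F := (fun _ => _) => dF F'x.
have DF : is_derive x 1 F (k_ x) by rewrite -F'x; exact: derive1P.
have D := derD (derC (W (x - 1)) x) DF.
rewrite add0r in D; apply: near_eq_is_derive D.
have : \forall y \near x, x - 1 < y by apply: lt_nbhsr; lra.
apply: filterS => y xy; rewrite /F -(prim_eq p (ltW xy)); ring.
Qed.

(** The hat with values 0, 1, 0 at [a], [b], [c]. It is prolonged affinely instead of being cut off,
    because variations are only compared on [[a, c]]. *)
Definition hat a b c := paste b (fun x => (b - a)^-1 * x + - (a / (b - a)))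
  (fun x => - (c - b)^-1 * x + c / (c - b)).
Definition hat' a b c := paste b (fun=> (b - a)^-1) (fun=> - (c - b)^-1 : R).

Lemma prim_hat a b c : a < b -> b < c -> prim (hat a b c) (hat' a b c).
Proof.
move=> ab bc; apply: prim_paste; [exact: prim_affine|exact: prim_affine|].
by field; rewrite !subr_eq0 !gt_eqF.
Qed.

Lemma density_expand eps al v g h h' t x : eps != 0 ->
  dens eps al (fun x => v x + t * h x) (fun x => g x + t * h' x) x =
  dens eps al v g x + (t * (eps * (h' x * g x) - eps^-1 * (reaction mu eps al v x * h x))
    + t ^+ 2 * (eps / 2 * (h' x * h' x) + (- (2 * eps)^-1 * mu x * h x ^+ 2
                + 6 * (4 * eps)^-1 * v x ^+ 2 * h x ^+ 2))
    + t ^+ 3 * (eps^-1 * v x * h x ^+ 3) + t ^+ 4 * ((4 * eps)^-1 * h x ^+ 4)).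
Proof.
by move=> e0; rewrite /density /reaction !real_normK ?num_real//; field.
Qed.

Lemma Rint_lin4 a b F1 F2 F3 F4 k1 k2 k3 k4 :
  itg `[a, b] F1 -> itg `[a, b] F2 -> itg `[a, b] F3 -> itg `[a, b] F4 ->
  \int[leb R]_(x in `[a, b]) (k1 * F1 x + k2 * F2 x + k3 * F3 x + k4 * F4 x) =
  k1 * \int[leb R]_(x in `[a, b]) F1 x + k2 * \int[leb R]_(x in `[a, b]) F2 x
  + k3 * \int[leb R]_(x in `[a, b]) F3 x + k4 * \int[leb R]_(x in `[a, b]) F4 x.
Proof.
move=> i1 i2 i3 i4.
have mI : measurable `[a, b]%classic by [].
have j1 := itgZ k1 mI i1; have j2 := itgZ k2 mI i2.
have j3 := itgZ k3 mI i3; have j4 := itgZ k4 mI i4.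
have j12 := itgD mI j1 j2; have j123 := itgD mI j12 j3.
by rewrite (RintD j123 j4) (RintD j12 j3) (RintD j1 j2) !RintZ.
Qed.

(** The first variation in the direction of a hat vanishes. As the derivative of the hat is constant
    on each side of [b], its pairing with [g] is a difference of slopes of [v]: the Euler-Lagrange
    equation in integrated form, before any second derivative is known to exist. *)
Lemma secant_identity eps al v g a b c : half_minimal mu eps al v g -> 0 < eps ->
  0 <= a -> a < b -> b < c ->
  (v b - v a) / (b - a) - (v c - v b) / (c - b) =
  eps ^- 2 * \int[leb R]_(x in `[a, c]) (reaction mu eps al v x * hat a b c x).
Proof.
move=> H e0 a0 ab bc; have [[pv sv sg] _ _] := H.
have ac := lt_trans ab bc.
have ph := prim_hat ab bc; set h := hat a b c; set h' := hat' a b c.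
have ch : continuous h := prim_continuous ph.
have cv := prim_continuous pv.
have cmu := mu_continuous mu_C1; have cf := f_continuous mu_C1.
have cr : continuous (reaction mu eps al v) by exact: reaction_continuous.
have mh' : measurable_fun `[a, c] h'.
  by apply: measurable_funTS; exact: prim_measurable ph.
pose N := (b - a)^-1 + (c - b)^-1.
have hN x : `|h' x| <= N.
  have i1 : 0 < (b - a)^-1 by rewrite invr_gt0; lra.
  have i2 : 0 < (c - b)^-1 by rewrite invr_gt0; lra.
  by rewrite /h' /hat' /paste /N; case: ifP => _; rewrite ler_norml; apply/andP; split; lra.
have ig : itg `[a, c] g by exact: sqi_itg.
have ih' : itg `[a, c] h' by exact: prim_itg ph.
have ihg : itg `[a, c] (fun x => h' x * g x) by apply: (@itgM _ _ _ _ N).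
have ihh : itg `[a, c] (fun x => h' x * h' x) by apply: (@itgM _ _ _ _ N).
have irh : itg `[a, c] (fun x => reaction mu eps al v x * h x).
  by apply: itg_cont; exact: contM.
pose L x := eps * (h' x * g x) - eps^-1 * (reaction mu eps al v x * h x).
pose Q x := eps / 2 * (h' x * h' x) + (- (2 * eps)^-1 * mu x * h x ^+ 2
                + 6 * (4 * eps)^-1 * v x ^+ 2 * h x ^+ 2).
pose C x := eps^-1 * v x * h x ^+ 3.
pose D x := (4 * eps)^-1 * h x ^+ 4.
have iL : itg `[a, c] L by apply: itgB => //; exact: itgZ.
have iQ : itg `[a, c] Q.
  apply: itgD => //; first exact: itgZ.
  apply: itg_cont; apply: contD; apply: contM; try exact: contX.
    by apply: contM => //; exact: contC.
  by apply: contM; [exact: contC|exact: contX].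
have iC : itg `[a, c] C.
  by apply: itg_cont; apply: contM; [apply: contM => //; exact: contC|exact: contX].
have iD : itg `[a, c] D.
  by apply: itg_cont; apply: contM; [exact: contC|exact: contX].
have id : itg `[a, c] (dens eps al v g).
  by apply: itgS (density_itg mu_C1 mu_le f_L43 eps al (hm_pair H)).
have h_a : h a = 0.
  by rewrite /h /hat /paste leNgt ab/=; field; rewrite subr_eq0 gt_eqF.
have h_c : h c = 0.
  by rewrite /h /hat /paste ltW//; field; rewrite subr_eq0 gt_eqF.
have : \int[leb R]_(x in `[a, c]) L x = 0.
  apply: (@quartic_linear_part _ _ (\int[leb R]_(x in `[a, c]) Q x)
    (\int[leb R]_(x in `[a, c]) C x) (\int[leb R]_(x in `[a, c]) D x)) => t.
  have pW : prim (fun x => v x + t * h x) (fun x => g x + t * h' x).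
    by apply: primD => //; exact: primZ.
  have iG : itg `[a, c] (fun x => (g x + t * h' x) ^+ 2).
    apply: (@eq_itg _ _ (fun x => g x ^+ 2 + (2 * t * (h' x * g x) + t ^+ 2 * (h' x * h' x)))) => //.
      by move=> x _; ring.
    apply: itgD => //; first by have [_ i] := sg; exact: itgS i.
    by apply: itgD => //; exact: itgZ.
  have := local_min mu_C1 mu_le f_L43 H a0 (ltW ac) pW iG.
  rewrite h_a h_c mulr0 !addr0 => /(_ erefl erefl).
  under [X in _ <= X -> _]eq_Rintegral do rewrite density_expand ?gt_eqF//.
  have iP : itg `[a, c] (fun x => t * L x + t ^+ 2 * Q x + t ^+ 3 * C x + t ^+ 4 * D x).
    by apply: itgD => //; [apply: itgD => //; [apply: itgD => //|]|]; exact: itgZ.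
  by rewrite (RintD id iP) lerDl Rint_lin4.
rewrite RintB; [|exact: itgZ|exact: itgZ].
rewrite !RintZ// => /eqP; rewrite subr_eq0 => /eqP e1.
have -> : eps ^- 2 * \int[leb R]_(x in `[a, c]) (reaction mu eps al v x * h x) =
   \int[leb R]_(x in `[a, c]) (h' x * g x).
  have -> : eps ^- 2 = eps^-1 * eps^-1 by rewrite -exprVn expr2.
  by rewrite -mulrA -e1; field; rewrite gt_eqF.
rewrite (Rint_cat (ltW ab) (ltW bc) ihg); congr (_ + _).
  rewrite -(@eq_Rint_co _ _ _ (fun x => (b - a)^-1 * g x)).
  - by rewrite RintZ ?(prim_eq pv (ltW ab)); [rewrite mulrC|exact: sqi_itg].
  - by move=> x /andP[_ xb]; rewrite /h' /hat' /paste leNgt xb.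
  - by apply: itgZ => //; exact: sqi_itg.
rewrite -(@eq_Rint _ _ _ (fun x => - (c - b)^-1 * g x)).
- by rewrite RintZ ?(prim_eq pv (ltW bc)); [rewrite mulrC mulNr|exact: sqi_itg].
- by move=> x /andP[bx _]; rewrite /h' /hat' /paste bx.
Qed.

Lemma affine_of_secants (u : R -> R) :
  (forall a b c, 0 < a -> a < b -> b < c -> (u b - u a) / (b - a) = (u c - u b) / (c - b)) ->
  forall x, 0 < x -> u x = u 1 + (x - 1) * (u 2 - u 1).
Proof.
move=> s x x0.
have e b a : b != a -> forall k l, k / (b - a) = l -> k = l * (b - a) :> R.
  by move=> ba k l <-; rewrite divfK// subr_eq0.
case: (ltgtP x 1) => [x1|x1|->]; last by ring.
- have h := s x 1 2 x0 x1 (ltr1n R 2).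
  have := e _ _ _ _ _ h; rewrite gt_eqF// => /(_ isT); have -> : (2 - 1 : R) = 1 by ring.
  by rewrite invr1 mulr1 => E; have : u 1 - u x = (u 2 - u 1) * (1 - x) by []; lra.
- case: (ltgtP x 2) => [x2|x2|->]; last by ring.
    have h := s 1 x 2 ltr01 x1 x2.
    have x1n : x - 1 != 0 by rewrite subr_eq0 gt_eqF.
    have x2n : 2 - x != 0 by rewrite subr_eq0 gt_eqF.
    have : (u x - u 1) * (2 - x) = (u 2 - u x) * (x - 1).
      have : (u x - u 1) / (x - 1) * ((x - 1) * (2 - x)) = (u 2 - u x) / (2 - x) * ((x - 1) * (2 - x)).
        by rewrite h.
      by rewrite mulrA divfK// => ->; field.
    by lra.
  have h := s 1 2 x ltr01 (ltr1n R 2) x2.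
  have := e _ _ _ _ _ (esym h); rewrite gt_eqF// => /(_ isT); have -> : (2 - 1 : R) = 1 by ring.
  by rewrite invr1 mulr1; lra.
Qed.

Record regular_solution eps al v V V1 : Prop := {
  rs_eq : forall x, 0 <= x -> V x = v x;
  rs_der : forall x, is_derive x 1 V (V1 x);
  rs_der2 : forall x, 0 < x -> is_derive x 1 V1 (- reaction mu eps al V x / eps ^+ 2);
  rs_cont : continuous V1 }.

(** On the half-line [v] is an affine function minus a multiple of a second antiderivative of its
    reaction, so it is of class $C^2$. The same formula extends it beyond the origin as a $C^1$
    function. *)
Lemma half_minimal_regular eps al v g : half_minimal mu eps al v g -> 0 < eps ->
  exists V V1, regular_solution eps al v V V1.
Proof.
move=> H e0; have [[pv sv sg] _ _] := H.
have cv := prim_continuous pv.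
have cr : continuous (reaction mu eps al v) by exact: reaction_continuous.
have [F1 dF1] := antiderivative cr.
have cF1 := cont_derive dF1.
have [F2 dF2] := antiderivative cF1.
have en : eps != 0 by rewrite gt_eqF.
(* Adding the second antiderivative [F2] cancels the right side of [secant_identity], so that all
   secant slopes of [u] agree. *)
pose u x := v x + eps ^- 2 * F2 x.
have su a b c : 0 < a -> a < b -> b < c -> (u b - u a) / (b - a) = (u c - u b) / (c - b).
  move=> a0 ab bc; have ac := lt_trans ab bc.
  have := secant_identity H e0 (ltW a0) ab bc.
  have -> : \int[leb R]_(x in `[a, c]) (reaction mu eps al v x * hat a b c x) =
     - (F2 b - F2 a) / (b - a) + (F2 c - F2 b) / (c - b).
    have ch := prim_continuous (prim_hat ab bc).
    rewrite (Rint_cat (ltW ab) (ltW bc)); last by apply: itg_cont; exact: contM.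
    have ban : b - a != 0 by rewrite subr_eq0 gt_eqF.
    have cbn : c - b != 0 by rewrite subr_eq0 gt_eqF.
    pose P1 x := F1 x * ((b - a)^-1 * x + - (a / (b - a))) - (b - a)^-1 * F2 x.
    pose P2 x := F1 x * (- (c - b)^-1 * x + c / (c - b)) - (- (c - b)^-1) * F2 x.
    have caff k l : continuous (fun x => k * x + l).
      by apply: contD; [apply: contM; [exact: contC|exact: contI]|exact: contC].
    have daff k l x : is_derive x 1 (fun x => k * x + l) k.
      by have := derD (derZ k (derI x)) (derC l x); rewrite mulr1 addr0.
    have dP k l x : is_derive x 1 (fun x => F1 x * (k * x + l) - k * F2 x)
        (reaction mu eps al v x * (k * x + l)).
      have := derB (derM (dF1 x) (daff k l x)) (derZ k (dF2 x)).
      by rewrite (mulrC k (F1 x)) addrK.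
    rewrite -(@eq_Rint_co _ _ _ (fun x => reaction mu eps al v x * ((b - a)^-1 * x + - (a / (b - a))))); last 2 first.
    - by move=> x /andP[_ xb]; rewrite /hat /paste leNgt xb.
    - by apply: itg_cont; exact: contM.
    rewrite -(@eq_Rint _ b c (fun x => reaction mu eps al v x * (- (c - b)^-1 * x + c / (c - b)))); last first.
      by move=> x /andP[bx _]; rewrite /hat /paste bx.
    rewrite (Rint_derive (ltW ab) (fun x _ => dP (b - a)^-1 (- (a / (b - a))) x)); last first.
      by apply: continuous_subspaceT; exact: contM.
    rewrite (Rint_derive (ltW bc) (fun x _ => dP (- (c - b)^-1) (c / (c - b)) x)); last first.
      by apply: continuous_subspaceT; exact: contM.
    by field; rewrite ?ban ?cbn.
  rewrite /u => E; apply/eqP; rewrite -subr_eq0; apply/eqP.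
  have -> : (v b + eps ^- 2 * F2 b - (v a + eps ^- 2 * F2 a)) / (b - a) -
     (v c + eps ^- 2 * F2 c - (v b + eps ^- 2 * F2 b)) / (c - b) =
     ((v b - v a) / (b - a) - (v c - v b) / (c - b)) -
     eps ^- 2 * (- (F2 b - F2 a) / (b - a) + (F2 c - F2 b) / (c - b)).
    ring.
  by rewrite E subrr.
have aff := affine_of_secants su.
pose V x := u 1 + (x - 1) * (u 2 - u 1) - eps ^- 2 * F2 x.
pose V1 x := (u 2 - u 1) - eps ^- 2 * F1 x.
have dV x : is_derive x 1 V (V1 x).
  have := derB (derD (derC (u 1) x) (derM (derB (derI x) (derC 1 x)) (derC (u 2 - u 1) x))) (derZ (eps ^- 2) (dF2 x)).
  by rewrite mulr0 addr0 add0r subr0 mul1r.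
have cV := cont_derive dV.
have Vpos x : 0 < x -> V x = v x.
  by move=> x0; rewrite /V -(aff _ x0) /u; ring.
(* The secants are only taken at positive abscissas; the value at the origin follows by
   continuity. *)
have V0 : V 0 = v 0.
  have cB : continuous (fun x => V x - v x) by exact: contB.
  apply/eqP; rewrite -subr_eq0; apply/eqP.
  apply: (@cvg_unique _ _ ((fun x => V x - v x) @ 0^'+)) => //.
    by apply: cvg_at_right_filter; exact: cB.
  apply: cvg_near_cst; near=> x; rewrite Vpos ?subrr//.
exists V, V1; split=> //.
- by move=> x; rewrite le_eqVlt => /predU1P[<-//|/Vpos].
- move=> x x0; have := derB (derC (u 2 - u 1) x) (derZ (eps ^- 2) (dF1 x)).
  by rewrite sub0r {1}/reaction /= -(Vpos x x0) -/(reaction mu eps al V x) mulNr mulrC.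
- by apply: contB; [exact: contC|apply: contM => //; exact: contC].
Unshelve. all: by end_near. Qed.

End regularity.

(** * A bound in $L^4$ that is uniform in [eps] *)

Lemma young43_weighted {R : realType} (A a b : R) : 1 <= A -> 0 <= a -> 0 <= b ->
  A * (a * b) <= b ^+ 4 / 16 + 16 * A ^+ 2 * a `^ (4 / 3).
Proof.
move=> A1 /cube_root[s [s0 <- <-]] b0.
have s4 : s ^+ 4 = s ^+ 3 * s by rewrite exprSr.
have b4 : b ^+ 4 = b ^+ 3 * b by rewrite exprSr.
have s3 : 0 <= s ^+ 3 by exact: exprn_ge0.
have b3 : 0 <= b ^+ 3 by exact: exprn_ge0.
have b40 : 0 <= b ^+ 4 by exact: exprn_ge0.
have s40 : 0 <= s ^+ 4 by exact: exprn_ge0.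
have A2 : 1 <= A ^+ 2 by rewrite exprn_ege1.
case: (leP b (16 * A * s)) => h.
  have : A * (s ^+ 3 * b) <= A * (s ^+ 3 * (16 * A * s)).
    by rewrite ler_wpM2l ?ler_wpM2l//; lra.
  have -> : A * (s ^+ 3 * (16 * A * s)) = 16 * A ^+ 2 * s ^+ 4 by rewrite s4; ring.
  by lra.
have : (16 * A * s) ^+ 3 <= b ^+ 3.
  have q0 : 0 <= 16 * A * s by rewrite !mulr_ge0//; lra.
  by rewrite lerXn2r ?nnegrE// ltW.
have -> : (16 * A * s) ^+ 3 = 4096 * A ^+ 2 * (A * s ^+ 3) by ring.
move=> h3.
have h4 : 4096 * A ^+ 2 * (A * s ^+ 3) * b <= b ^+ 3 * b by rewrite ler_wpM2r.
have X0 : 0 <= A * (s ^+ 3 * b) by rewrite !mulr_ge0 ?exprn_ge0// (le_trans ler01).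
have h5 : A * (s ^+ 3 * b) <= A ^+ 2 * (A * (s ^+ 3 * b)) by rewrite ler_peMl.
have : 0 <= 16 * A ^+ 2 * s ^+ 4 by rewrite mulr_ge0// mulr_ge0// sqr_ge0.
have : 4096 * A ^+ 2 * (A * s ^+ 3) * b = 4096 * (A ^+ 2 * (A * (s ^+ 3 * b))) by ring.
by rewrite b4; lra.
Qed.

Section good_solutions.
Context {R : realType}.
Variable mu : R -> R.
Hypothesis mu_C1 : C1 mu.
Variable M : R.
Hypothesis mu_le : forall x, `|mu x| <= M.
Notation f := (forcing mu).
Hypothesis f_L43 : itg setT (fun x => `|f x| `^ (4 / 3)).
Variable K : R.
Hypothesis mu_out : forall x, K < `|x| -> mu x <= 0.
Implicit Types (F G W v g w : R -> R) (a b c d k x y t eps al A : R).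
Notation dens := (density mu).

Let P x := Num.max (mu x) 0 ^+ 2.

Let iP : itg setT P.
Proof.
have cP : continuous P.
  apply: contX => x; apply: (@continuous_max _ _ mu (cst 0) x); last exact: cvg_cst.
  exact: mu_continuous.
apply: (itg_support (K := K) _ _).1; first exact: itg_cont.
by move=> x /mu_out mx; rewrite /P max_r// expr0n.
Qed.

Definition L4_bound A := 8 * (\int[leb R]_x P x) + 256 * A ^+ 2 * (\int[leb R]_x (`|f x| `^ (4 / 3))).

(** The quartic term has coefficient [1 / (4 eps)]. The term in [mu] takes half of it and the force,
    as [eps <= 1], a quarter, by [young43_weighted]; [1 / (16 eps)] is left. Since the energy is
    nonpositive, multiplication by [16 * eps] gives a bound free of [eps]. *)
Lemma half_minimal_L4 A eps al v g : half_minimal mu eps al v g ->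
  0 < eps -> eps <= 1 -> 1 <= A -> 0 <= al <= A ->
  \int[leb R]_x (v x ^+ 4) <= L4_bound A.
Proof.
move=> [H hE _] e0 e1 A1 /andP[al0 alA].
have i4 := pow4_itg H.
have pw x : (16 * eps)^-1 * v x ^+ 4 <= dens eps al v g x +
    ((2 * eps)^-1 * P x + 16 * A ^+ 2 * `|f x| `^ (4 / 3)).
  have v40 : 0 <= v x ^+ 4 by rewrite exprn_even_ge0.
  have h1 : al * f x * v x <= v x ^+ 4 / 16 + 16 * A ^+ 2 * `|f x| `^ (4 / 3).
    have := young43_weighted A1 (normr_ge0 (f x)) (normr_ge0 (v x)).
    have -> : `|v x| ^+ 4 = v x ^+ 4 by rewrite -normrX ger0_norm.
    apply: le_trans; rewrite -mulrA; apply: le_trans (ler_norm _) _.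
    by rewrite normrM normrM (ger0_norm al0) ler_wpM2r.
  have h2 : mu x * v x ^+ 2 <= v x ^+ 4 / 4 + P x.
    have := sqr_ge0 (v x ^+ 2 / 2 - Num.max (mu x) 0).
    have : mu x * v x ^+ 2 <= Num.max (mu x) 0 * v x ^+ 2.
      by rewrite ler_wpM2r ?sqr_ge0// le_max lexx.
    have -> : (v x ^+ 2 / 2 - Num.max (mu x) 0) ^+ 2 =
      v x ^+ 4 / 4 - Num.max (mu x) 0 * v x ^+ 2 + P x by rewrite /P; field.
    by lra.
  have ei : 1 <= eps^-1 by rewrite invf_ge1.
  have E2 : (2 * eps)^-1 = eps^-1 / 2 by field; rewrite gt_eqF.
  have E4 : (4 * eps)^-1 = eps^-1 / 4 by field; rewrite gt_eqF.
  have E16 : (16 * eps)^-1 = eps^-1 / 16 by field; rewrite gt_eqF.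
  rewrite /density E2 E4 E16.
  have g2 : 0 <= eps / 2 * `|g x| ^+ 2 by rewrite mulr_ge0 ?sqr_ge0//; lra.
  have h3 : eps^-1 * (mu x * v x ^+ 2) <= eps^-1 * (v x ^+ 4 / 4 + P x).
    by rewrite ler_wpM2l//; lra.
  have h4 : v x ^+ 4 <= eps^-1 * v x ^+ 4 by rewrite ler_peMl.
  have -> : eps^-1 / 2 * mu x * v x ^+ 2 = eps^-1 * (mu x * v x ^+ 2) / 2 by ring.
  by lra.
have id := density_itg mu_C1 mu_le f_L43 eps al H.
have iB : itg setT (fun x => (2 * eps)^-1 * P x + 16 * A ^+ 2 * `|f x| `^ (4 / 3)).
  by apply: itgD => //; exact: itgZ.
have : \int[leb R]_x ((16 * eps)^-1 * v x ^+ 4) <= \int[leb R]_x (dens eps al v g x +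
    ((2 * eps)^-1 * P x + 16 * A ^+ 2 * `|f x| `^ (4 / 3))).
  by apply: le_Rintegral => //; [exact: itgZ|exact: itgD].
have j1 : itg setT (fun x => (2 * eps)^-1 * P x) by exact: itgZ.
have j2 : itg setT (fun x => 16 * A ^+ 2 * `|f x| `^ (4 / 3)) by exact: itgZ.
rewrite (RintegralZl _ measurableT i4) (RintegralD measurableT id iB).
rewrite (RintegralD measurableT j1 j2) (RintegralZl _ measurableT iP).
rewrite (RintegralZl _ measurableT f_L43) /L4_bound.
have q0 : 0 <= \int[leb R]_x `|f x| `^ (4 / 3).
  by apply: Rintegral_ge0 => x _; exact: powR_ge0.
move: q0; move: (\int[leb R]_x (v x ^+ 4)) (\int[leb R]_x P x) => I4 IP.
move: (\int[leb R]_x dens eps al v g x) (\int[leb R]_x (`|f x| `^ (4 / 3))) hE => IE Iq hE q0 h.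
have h' : (16 * eps)^-1 * I4 <= (2 * eps)^-1 * IP + 16 * A ^+ 2 * Iq by lra.
have : 16 * eps * ((16 * eps)^-1 * I4) <= 16 * eps * ((2 * eps)^-1 * IP + 16 * A ^+ 2 * Iq).
  by rewrite ler_wpM2l//; lra.
have -> : 16 * eps * ((16 * eps)^-1 * I4) = I4 by field; rewrite gt_eqF.
have -> : 16 * eps * ((2 * eps)^-1 * IP + 16 * A ^+ 2 * Iq) = 8 * IP + eps * (256 * A ^+ 2 * Iq).
  by field; rewrite gt_eqF.
have Aq : 0 <= 256 * A ^+ 2 * Iq.
  exact: (mulr_ge0 (mulr_ge0 (ler0n _ _) (sqr_ge0 A)) q0).
have : eps * (256 * A ^+ 2 * Iq) <= 256 * A ^+ 2 * Iq by rewrite ler_piMl.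
lra.
Qed.

(* [V] coincides with a minimizer on the half-line [0, +oo[ only: to the left of
   the origin it is an arbitrary C^1 extension. *)
Record good C eps al V V1 : Prop := {
  gd_der : forall x, is_derive x 1 V (V1 x);
  gd_der2 : forall x, 0 < x -> is_derive x 1 V1 (- reaction mu eps al V x / eps ^+ 2);
  gd_cont : continuous V1;
  gd_min : forall W G a b, 0 <= a -> a <= b -> prim W G ->
    itg `[a, b] (fun x => G x ^+ 2) -> W a = V a -> W b = V b ->
    \int[leb R]_(x in `[a, b]) dens eps al V V1 x <=
    \int[leb R]_(x in `[a, b]) dens eps al W G x;
  gd_inf : forall a, 0 <= a -> V a = 0 -> ~ (forall x, a < x -> f x * V x < 0);
  gd_L4 : forall a b, 0 <= a -> a < b ->
    exists2 c, a <= c <= b & V c ^+ 4 * (b - a) <= C }.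

(** Gathers all that is used about a minimizer afterwards: the equation, minimality on intervals,
    the exclusion of an infinite flip, and the $L^4$ bound in pointwise form. *)
Lemma half_minimal_good A eps al v g : half_minimal mu eps al v g ->
  0 < eps -> eps <= 1 -> 1 <= A -> 0 < al -> al <= A ->
  exists V V1, (forall x, 0 <= x -> V x = v x) /\ good (L4_bound A) eps al V V1.
Proof.
move=> H e0 e1 A1 al0 alA.
have [V [V1 [Veq dV dV1 cV1]]] := half_minimal_regular mu_C1 mu_le f_L43 H e0.
exists V, V1; split=> //.
have [Hp _ _] := H; have [pv sv sg] := Hp.
have pV := prim_derive dV cV1.
have cV := cont_derive dV.
(* [g] and [paste 0 g V1] are both derivatives of [v], hence [g = V1] almost everywhere on the
   half-line and either can be used in the energy. *)
have pp : prim v (paste 0 g V1).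
  have := prim_paste pv pV (esym (Veq 0 (lexx 0))).
  suff -> : paste 0 v V = v by [].
  by apply/funext => x; rewrite /paste; case: ifP => // /Veq.
have Eab a b : 0 <= a -> \int[leb R]_(x in `[a, b]) dens eps al v g x =
    \int[leb R]_(x in `[a, b]) dens eps al V V1 x.
  move=> a0; have id := density_itg mu_C1 mu_le f_L43 eps al Hp.
  have mab : measurable `[a, b]%classic by [].
  apply: ae_eq_Rintegral => //.
  - by apply: itg_measurable; exact: itgS id.
  - have cmu := mu_continuous mu_C1; have cf := f_continuous mu_C1.
    apply: itg_measurable; apply: itg_cont; rewrite /density.
    apply: contB; last by apply: contM => //; apply: contM => //; exact: contC.
    apply: contD; last by apply: contM; [exact: contC|exact: contX].
    apply: contB; last first.
      by apply: contM; [apply: contM => //; exact: contC|exact: contX].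
    apply: contM; first exact: contC.
    by apply: contX => x; apply: (continuous_comp (f := V1)); [exact: cV1|exact: norm_continuous].
  - have := prim_ae_unique pv pp.
    apply: filterS; first exact: (ae_filter_ringOfSetsType (leb R)).
    move=> x gx; rewrite /= in_itv/= => /andP[ax _].
    by rewrite /density gx /paste (le_trans a0 ax) Veq// (le_trans a0 ax).
split=> //.
- move=> W G a b a0 ab pW iG Wa Wb; rewrite -Eab//.
  by apply: (local_min mu_C1 mu_le f_L43 H) => //; rewrite -Veq// (le_trans a0).
- move=> a a0 Va; have va : v a = 0 by rewrite -Veq.
  move=> h; apply: (flip_infinity mu_C1 mu_le f_L43 H al0 a0 va) => x ax.
  by rewrite -Veq ?h// (le_trans a0 (ltW ax)).
(* The point is a minimum of the fourth power of [V] on [[a, b]], which is at most the average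
   there. *)
- move=> a b a0 ab.
  have [c cab cmin] := EVT_min (ltW ab) (continuous_subspaceT (A := `[a, b]%classic) (contX (n := 4) cV)).
  exists c; first by move: cab; rewrite in_itv.
  rewrite -Rint_cst; last exact: ltW.
  have al' : 0 <= al <= A by rewrite ltW.
  apply: le_trans (half_minimal_L4 H e0 e1 A1 al').
  apply: (@le_trans _ _ (\int[leb R]_(x in `[a, b]) (v x ^+ 4))).
    apply: Rint_le; [exact: itg_cst|apply: itgS (pow4_itg Hp) => //|].
    move=> x xab; rewrite -Veq; last by case/andP: xab => /(le_trans a0).
    by apply: cmin; rewrite in_itv.
  apply: Rint_subset => //; first exact: pow4_itg Hp.
  by move=> x; rewrite exprn_even_ge0.
Qed.

End good_solutions.

(** * Zeros of a minimizer *)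

Section real_functions.
Context {R : realType}.
Implicit Types (F G h w : R -> R) (a b c d k x y z t e : R).

Lemma cont_near F x e : {for x, continuous F} -> 0 < e ->
  exists2 d, 0 < d & forall t, `|t - x| < d -> `|F t - F x| < e.
Proof.
move=> cF e0; have /cvgrPdist_lt/(_ e e0) := cF.
move=> /nbhs_ballP[d /= d0 hd]; exists d => // t tx.
by rewrite distrC; apply: hd; rewrite /ball/= distrC.
Qed.

Lemma cont_pos h x : continuous h -> 0 < h x ->
  exists2 d, 0 < d & forall t, `|t - x| < d -> 0 < h t.
Proof.
move=> ch hx; have [d d0 hd] := cont_near (ch x) hx; exists d => // t /hd.
rewrite ltr_norml => /andP[]; lra.
Qed.

(** [z] is the supremum of the points of [[y, x]] at which [h] is nonpositive. *)
Lemma last_nonpos h y x : continuous h -> y < x -> h y <= 0 -> 0 < h x ->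
  exists z, [/\ y <= z, z < x, h z = 0 & forall t, z < t <= x -> 0 < h t].
Proof.
move=> ch yx hy hx.
pose S := [set t | y <= t <= x /\ h t <= 0].
have Sy : S y by split=> //; rewrite lexx ltW.
have supS : has_sup S by split; [exists y|exists x => t [/andP[]]].
set z := sup S.
have yz : y <= z by apply: ub_le_sup => //; exact: supS.2.
have zx : z <= x by apply: ge_sup; [exists y|move=> t [/andP[]]].
have above t : z < t <= x -> 0 < h t.
  move=> /andP[zt tx]; rewrite ltNge; apply/negP => ht.
  have : t <= z.
    by apply: ub_le_sup; [exact: supS.2|split=> //; rewrite tx (le_trans yz (ltW zt))].
  by rewrite leNgt zt.
have hz0 : h z <= 0.
  rewrite leNgt; apply/negP => hz; have [d d0 hd] := cont_pos ch hz.
  have [t [tS tz]] : exists t, S t /\ z - d < t.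
    have [t St zt] := sup_adherent d0 supS; by exists t.
  have tlez : t <= z by apply: ub_le_sup => //; exact: supS.2.
  have : 0 < h t by apply: hd; rewrite ltr_norml; apply/andP; split; lra.
  by case: tS => _; rewrite leNgt => /negP.
have zltx : z < x.
  by rewrite lt_neqAle zx andbT; apply/negP => /eqP e; move: hz0; rewrite e leNgt hx.
exists z; split=> //; apply/eqP; rewrite eq_le hz0 leNgt; apply/negP => hz.
have [||d d0 hd] := @cont_pos (fun t => - h t) z.
- by move=> t; apply: cvgN; exact: ch.
- by rewrite oppr_gt0.
pose t := Num.min x (z + d / 2).
have zt : z < t by rewrite lt_min zltx /=; lra.
have tx : t <= x by rewrite ge_min lexx.
have td : t <= z + d / 2 by rewrite ge_min lexx orbT.
have : 0 < - h t by apply: hd; rewrite gtr0_norm; lra.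
by have := above t; rewrite zt tx => /(_ isT); lra.
Qed.

Lemma first_nonpos h x y : continuous h -> x < y -> 0 < h x -> h y <= 0 ->
  exists z, [/\ x < z, z <= y, h z = 0 & forall t, x <= t < z -> 0 < h t].
Proof.
move=> ch xy hx hy.
have [|||| z [yz zx hz above]] := @last_nonpos (fun t => h (- t)) (- y) (- x).
- by move=> t; apply: (continuous_comp (f := -%R)); [exact: opp_continuous|exact: ch].
- by rewrite ltrN2.
- by rewrite opprK.
- by rewrite opprK.
exists (- z); split=> //; [lra|lra|].
move=> t /andP[xt tz]; have := above (- t); rewrite opprK; apply; apply/andP; split; lra.
Qed.

(** At the ends of the interval continuity only gives [h <= 0]; the strict sign comes from the
    middle third, where [h] has a negative maximum. *)
Lemma Rint_lt0 h a b : continuous h -> a < b -> (forall x, a < x < b -> h x < 0) ->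
  \int[leb R]_(x in `[a, b]) h x < 0.
Proof.
move=> ch ab h0.
have h_le x : a <= x <= b -> h x <= 0.
  move=> /andP[ax xb]; rewrite leNgt; apply/negP => hx.
  have [d d0 hd] := cont_pos ch hx.
  pose m := (a + b) / 2.
  pose t := if x < m then x + Num.min (d / 2) ((m - x) / 2) else x - Num.min (d / 2) ((b - a) / 4).
  have tab : a < t < b.
    rewrite /t /m; case: (ltP x ((a + b) / 2)) => xm.
      have m1 : 0 < Num.min (d / 2) (((a + b) / 2 - x) / 2) by rewrite lt_min; apply/andP; split; lra.
      have m2 : Num.min (d / 2) (((a + b) / 2 - x) / 2) <= ((a + b) / 2 - x) / 2 by rewrite ge_min lexx orbT.
      by apply/andP; split; lra.
    have m1 : 0 < Num.min (d / 2) ((b - a) / 4) by rewrite lt_min; apply/andP; split; lra.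
    have m2 : Num.min (d / 2) ((b - a) / 4) <= (b - a) / 4 by rewrite ge_min lexx orbT.
    by apply/andP; split; lra.
  have tx : `|t - x| < d.
    rewrite /t; case: (ltP x m) => xm.
      have m1 : 0 <= Num.min (d / 2) ((m - x) / 2) by rewrite le_min; apply/andP; split; lra.
      have m2 : Num.min (d / 2) ((m - x) / 2) <= d / 2 by rewrite ge_min lexx.
      by rewrite addrC addKr ger0_norm//; lra.
    have m1 : 0 <= Num.min (d / 2) ((b - a) / 4) by rewrite le_min; apply/andP; split; lra.
    have m2 : Num.min (d / 2) ((b - a) / 4) <= d / 2 by rewrite ge_min lexx.
    by rewrite addrC addKr normrN ger0_norm//; lra.
  by have := h0 _ tab; have := hd _ tx; lra.
pose a' := a + (b - a) / 3; pose b' := b - (b - a) / 3.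
have aa' : a < a' by rewrite /a'; lra.
have a'b' : a' < b' by rewrite /a' /b'; lra.
have b'b : b' < b by rewrite /b'; lra.
have [c cab cmax] := EVT_max (ltW a'b') (continuous_subspaceT (A := `[a', b']%classic) ch).
have hc : h c < 0 by apply: h0; move: cab; rewrite in_itv/= => /andP[]; lra.
have ii x y : itg `[x, y] h by exact: itg_cont.
rewrite (Rint_cat (ltW aa') (ltW (lt_trans a'b' b'b)) (ii _ _)).
rewrite (Rint_cat (ltW a'b') (ltW b'b) (ii _ _)).
have nonpos x y : a <= x -> x <= y -> y <= b -> \int[leb R]_(t in `[x, y]) h t <= 0.
  move=> ax xy yb; have <- : \int[leb R]_(t in `[x, y]) (0 : R) = 0 by rewrite Rint_cst// mul0r.
  by apply: Rint_le => //; [exact: itg_cst|move=> t /andP[xt ty]; apply: h_le; rewrite (le_trans ax)// (le_trans ty)].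
have i1 := nonpos a a' (lexx a) (ltW aa') (ltW (lt_trans a'b' b'b)).
have i2 := nonpos b' b (ltW (lt_trans aa' a'b')) (ltW b'b) (lexx b).
have : \int[leb R]_(t in `[a', b']) h t <= h c * (b' - a').
  rewrite -Rint_cst; last exact: ltW.
  by apply: Rint_le => //; exact: itg_cst.
have : h c * (b' - a') < 0 by rewrite pmulr_llt0//; lra.
lra.
Qed.

(** At a maximum [F1 b = 0]; a positive derivative of [F1] at [b] makes [F1] positive just to the
    right, and the mean value theorem makes [F] increase there. Nothing is asked of [F1] away from
    [b] beyond being the derivative of [F]. *)
Lemma no_local_max F F1 b k : (forall x, is_derive x 1 F (F1 x)) ->
  is_derive b 1 F1 k -> 0 < k ->
  forall d, 0 < d -> ~ (forall x, `|x - b| < d -> F x <= F b).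
Proof.
move=> dF dF1 k0 d d0 Fmax.
have F1b : F1 b = 0.
  have : is_derive b 1 F 0.
    apply: (@derive1_at_max _ F (b - d) (b + d)); first by lra.
    - by move=> t _; have [] := dF t.
    - by rewrite in_itv/=; apply/andP; split; lra.
    - move=> t; rewrite in_itv/= => /andP[t1 t2]; apply: Fmax.
      by rewrite ltr_norml; apply/andP; split; lra.
  by move=> /derive1_eq <-; rewrite (derive1_eq (dF b)).
have [e e0 he] : exists2 e : R, 0 < e & forall h : R, 0 < h < e -> 0 < F1 (b + h).
  have [dv kE] := dF1.
  have /cvgrPdist_lt/(_ k k0) : h^-1 *: (F1 (h *: (1 : R) + b) - F1 b) @[h --> 0^'] --> k.
    by rewrite -kE; exact: dv.
  rewrite /dnbhs/within/= => /nbhs_ballP[e /= e0 he]; exists e => // h /andP[h0 hlt].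
  have := he h; rewrite /ball/= sub0r normrN gtr0_norm// gt_eqF// => /(_ hlt isT).
  rewrite F1b subr0 (_ : h *: (1 : R) + b = b + h); last by rewrite addrC [h *: _]mulr1.
  move=> hk.
  have : 0 < h^-1 * F1 (b + h).
    by move: hk; rewrite -[_ *: _]/(h^-1 * _) ltr_norml => /andP[]; lra.
  by rewrite pmulr_rgt0// invr_gt0.
pose h := Num.min e d / 2.
have md : 0 < Num.min e d by rewrite lt_min e0.
have h0 : 0 < h by rewrite /h; lra.
have he' : h < e by rewrite /h; have : Num.min e d <= e by [rewrite ge_min lexx]; lra.
have hd : h < d by rewrite /h; have : Num.min e d <= d by [rewrite ge_min lexx orbT]; lra.
have cF := cont_derive dF.
have bh : b < b + h by lra.
have [c] := MVT bh (fun x _ => dF x) (continuous_subspaceT cF).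
rewrite in_itv/= => /andP[bc cbh] E.
have F1c : 0 < F1 c.
  have -> : c = b + (c - b) by ring.
  by apply: he; apply/andP; split; lra.
have : 0 < F1 c * (b + h - b) by rewrite mulr_gt0//; lra.
have bb : b + h - b = h by ring.
have := Fmax (b + h); rewrite bb gtr0_norm// => /(_ hd); lra.
Qed.

End real_functions.

Section zero_structure.
Context {R : realType}.
Variable mu : R -> R.
Hypothesis mu_C1 : C1 mu.
Notation f := (forcing mu).
Variable zeta : R.
Hypothesis zeta_gt0 : 0 < zeta.
Hypothesis f_neg : forall x, 0 < x < zeta -> f x < 0.
Hypothesis f_pos : forall x, zeta < x -> 0 < f x.
Variables (C eps al : R) (V V1 : R -> R).
Hypothesis VG : good mu C eps al V V1.
Hypothesis eps_gt0 : 0 < eps.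
Hypothesis al_gt0 : 0 < al.
Implicit Types (a b c d k x y z t q p : R).

Let cV : continuous V := cont_derive (gd_der VG).
Let cf : continuous f := f_continuous mu_C1.

(** At a zero the equation reduces to $\epsilon V''=-\alpha f$, which is positive where [f] is
    negative. *)
Lemma touch_neg b d : 0 < b -> V b = 0 -> f b < 0 -> 0 < d ->
  ~ (forall x, `|x - b| < d -> V x <= 0).
Proof.
move=> b0 Vb fb d0 h.
apply: (@no_local_max _ V V1 b _ (gd_der VG) (gd_der2 VG b0) _ d d0).
  rewrite /reaction Vb mulr0 expr0n/= subr0 add0r divr_gt0 ?exprn_gt0//.
  by rewrite oppr_gt0 pmulr_rlt0 ?mulr_gt0.
by move=> x /h; rewrite Vb.
Qed.

Lemma touch_pos b d : 0 < b -> V b = 0 -> 0 < f b -> 0 < d ->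
  ~ (forall x, `|x - b| < d -> 0 <= V x).
Proof.
move=> b0 Vb fb d0 h.
have dN x : is_derive x 1 (fun x => - V x) (- V1 x) by exact: derN (gd_der VG x).
apply: (@no_local_max _ _ _ b _ dN (derN (gd_der2 VG b0)) _ d d0).
  rewrite /reaction Vb mulr0 expr0n/= subr0 add0r mulNr opprK.
  by apply: divr_gt0; [apply: mulr_gt0 => //; exact: mulr_gt0|exact: exprn_gt0].
by move=> x /h; rewrite Vb oppr0 oppr_le0.
Qed.

Lemma flip_interval a b : 0 <= a -> a < b -> V a = 0 -> V b = 0 ->
  ~ (forall x, a < x < b -> f x * V x < 0).
Proof.
move=> a0 ab Va Vb fV.
have cfV : continuous (fun x => f x * V x) by exact: contM.
have pV := primZ (- 1) (prim_derive (gd_der VG) (gd_cont VG)).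
have cN : continuous (fun x => (- 1) * V1 x) by apply: contM; [exact: contC|exact: (gd_cont VG)].
have := gd_min VG a0 (ltW ab) pV (itg_cont a b (contX (n := 2) cN)).
rewrite Va Vb mulr0 => /(_ erefl erefl).
have cmu := mu_continuous mu_C1.
have cdens : continuous (density mu eps al V V1).
  rewrite /density; apply: contB; last by apply: contM => //; apply: contM => //; exact: contC.
  apply: contD; last by apply: contM; [exact: contC|exact: contX].
  apply: contB; last first.
    by apply: contM; [apply: contM => //; exact: contC|exact: contX].
  apply: contM; first exact: contC.
  by apply: contX => x; apply: (continuous_comp (f := V1)); [exact: (gd_cont VG)|exact: norm_continuous].
have -> : density mu eps al (fun x => (- 1) * V x) (fun x => (- 1) * V1 x) =
   fun x => density mu eps al V V1 x + 2 * al * (f x * V x).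
  by apply/funext => x; rewrite /density normrM normrN1 mul1r; ring.
have j1 := itg_cont a b cdens; have j2 := itg_cont a b cfV.
rewrite (RintD j1 (itgZ (2 * al) (measurable_itv _) j2)) (RintZ _ j2).
have := Rint_lt0 cfV ab fV.
have : 0 < 2 * al by rewrite mulr_gt0.
set I := \int[leb R]_(x in _) (f x * V x); set J := Rintegral _ _ _.
by move=> al2 I0; rewrite lerDl pmulr_rge0// leNgt I0.
Qed.

(** A positive hump between two zeros lies in the region where [f] is negative, and reversing its
    sign would lower the energy. *)
Lemma nonpos_between x0 x1 x : 0 <= x0 -> x1 <= zeta -> V x0 <= 0 -> V x1 <= 0 ->
  x0 <= x <= x1 -> V x <= 0.
Proof.
move=> h0 h1 V0 V1' /andP[x0x xx1]; rewrite leNgt; apply/negP => Vx.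
have lt0 : x0 < x by rewrite lt_neqAle x0x andbT; apply/eqP => e; move: V0; rewrite e leNgt Vx.
have lt1 : x < x1 by rewrite lt_neqAle xx1 andbT; apply/eqP => e; move: V1'; rewrite -e leNgt Vx.
have [a [xa ax Va Pa]] := last_nonpos cV lt0 V0 Vx.
have [b [xb bx Vb Pb]] := first_nonpos cV lt1 Vx V1'.
apply: (@flip_interval a b) => //; [exact: le_trans xa|exact: lt_trans xb|].
move=> t /andP[at_ tb]; rewrite pmulr_llt0.
  apply: f_neg; rewrite (le_lt_trans (le_trans h0 xa) at_)/=.
  exact: lt_le_trans tb (le_trans bx h1).
case: (leP t x) => tx; first by apply: Pa; rewrite at_.
by apply: Pb; rewrite tb ltW.
Qed.

(** A negative excursion beyond [zeta] either returns to zero, and is excluded by [flip_interval],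
    or never does, and is excluded by [gd_inf]. *)
Lemma nonneg_after y x : zeta <= y -> V y = 0 -> y < x -> 0 <= V x.
Proof.
move=> zy Vy yx; rewrite leNgt; apply/negP => Vx.
have cN : continuous (fun x => - V x) by move=> t; apply: cvgN; exact: cV.
have [||a [ya ax Va Pa]] := @last_nonpos _ (fun x => - V x) y x cN yx.
- by rewrite Vy oppr0.
- by rewrite oppr_gt0.
have Va0 : V a = 0 by rewrite -[V a]opprK Va oppr0.
have a0 : 0 <= a by apply: le_trans (ltW zeta_gt0) (le_trans zy ya).
have [[b [xb Vb]]|nob] := pselect (exists b, x < b /\ 0 <= V b).
  have [||z [xz zb Vz Pz]] := @first_nonpos _ (fun x => - V x) x b cN xb.
  - by rewrite oppr_gt0.
  - by rewrite oppr_le0.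
  apply: (@flip_interval a z) => //; [exact: lt_trans xz|by rewrite -[V z]opprK Vz oppr0|].
  move=> t /andP[at_ tz]; rewrite pmulr_rlt0.
    rewrite -oppr_gt0; case: (leP t x) => tx; first by apply: Pa; rewrite at_.
    by apply: Pz; rewrite tz ltW.
  by apply: f_pos; exact: le_lt_trans (le_trans zy ya) at_.
apply: (gd_inf VG a0 Va0) => t at_; rewrite pmulr_rlt0.
  rewrite -oppr_gt0; case: (leP t x) => tx; first by apply: Pa; rewrite at_.
  by rewrite oppr_gt0 ltNge; apply/negP => Vt; apply: nob; exists t.
by apply: f_pos; exact: le_lt_trans (le_trans zy ya) at_.
Qed.

(** The first zero [z] beyond [q] is the only one. Past [zeta] a further zero would be touched from
    above where [f] is positive; a zero [z] before [zeta] calls for a separate study of the stretch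
    up to [zeta]. *)
Lemma right_sign_change q p : 0 < q -> q < zeta -> V q < 0 -> q < p -> 0 < V p ->
  exists z, [/\ q < z, V z = 0, forall x, q <= x < z -> V x < 0 & forall x, z < x -> 0 < V x].
Proof.
move=> q0 qz Vq qp Vp.
have cN : continuous (fun x => - V x) by move=> t; apply: cvgN; exact: cV.
have [||z [qz' zp Vz Pz]] := @first_nonpos _ (fun x => - V x) q p cN qp.
- by rewrite oppr_gt0.
- by rewrite oppr_le0 ltW.
have {}Vz : V z = 0 by rewrite -[V z]opprK Vz oppr0.
have {}Pz x : q <= x < z -> V x < 0 by move=> /Pz; rewrite oppr_gt0.
have z0 : 0 < z by exact: lt_trans qz'.
exists z; split=> // x zx; rewrite ltNge; apply/negP => Vx.
case: (leP zeta z) => zz.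
  have Vx0 : V x = 0 by apply/eqP; rewrite eq_le Vx (nonneg_after zz Vz zx).
  have x0 : 0 < x by exact: lt_trans zx.
  apply: (@touch_pos x (x - z) x0 Vx0); [by apply: f_pos; exact: le_lt_trans zx|by lra|].
  move=> t; rewrite ltr_norml => /andP[t1 t2]; apply: (nonneg_after zz Vz); lra.
have fz : f z < 0 by apply: f_neg; rewrite z0.
(* If [V t <= 0], then [V] is nonpositive on [[z, t]] by [nonpos_between], hence on both sides of
   [z], which [touch_neg] forbids. *)
have A t : z < t -> t <= zeta -> 0 < V t.
  move=> zt tz; rewrite ltNge; apply/negP => Vt.
  apply: (@touch_neg z (Num.min (z - q) (t - z)) z0 Vz fz).
    by rewrite lt_min; apply/andP; split; lra.
  move=> s; rewrite lt_min => /andP[]; rewrite !ltr_norml => /andP[s1 s2] /andP[s3 s4].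
  case: (ltP s z) => sz; first by apply: ltW; apply: Pz; apply/andP; split; lra.
  apply: (@nonpos_between z t) => //; [exact: ltW|by rewrite Vz|by apply/andP; split; lra].
case: (leP x zeta) => xz; first by have := A x zx xz; rewrite ltNge Vx.
(* At the first return [y] to zero beyond [zeta], the function is nonnegative on both sides and the
   force is positive. *)
have Vzeta := A zeta zz (lexx _).
have [y [zy yx Vy Py]] := first_nonpos cV xz Vzeta Vx.
have y0 : 0 < y by exact: lt_trans zy.
apply: (@touch_pos y (y - zeta) y0 Vy); [exact: f_pos|by lra|].
move=> t; rewrite ltr_norml => /andP[t1 t2]; case: (ltgtP t y) => [ty|yt|->].
- by apply: ltW; apply: Py; apply/andP; split; lra.
- exact: (nonneg_after (ltW zy) Vy yt).
- by rewrite Vy.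
Qed.

(** If [V] is nonnegative somewhere in [(0, q)], its last zero [a] before [q] is followed by
    negative values. A nonpositive value before [a] would make [V] nonpositive around [a], against
    [touch_neg]; so [V] is positive from 0 to [a]. The dichotomy on the sign of [V 0] lets the two
    halves be matched at the origin. *)
Lemma middle_zero q : 0 < q -> q < zeta -> V q < 0 ->
  (V 0 <= 0 /\ forall x, 0 < x <= q -> V x < 0) \/
  (0 < V 0 /\ exists a, [/\ 0 < a, a < q, V a = 0, forall x, 0 <= x < a -> 0 < V x &
     forall x, a < x <= q -> V x < 0]).
Proof.
move=> q0 qz Vq.
have [[t [/andP[t0 tq] Vt]]|no] := pselect (exists t, 0 < t < q /\ 0 <= V t); last first.
  left; have neg x : 0 < x <= q -> V x < 0.
    move=> /andP[x0]; rewrite le_eqVlt => /predU1P[->//|xq].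
    by rewrite ltNge; apply/negP => Vx; apply: no; exists x; rewrite x0 xq.
  split=> //; rewrite leNgt; apply/negP => V0.
  have [d d0 hd] := cont_pos cV V0.
  pose x := Num.min (d / 2) q.
  have x0 : 0 < x by rewrite lt_min q0 andbT; lra.
  have xq : x <= q by rewrite ge_min lexx orbT.
  have xd : x <= d / 2 by rewrite ge_min lexx.
  have := neg x; rewrite x0 xq => /(_ isT).
  have := hd x; rewrite subr0 gtr0_norm// => h; have := h (le_lt_trans xd _); lra.
have cN : continuous (fun x => - V x) by move=> s; apply: cvgN; exact: cV.
have [||a [ta aq Va Pa]] := @last_nonpos _ (fun x => - V x) t q cN tq.
- by rewrite oppr_le0.
- by rewrite oppr_gt0.
have {}Va : V a = 0 by rewrite -[V a]opprK Va oppr0.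
have {}Pa x : a < x <= q -> V x < 0 by move=> /Pa; rewrite oppr_gt0.
have a0 : 0 < a by exact: lt_le_trans ta.
have az : a < zeta by exact: lt_trans qz.
have pos x : 0 <= x < a -> 0 < V x.
  move=> /andP[x0 xa]; rewrite ltNge; apply/negP => Vx.
  apply: (@touch_neg a (Num.min (a - x) (q - a)) a0 Va); first by apply: f_neg; rewrite a0.
    by rewrite lt_min; apply/andP; split; lra.
  move=> s; rewrite lt_min => /andP[]; rewrite !ltr_norml => /andP[s1 s2] /andP[s3 s4].
  case: (leP s a) => sa.
    by apply: (@nonpos_between x a) => //; [exact: ltW|rewrite Va|apply/andP; split; lra].
  by apply: ltW; apply: Pa; apply/andP; split; lra.
right; split; first by apply: pos; rewrite lexx.
by exists a.
Qed.

End zero_structure.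

(** * Bounds away from the zeros *)

Section second_differences.
Context {R : realType}.
Implicit Types (F G h w U : R -> R) (a b c d k x y z t e r : R).

Lemma derive_ge F F1 a b k : a <= b -> (forall x, is_derive x 1 F (F1 x)) ->
  (forall x, a < x < b -> k <= F1 x) -> k * (b - a) <= F b - F a.
Proof.
move=> + dF F1k; rewrite le_eqVlt => /predU1P[->|ab]; first by rewrite !subrr mulr0.
have [c] := MVT ab (fun x _ => dF x) (continuous_subspaceT (cont_derive dF)).
rewrite in_itv/= => cab ->; rewrite ler_wpM2r ?subr_ge0 ?(ltW ab)//.
exact: F1k.
Qed.

Lemma derive_ge_itv F F1 a b k : a <= b -> continuous F ->
  (forall x, a < x < b -> is_derive x 1 F (F1 x)) ->
  (forall x, a < x < b -> k <= F1 x) -> k * (b - a) <= F b - F a.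
Proof.
move=> + cF dF F1k; rewrite le_eqVlt => /predU1P[->|ab]; first by rewrite !subrr mulr0.
have dF' x : x \in `]a, b[%R -> is_derive x 1 F (F1 x) by rewrite in_itv/=; exact: dF.
have [c] := MVT ab dF' (continuous_subspaceT cF).
rewrite in_itv/= => cab ->; rewrite ler_wpM2r ?subr_ge0 ?(ltW ab)//.
exact: F1k.
Qed.

(** The derivative in [s] of [U (c + s) + U (c - s) - k * s ^+ 2] is
    [U1 (c + s) - U1 (c - s) - 2 * k * s], nonnegative by the bound on [U2]. *)
Lemma second_diff_ge U U1 U2 c r k : 0 <= r -> (forall x, is_derive x 1 U (U1 x)) ->
  continuous U1 -> (forall x, c - r < x < c + r -> is_derive x 1 U1 (U2 x)) ->
  (forall x, c - r < x < c + r -> k <= U2 x) ->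
  k * r ^+ 2 <= U (c + r) + U (c - r) - 2 * U c.
Proof.
move=> r0 dU cU1 dU1 U2k.
have dp (s : R) : is_derive s 1 (fun s => c + s) 1.
  by have := derD (derC c s) (derI s); rewrite add0r.
have dm (s : R) : is_derive s 1 (fun s => c - s) (- 1).
  by have := derB (derC c s) (derI s); rewrite sub0r.
have D s := derB (derD (@der_comp _ U (fun s => c + s) s _ _ (dU (c + s)) (dp s))
  (@der_comp _ U (fun s => c - s) s _ _ (dU (c - s)) (dm s)))
  (derZ k (derM (derI s) (derI s))).
have /= := @derive_ge _ _ 0 r 0 r0 D.
rewrite !addr0 !subr0 !mul0r mulr0 subr0 => h.
suff /h : forall s, 0 < s < r -> 0 <= U1 (c + s) * 1 + U1 (c - s) * - 1 - k * (1 * s + s * 1).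
  by rewrite expr2; lra.
move=> s /andP[s0 sr].
have : k * (c + s - (c - s)) <= U1 (c + s) - U1 (c - s).
  apply: (@derive_ge_itv _ U2) => //; first by lra.
  - by move=> x /andP[x1 x2]; apply: dU1; apply/andP; split; lra.
  - by move=> x /andP[x1 x2]; apply: U2k; apply/andP; split; lra.
have -> : c + s - (c - s) = 2 * s by ring.
lra.
Qed.

End second_differences.

(** * The energy with a completed square, and pointwise bounds for local minimizers *)

Section normalized_energy.
Context {R : realType}.
Variable mu : R -> R.
Hypothesis mu_C1 : C1 mu.
Notation f := (forcing mu).
Implicit Types (W G U : R -> R) (a b c d k x y z t e r eps al : R).

(** The density plus $\mu^2/(4\epsilon)$, which does not depend on [w]: comparisons on a fixed
    interval are unchanged and the potential becomes a nonnegative square. *)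
Definition ndens eps al w g x : R :=
  eps / 2 * g x ^+ 2 + (4 * eps)^-1 * (w x ^+ 2 - mu x) ^+ 2 - al * f x * w x.

Lemma ndens_density eps al w g x : eps != 0 ->
  ndens eps al w g x = density mu eps al w g x + (4 * eps)^-1 * mu x ^+ 2.
Proof. by move=> e0; rewrite /ndens /density real_normK ?num_real//; field. Qed.

Lemma ndens_neg eps al w g x :
  ndens eps al (fun x => - w x) (fun x => - g x) x = ndens eps (- al) w g x.
Proof. by rewrite /ndens; ring. Qed.

Lemma ndens_flip eps al w g x :
  ndens eps al (fun x => - w x) (fun x => - g x) x = ndens eps al w g x + 2 * al * (f x * w x).
Proof. by rewrite /ndens; ring. Qed.

Lemma ndens_cont eps al W G : continuous W -> continuous G -> continuous (ndens eps al W G).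
Proof.
move=> cW cG; have cmu := mu_continuous mu_C1; have cf := f_continuous mu_C1.
rewrite /ndens; apply: contB; last by apply: contM => //; apply: contM => //; exact: contC.
apply: contD; first by apply: contM; [exact: contC|exact: contX].
by apply: contM; [exact: contC|apply: contX; apply: contB => //; exact: contX].
Qed.

Lemma ndens_itg eps al W G a b : prim W G -> itg `[a, b] (fun x => G x ^+ 2) ->
  itg `[a, b] (ndens eps al W G).
Proof.
move=> p iG; have cW := prim_continuous p.
have cmu := mu_continuous mu_C1; have cf := f_continuous mu_C1.
have i1 : itg `[a, b] (fun x => (4 * eps)^-1 * (W x ^+ 2 - mu x) ^+ 2).
  by apply: itg_cont; apply: contM; [exact: contC|apply: contX; apply: contB => //; exact: contX].
have i2 : itg `[a, b] (fun x => al * f x * W x).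
  by apply: itg_cont; apply: contM => //; apply: contM => //; exact: contC.
by apply: itgB => //; apply: itgD => //; exact: itgZ.
Qed.

(** A path from the value [p] at [a] to the value [q] at [b] of cost at most [c]. Hiding the path
    makes costs additive under concatenation, so a comparison function is assembled from independent
    pieces. *)
Definition competitor eps al a p b q c := exists W G,
  [/\ prim W G, itg `[a, b] (fun x => G x ^+ 2), W a = p, W b = q &
      \int[leb R]_(x in `[a, b]) ndens eps al W G x <= c].

Lemma competitor_cat eps al a p b q c1 d r c2 : a <= b -> b <= d ->
  competitor eps al a p b q c1 -> competitor eps al b q d r c2 ->
  competitor eps al a p d r (c1 + c2).
Proof.
move=> ab bd [W1 [G1 [p1 i1 Wa1 Wb1 e1]]] [W2 [G2 [p2 i2 Wa2 Wb2 e2]]].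
have pp : prim (paste b W1 W2) (paste b G1 G2) by apply: prim_paste => //; rewrite Wb1.
have iG : itg `[a, d] (fun x => paste b G1 G2 x ^+ 2).
  apply: (itg_cat ab bd).
    by apply: eq_itg_co i1 => x /andP[_ xb]; rewrite /paste leNgt xb.
  by apply: eq_itg_itv i2 => x /andP[bx _]; rewrite /paste bx.
exists (paste b W1 W2), (paste b G1 G2); split=> //.
- rewrite /paste; case: (leP b a) => // ba; rewrite -Wa1.
  have -> : a = b by apply/eqP; rewrite eq_le ab.
  by rewrite Wa2 Wb1.
- by rewrite /paste bd.
- rewrite (Rint_cat ab bd (ndens_itg eps al pp iG)).
  apply: lerD.
    rewrite -(@eq_Rint_co _ _ _ (ndens eps al W1 G1))//; last exact: ndens_itg.
    by move=> x /andP[_ xb]; rewrite /ndens /paste leNgt xb.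
  rewrite -(@eq_Rint _ _ _ (ndens eps al W2 G2))//.
  by move=> x /andP[bx _]; rewrite /ndens /paste bx.
Qed.

Lemma competitor_C1 eps al W G a b c : (forall x, is_derive x 1 W (G x)) -> continuous G ->
  \int[leb R]_(x in `[a, b]) ndens eps al W G x <= c ->
  competitor eps al a (W a) b (W b) c.
Proof.
move=> dW cG e; exists W, G; split=> //; first exact: prim_derive.
by apply: itg_cont; exact: contX.
Qed.

Variables (A B : R).

(** A bounded local minimizer on [[A, B]], a notion stable under change of sign (with [- al]) and
    under reflection. Upper bounds then yield lower bounds, and statements about a transition on one
    side of [zeta] yield those about the other side. *)
Record lsol C1b eps al U U1 : Prop := {
  ls_der : forall x, is_derive x 1 U (U1 x);
  ls_der2 : forall x, A < x < B -> is_derive x 1 U1 (- reaction mu eps al U x / eps ^+ 2);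
  ls_cont : continuous U1;
  ls_min : forall a b c, A <= a -> a <= b -> b <= B ->
    competitor eps al a (U a) b (U b) c ->
    \int[leb R]_(x in `[a, b]) ndens eps al U U1 x <= c;
  ls_bd : forall x, A <= x <= B -> `|U x| <= C1b }.

Lemma lsol_neg C1b eps al U U1 : lsol C1b eps al U U1 ->
  lsol C1b eps (- al) (fun x => - U x) (fun x => - U1 x).
Proof.
case=> d d2 c m bd; split.
- by move=> x; exact: derN.
- move=> x xAB; have := derN (d2 x xAB).
  by have -> : - (- reaction mu eps al U x / eps ^+ 2) =
    - reaction mu eps (- al) (fun x => - U x) x / eps ^+ 2 by rewrite /reaction; ring.
- by move=> x; apply: cvgN; exact: c.
- move=> a b k Aa ab bB [W [G [p i Wa Wb e]]].
  under eq_Rintegral do rewrite ndens_neg opprK.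
  apply: (m a b) => //; exists (fun x => - W x), (fun x => - G x); split.
  + have -> : (fun x => - W x) = fun x => (- 1) * W x by apply/funext => x; rewrite mulN1r.
    have -> : (fun x => - G x) = fun x => (- 1) * G x by apply/funext => x; rewrite mulN1r.
    exact: primZ.
  + by apply: (@eq_itg _ _ (fun x => G x ^+ 2)) => // x _; rewrite sqrrN.
  + by rewrite Wa opprK.
  + by rewrite Wb opprK.
  + by under eq_Rintegral do rewrite ndens_neg.
- by move=> x /bd; rewrite normrN.
Qed.

Section bounds.
Variables (C1b eps al : R) (U U1 : R -> R).
Hypothesis S : lsol C1b eps al U U1.
Hypothesis eps_gt0 : 0 < eps.

Let cU : continuous U := cont_derive (ls_der S).

Lemma max_principle c d L x : A < c -> d < B -> U c <= L -> U d <= L ->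
  (forall y, c <= y <= d -> L < U y -> reaction mu eps al U y < 0) ->
  c <= x <= d -> U x <= L.
Proof.
move=> Ac dB Uc Ud neg xcd; have /andP[cx xd] := xcd.
rewrite leNgt; apply/negP => Ux; have cd := le_trans cx xd.
have [y ycd ymax] := EVT_max cd (continuous_subspaceT (A := `[c, d]%classic) cU).
have /andP[cy yd] : c <= y <= d by move: ycd; rewrite in_itv.
have Uy : L < U y by apply: lt_le_trans Ux _; apply: ymax; rewrite in_itv.
have c_y : c < y by rewrite lt_neqAle cy andbT; apply/eqP => e; move: Uc; rewrite e leNgt Uy.
have y_d : y < d by rewrite lt_neqAle yd andbT; apply/eqP => e; move: Ud; rewrite -e leNgt Uy.
have yAB : A < y < B by rewrite (lt_trans Ac c_y) (lt_trans y_d dB).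
have r0 := neg y (introT andP (conj cy yd)) Uy.
apply: (@no_local_max _ U U1 y _ (ls_der S) (ls_der2 S yAB) _ (Num.min (y - c) (d - y))).
- by rewrite divr_gt0 ?exprn_gt0// oppr_gt0.
- by rewrite lt_min !subr_gt0 c_y.
- move=> t; rewrite lt_min => /andP[]; rewrite !ltr_norml => /andP[t1 _] /andP[_ t2].
  by apply: ymax; rewrite in_itv/=; apply/andP; split; lra.
Qed.

(** If [U] stayed above [L] on the whole interval, its second derivative would be at least
    [k / eps ^+ 2], and the second difference, at most [4 * C1b], would be too large. *)
Lemma exists_below c r L k : A <= c - r -> c + r <= B -> 0 <= r ->
  (forall t, c - r <= t <= c + r -> L <= U t -> reaction mu eps al U t <= - k) ->
  4 * C1b * eps ^+ 2 < k * r ^+ 2 ->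
  exists2 t, c - r <= t <= c + r & U t < L.
Proof.
move=> Ac cB r0 neg small; apply: contrapT => no.
have UL t : c - r <= t <= c + r -> L <= U t.
  by move=> tcr; rewrite leNgt; apply/negP => Ut; apply: no; exists t.
have := @second_diff_ge _ U U1 (fun x => - reaction mu eps al U x / eps ^+ 2) c r (k / eps ^+ 2)
  r0 (ls_der S) (ls_cont S).
have d2 x : c - r < x < c + r -> is_derive x 1 U1 (- reaction mu eps al U x / eps ^+ 2).
  by move=> /andP[x1 x2]; apply: (ls_der2 S); apply/andP; split; lra.
have k2 x : c - r < x < c + r -> k / eps ^+ 2 <= - reaction mu eps al U x / eps ^+ 2.
  move=> /andP[x1 x2]; rewrite ler_pM2r ?invr_gt0 ?exprn_gt0//.
  have xx : c - r <= x <= c + r by rewrite !ltW.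
  by have := neg x xx (UL x xx); lra.
move=> /(_ d2 k2).
have b1 : `|U (c + r)| <= C1b by apply: (ls_bd S); apply/andP; split; lra.
have b2 : `|U (c - r)| <= C1b by apply: (ls_bd S); apply/andP; split; lra.
have b3 : `|U c| <= C1b by apply: (ls_bd S); apply/andP; split; lra.
move: b1 b2 b3; rewrite !ler_norml => /andP[_ b1] /andP[_ b2] /andP[b3 _] h.
have : k / eps ^+ 2 * r ^+ 2 <= 4 * C1b by lra.
rewrite mulrAC ler_pdivrMr ?exprn_gt0//; lra.
Qed.

(** Points where [U < L] are found near [y - 3 * d / 4] and near [y + 3 * d / 4]; between them the
    maximum principle applies. *)
Lemma upper_principle y d L k : A < y - d -> y + d < B -> 0 < d -> 0 < k ->
  (forall t, y - d <= t <= y + d -> L <= U t -> reaction mu eps al U t <= - k) ->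
  4 * C1b * eps ^+ 2 < k * (d / 4) ^+ 2 ->
  forall t, y - d / 2 <= t <= y + d / 2 -> U t <= L.
Proof.
move=> Ay yB d0 k0 neg small.
have [|||||c /andP[c1 c2] Uc] := @exists_below (y - 3 * d / 4) (d / 4) L k; [lra|lra|lra| |by []|].
  by move=> t /andP[t1 t2]; apply: neg; apply/andP; split; lra.
have [|||||e /andP[e1 e2] Ue] := @exists_below (y + 3 * d / 4) (d / 4) L k; [lra|lra|lra| |by []|].
  by move=> t /andP[t1 t2]; apply: neg; apply/andP; split; lra.
move=> t /andP[t1 t2]; apply: (@max_principle c e L); [lra|lra|exact: ltW|exact: ltW| |].
  move=> s /andP[s1 s2] /ltW Us.
  by have := neg s; have -> : y - d <= s <= y + d by [apply/andP; split; lra]; move=> /(_ isT Us); lra.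
by apply/andP; split; lra.
Qed.

(** Where [U >= s], the cubic part of the reaction is at most [- s * k], and the force is small
    enough to consume only half of it. *)
Lemma sol_le y d s k F : A < y - d -> y + d < B -> 0 < d -> 0 < k -> 0 < s ->
  (forall t, y - d <= t <= y + d -> mu t <= s ^+ 2 - k) ->
  (forall t, y - d <= t <= y + d -> `|f t| <= F) ->
  eps * `|al| * F <= s * k / 2 ->
  4 * C1b * eps ^+ 2 < s * k / 2 * (d / 4) ^+ 2 ->
  U y <= s.
Proof.
move=> Ay yB d0 k0 s0 muk fF small1 small2.
apply: (@upper_principle y d s (s * k / 2)) => //.
- by rewrite divr_gt0// mulr_gt0.
- move=> t td sU; rewrite /reaction.
  have h1 : eps * al * f t <= eps * `|al| * F.
    apply: le_trans (ler_norm _) _; rewrite (normrM _ (f t)) (normrM eps) (gtr0_norm eps_gt0).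
    by apply: ler_wpM2l; [apply: mulr_ge0 => //; exact: ltW|exact: fF].
  have h2 : mu t * U t - U t ^+ 3 <= - (s * k).
    have m := muk t td.
    have U2 : s ^+ 2 <= U t ^+ 2 by rewrite lerXn2r ?nnegrE//; lra.
    have -> : mu t * U t - U t ^+ 3 = - (U t * (U t ^+ 2 - mu t)) by ring.
    rewrite lerN2; apply: ler_pM; lra.
  by lra.
- by apply/andP; split; lra.
Qed.

End bounds.
End normalized_energy.

(** * Competitors made of short ramps and constants *)

Lemma sqr_gap_le {R : realType} (a b m u : R) : u <= a -> a < b -> b <= m ->
  (b - m) ^+ 2 + (b - a) ^+ 2 <= (u - m) ^+ 2.
Proof. by move=> *; nra. Qed.

Lemma sqr_sub_le {R : realType} (u r : R) : `|u| <= r -> (r - u) ^+ 2 <= 4 * r ^+ 2.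
Proof. by rewrite ler_norml => /andP[? ?]; nra. Qed.

Lemma between_norm {R : realType} (p q w r : R) :
  `|p| <= r -> `|q| <= r -> (p - w) * (q - w) <= 0 -> `|w| <= r.
Proof. by rewrite !ler_norml => /andP[p1 p2] /andP[q1 q2] pq; apply/andP; split; nra. Qed.

Lemma sqr_norm_le {R : realType} (w r : R) : `|w| <= r -> w ^+ 2 <= r ^+ 2.
Proof.
move=> wr; rewrite -(real_normK (num_real w)) lerXn2r ?nnegrE//.
exact: le_trans (normr_ge0 w) wr.
Qed.

Lemma sqr_lt {R : realType} (a b : R) : 0 < a -> a < b -> a ^+ 2 < b ^+ 2.
Proof. by move=> a0 ab; rewrite ltrXn2r ?nnegrE//; lra. Qed.

Section competitors.
Context {R : realType}.
Variable mu : R -> R.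
Hypothesis mu_C1 : C1 mu.
Notation f := (forcing mu).
Implicit Types (W G U : R -> R) (a b c d k x y z t e r eps al p q m l D F : R).

Lemma linear_bound al F r x w : `|f x| <= F -> `|w| <= r -> `|al * f x * w| <= `|al| * F * r.
Proof.
move=> fF wr; rewrite (normrM _ w) (normrM al).
by apply: ler_pM; rewrite ?mulr_ge0// ler_wpM2l.
Qed.

(** An affine path of length [eps] balances gradient and potential, both of order 1. The condition
    [(p - w) * (q - w) <= 0] says that [w] lies between [p] and [q], in either order. *)
Lemma ramp eps al F D r a p q : 0 < eps -> `|p| <= r -> `|q| <= r ->
  (forall x, a <= x <= a + eps -> `|f x| <= F) ->
  (forall x w, a <= x <= a + eps -> (p - w) * (q - w) <= 0 -> (w ^+ 2 - mu x) ^+ 2 <= D) ->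
  competitor mu eps al a p (a + eps) q ((q - p) ^+ 2 / 2 + D / 4 + `|al| * F * r * eps).
Proof.
move=> e0 pr qr fF wD.
pose W x := (q - p) / eps * x + (p - (q - p) / eps * a).
have dW x : is_derive x 1 W ((q - p) / eps).
  by have := derD (derZ ((q - p) / eps) (derI x)) (derC (p - (q - p) / eps * a) x); rewrite mulr1 addr0.
have Wa : W a = p by rewrite /W; ring.
have Wb : W (a + eps) = q by rewrite /W; field; rewrite gt_eqF.
have ae : a <= a + eps by lra.
have cW := cont_derive dW.
set c := (X in competitor _ _ _ _ _ _ _ X).
suff h : \int[leb R]_(x in `[a, a + eps]) ndens mu eps al W (fun=> (q - p) / eps) x <= c.
  by have := competitor_C1 dW (@contC R _) h; rewrite Wa Wb.
rewrite /c.
have -> : (q - p) ^+ 2 / 2 + D / 4 + `|al| * F * r * eps =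
    (eps / 2 * ((q - p) / eps) ^+ 2 + (4 * eps)^-1 * D + `|al| * F * r) * (a + eps - a).
  by field; rewrite gt_eqF.
rewrite -Rint_cst//; apply: Rint_le; [|exact: itg_cst|].
  by apply: itg_cont; apply: ndens_cont => //; exact: contC.
move=> x /[dup] /andP[ax xa] xI; rewrite /ndens.
pose s := (x - a) / eps.
have s0 : 0 <= s by rewrite divr_ge0 ?subr_ge0// ltW.
have s1 : s <= 1 by rewrite ler_pdivrMr// mul1r; lra.
have Wx : W x = p + s * (q - p) by rewrite /W /s; field; rewrite gt_eqF.
have btw : (p - W x) * (q - W x) <= 0.
  have -> : (p - W x) * (q - W x) = - (s * (1 - s) * (q - p) ^+ 2) by rewrite Wx; ring.
  by rewrite oppr_le0; apply: mulr_ge0; [apply: mulr_ge0 => //; lra|exact: sqr_ge0].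
have Wr : `|W x| <= r.
  move: pr qr; rewrite !ler_norml Wx => /andP[p1 p2] /andP[q1 q2]; apply/andP; split; nra.
have h1 := wD x (W x) xI btw.
have h2 := linear_bound al (fF x xI) Wr.
have h3 : (4 * eps)^-1 * (W x ^+ 2 - mu x) ^+ 2 <= (4 * eps)^-1 * D.
  by rewrite ler_wpM2l// invr_ge0; lra.
have : - (al * f x * W x) <= `|al| * F * r by apply: le_trans (ler_norm _) _; rewrite normrN.
lra.
Qed.

Lemma constant_competitor eps al a b k :
  competitor mu eps al a k b k (\int[leb R]_(x in `[a, b]) ndens mu eps al (fun=> k) (fun=> 0) x).
Proof. exact: (competitor_C1 (W := fun=> k) (derC k) (@contC R 0)). Qed.

Variables (A B C1b eps al : R) (U U1 : R -> R).
Hypothesis S : lsol mu A B C1b eps al U U1.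
Hypothesis eps_gt0 : 0 < eps.
Variable F : R.
Hypothesis f_le : forall x, A <= x <= B -> `|f x| <= F.

Lemma ndens_lb x r D : A <= x <= B -> `|U x| <= r -> D <= (U x ^+ 2 - mu x) ^+ 2 ->
  (4 * eps)^-1 * D - `|al| * F * r <= ndens mu eps al U U1 x.
Proof.
move=> xAB Ur DU; rewrite /ndens.
have h2 := linear_bound al (f_le xAB) Ur.
have h3 : (4 * eps)^-1 * D <= (4 * eps)^-1 * (U x ^+ 2 - mu x) ^+ 2.
  by rewrite ler_wpM2l// invr_ge0; have := eps_gt0; lra.
have h4 : 0 <= eps / 2 * U1 x ^+ 2.
  by rewrite mulr_ge0 ?sqr_ge0//; have := eps_gt0; lra.
have : al * f x * U x <= `|al| * F * r by apply: le_trans (ler_norm _) _.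
lra.
Qed.

End competitors.

(** Otherwise [U] could be replaced by the constant [lam2], joined by a ramp at each end. As $U^2\le
    lam^2<lam2^2\le\mu$, the potential drops by at least $(lam2^2-lam^2)^2/(4\epsilon)$ per unit
    length, over a length at least [l / 2], whereas ramps and force cost a bounded amount. *)
Lemma exists_large {R : realType} (mu U U1 : R -> R) (A B C1b eps al F N c l lam lam2 : R) :
  C1 mu -> lsol mu A B C1b eps al U U1 -> 0 < eps ->
  (forall x, A <= x <= B -> `|forcing mu x| <= F) -> (forall x, A <= x <= B -> `|mu x| <= N) ->
  A <= c -> c + l <= B -> 0 < lam -> lam < lam2 -> 4 * eps <= l ->
  (forall x, c <= x <= c + l -> lam2 ^+ 2 <= mu x) ->
  8 * eps * (4 * lam2 ^+ 2 + (N + lam2 ^+ 2) ^+ 2 / 2 + 4 * (`|al| * F * lam2) * l) <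
    (lam2 ^+ 2 - lam ^+ 2) ^+ 2 * l ->
  exists2 x, c <= x <= c + l & lam < `|U x|.
Proof.
move=> mu_C1 S eps_gt0 f_le mu_le Ac cB l0 ll2 el mum + ; apply: contraPP => no.
have inAB x : c <= x <= c + l -> A <= x <= B.
  by move=> /andP[x1 x2]; rewrite (le_trans Ac x1) (le_trans x2 cB).
have e0 := eps_gt0.
have cnd : continuous (ndens mu eps al U U1) := ndens_cont mu_C1 (cont_derive (ls_der S)) (ls_cont S).
have Ul (x : R) : c <= x <= c + l -> `|U x| <= lam.
  by move=> xc; rewrite leNgt; apply/negP => Ux; apply: no; exists x.
have l_0 : 0 <= l by move: el e0; clear; lra.
have cAB : A <= c <= B by rewrite Ac (le_trans _ cB)// lerDl.
have F0 : 0 <= F by exact: le_trans (normr_ge0 _) (f_le c cAB).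
have N0 : 0 <= N by exact: le_trans (normr_ge0 _) (mu_le c cAB).
have lam2_0 : 0 < lam2 := lt_trans l0 ll2.
pose c1 := c + eps; pose c3 := c + l; pose c2 := c3 - eps.
have c01 : c <= c1 by rewrite lerDl ltW.
have c12 : c1 <= c2 by rewrite /c2 /c1 /c3; move: el e0; clear; lra.
have c23 : c2 <= c3 by rewrite gerBl ltW.
have c13 : c1 <= c3 by exact: le_trans c12 c23.
have c2e : c2 + eps = c3 by rewrite /c2; ring.
have Ac2 : A <= c2 by exact: le_trans (le_trans Ac c01) c12.
pose D := (N + lam2 ^+ 2) ^+ 2.
have Dw x w : A <= x <= B -> `|w| <= lam2 -> (w ^+ 2 - mu x) ^+ 2 <= D.
  move=> /mu_le; rewrite ler_norml => /andP[m1 m2] /sqr_norm_le wl.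
  have w20 := sqr_ge0 w; apply: sqr_norm_le; rewrite ler_norml; apply/andP.
  by move: m1 m2 wl w20; clear=> *; split; lra.
have Uc : `|U c| <= lam2 by apply: le_trans (Ul c _) (ltW ll2); rewrite lexx lerDl.
have Uc3 : `|U c3| <= lam2 by apply: le_trans (Ul c3 _) (ltW ll2); rewrite lexx andbT lerDl.
have l2l2 : `|lam2| <= lam2 by rewrite gtr0_norm.
have r1 := @ramp _ _ mu_C1 eps al F D lam2 c (U c) lam2 e0 Uc l2l2.
have r2 := @ramp _ _ mu_C1 eps al F D lam2 c2 lam2 (U c3) e0 l2l2 Uc3.
have fF a x : A <= a -> a + eps <= B -> a <= x <= a + eps -> `|forcing mu x| <= F.
  by move=> Aa aB /andP[x1 x2]; apply: f_le; rewrite (le_trans Aa x1) (le_trans x2 aB).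
have fF1 x := fF c x Ac; have fF2 x := fF c2 x.
have D1 : forall x w, c <= x <= c + eps -> (U c - w) * (lam2 - w) <= 0 -> (w ^+ 2 - mu x) ^+ 2 <= D.
  move=> x w /andP[x1 x2] pq; apply: Dw; last exact: between_norm pq.
  by apply: inAB; rewrite x1 (le_trans x2 (le_trans c12 c23)).
have D2 : forall x w, c2 <= x <= c2 + eps -> (lam2 - w) * (U c3 - w) <= 0 -> (w ^+ 2 - mu x) ^+ 2 <= D.
  move=> x w /andP[x1 x2] pq; apply: Dw; last exact: between_norm pq.
  by apply: inAB; rewrite (le_trans (le_trans c01 c12) x1) (le_trans x2)// c2e.
have c1B : c + eps <= B by exact: le_trans c13 cB.
have c2B : c2 + eps <= B by rewrite c2e.
have {}r1 := r1 (fun x h => fF1 x c1B h) D1.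
have {}r2 := r2 (fun x h => fF2 x Ac2 c2B h) D2.
rewrite c2e in r2.
have rc := constant_competitor mu eps al c1 c2 lam2.
have cat1 := competitor_cat mu_C1 c01 c12 r1 rc.
have cat2 := competitor_cat mu_C1 (le_trans c01 c12) c23 cat1 r2.
have c03 : c <= c3 by exact: le_trans c01 c13.
have := ls_min S Ac c03 cB cat2.
have ii a b : itg `[a, b] (ndens mu eps al U U1) by exact: itg_cont.
rewrite (Rint_cat c01 c13 (ii _ _)) (Rint_cat c12 c23 (ii _ _)).
have edge a b : c <= a -> a <= b -> b <= c3 ->
    - (`|al| * F * lam2) * (b - a) <= \int[leb R]_(x in `[a, b]) ndens mu eps al U U1 x.
  move=> ca ab bc; rewrite -Rint_cst//; apply: Rint_le => //; first exact: itg_cst.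
  move=> x /andP[ax xb].
  have xc : c <= x <= c + l by rewrite (le_trans ca ax) (le_trans xb bc).
  have xAB := inAB x xc.
  have := @ndens_lb _ _ _ _ _ al U U1 e0 F f_le x lam2 0 xAB (le_trans (Ul x xc) (ltW ll2)) (sqr_ge0 _).
  by rewrite mulr0 sub0r.
have e1 := edge c c1 (lexx c) c01 c13.
have e2 := edge c2 c3 (le_trans c01 c12) c23 (lexx _).
pose k2 := (lam2 ^+ 2 - lam ^+ 2) ^+ 2.
have mid : ((4 * eps)^-1 * k2 - 2 * (`|al| * F * lam2)) * (c2 - c1) +
    \int[leb R]_(x in `[c1, c2]) ndens mu eps al (fun=> lam2) (fun=> 0) x <=
    \int[leb R]_(x in `[c1, c2]) ndens mu eps al U U1 x.
  have icst : itg `[c1, c2] (ndens mu eps al (fun=> lam2) (fun=> 0)).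
    by apply: itg_cont; apply: ndens_cont => //; exact: contC.
  rewrite -(Rint_cst _ c12) -RintD//; last exact: itg_cst.
  apply: Rint_le => //; first by apply: itgD => //; exact: itg_cst.
  move=> x /andP[x1 x2].
  have xc : c <= x <= c + l by rewrite (le_trans c01 x1) (le_trans x2 c23).
  have xAB := inAB x xc.
  have m := mum x xc; have Ux := Ul x xc.
  have U2 : U x ^+ 2 <= lam ^+ 2 by exact: sqr_norm_le.
  have ll : lam ^+ 2 < lam2 ^+ 2 by exact: sqr_lt.
  have DD : (lam2 ^+ 2 - mu x) ^+ 2 + k2 <= (U x ^+ 2 - mu x) ^+ 2.
    exact: sqr_gap_le.
  have e6 := ndens_lb al U1 e0 f_le xAB (le_trans Ux (ltW ll2)) DD; rewrite mulrDr in e6.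
  have := linear_bound al (f_le x xAB) l2l2; rewrite ler_norml => /andP[h1 _].
  have -> : ndens mu eps al (fun=> lam2) (fun=> 0) x =
      (4 * eps)^-1 * (lam2 ^+ 2 - mu x) ^+ 2 - al * forcing mu x * lam2.
    by rewrite /ndens expr0n/= mulr0 add0r.
  by move: h1 e6; clear; lra.
move=> tot.
have P0 : 0 <= `|al| * F * lam2 by rewrite !mulr_ge0//; exact: ltW.
have sq1 : (lam2 - U c) ^+ 2 <= 4 * lam2 ^+ 2.
  exact: sqr_sub_le.
have sq2 : (U c3 - lam2) ^+ 2 <= 4 * lam2 ^+ 2.
  by rewrite -sqrrN opprB; exact: sqr_sub_le.
have c21 : c2 - c1 = l - 2 * eps by rewrite /c2 /c3 /c1; ring.
have c1c : c1 - c = eps by rewrite /c1; ring.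
have c3c2 : c3 - c2 = eps by rewrite /c2; ring.
rewrite c21 in mid; rewrite c1c in e1; rewrite c3c2 in e2.
have k20 : 0 <= k2 := sqr_ge0 _.
move: P0 tot e1 e2 mid; rewrite -/D -/k2.
move: (`|al| * F * lam2) => P P0.
set I1 := Rintegral _ _ _; set I2 := Rintegral _ _ _; set I3 := Rintegral _ _ _.
set I4 := Rintegral _ _ _ => tot e1 e2 mid.
apply/negP; rewrite -leNgt.
have D0 : 0 <= D := sqr_ge0 _.
move: tot e1 e2 mid sq1 sq2 e0 el l_0 P0 k20 D0; clear.
move: I1 I2 I3 I4 k2 D ((lam2 - U c) ^+ 2) ((U c3 - lam2) ^+ 2) (lam2 ^+ 2).
move=> I1 I2 I3 I4 k2 D s1 s2 L2 tot e1 e2 mid sq1 sq2 e0 el l_0 P0 k20 D0.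
have main : (4 * eps)^-1 * k2 * (l - 2 * eps) <= 4 * L2 + D / 2 + 2 * P * l by lra.
have half : (4 * eps)^-1 * k2 * (l / 2) <= (4 * eps)^-1 * k2 * (l - 2 * eps).
  rewrite ler_wpM2l//; first by rewrite mulr_ge0// invr_ge0 mulr_ge0// ltW.
  by move: el; clear; lra.
have e8 : (4 * eps)^-1 * k2 * (l / 2) = k2 * l / (8 * eps) by field; rewrite gt_eqF.
have : k2 * l / (8 * eps) <= 4 * L2 + D / 2 + 2 * P * l by rewrite -e8; exact: le_trans half main.
rewrite ler_pdivrMr; last by rewrite mulr_gt0.
have : 0 <= P * l * eps by rewrite !mulr_ge0// ltW.
clear; lra.
Qed.

(** Filling the dip with the constant [lam] removes the gradient and lowers the potential by at
    least [(lam - U x) * (lam * (m - lam ^+ 2) / (2 * eps))]. The change of the force is also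
    proportional to [lam - U x], so the density decreases at each interior point. *)
Lemma no_dip {R : realType} (mu U U1 : R -> R) (A B C1b eps al F c d lam m : R) :
  C1 mu -> lsol mu A B C1b eps al U U1 -> 0 < eps ->
  (forall x, A <= x <= B -> `|forcing mu x| <= F) ->
  A <= c -> c < d -> d <= B -> 0 < lam -> lam ^+ 2 < m ->
  (forall x, c <= x <= d -> m <= mu x) ->
  2 * eps * (`|al| * F) < lam * (m - lam ^+ 2) ->
  U c = lam -> U d = lam -> ~ (forall x, c < x < d -> 0 <= U x < lam).
Proof.
move=> mu_C1 S e0 f_le Ac cd dB l0 lm mum small Uc Ud Ux.
have cnd : continuous (ndens mu eps al U U1) := ndens_cont mu_C1 (cont_derive (ls_der S)) (ls_cont S).
have kc' : competitor mu eps al c (U c) d (U d) (\int[leb R]_(x in `[c, d]) ndens mu eps al (fun=> lam) (fun=> 0) x).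
  by rewrite Uc Ud; exact: constant_competitor.
have := ls_min S Ac (ltW cd) dB kc'.
have cc : continuous (ndens mu eps al (fun=> lam) (fun=> 0)) by apply: ndens_cont => //; exact: contC.
apply/negP; rewrite -ltNge -subr_lt0 -RintB; [|exact: itg_cont|exact: itg_cont].
apply: Rint_lt0 => //; first exact: contB.
move=> x xcd; have /andP[cx xd] := xcd; have /andP[U0 Ul] := Ux x xcd.
have xAB : A <= x <= B by rewrite (le_trans Ac (ltW cx)) (le_trans (ltW xd) dB).
have m' : m <= mu x by apply: mum; rewrite !ltW.
have g0 : 0 <= eps / 2 * U1 x ^+ 2 by rewrite mulr_ge0 ?sqr_ge0// divr_ge0// ltW.
have lin : - (al * forcing mu x * (lam - U x)) <= `|al| * F * (lam - U x).
  apply: le_trans (ler_norm _) _; rewrite normrN; apply: linear_bound; first exact: f_le.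
  by rewrite gtr0_norm// subr_gt0.
have pot : (lam ^+ 2 - mu x) ^+ 2 - (U x ^+ 2 - mu x) ^+ 2 <= - (lam - U x) * (2 * lam * (m - lam ^+ 2)).
  have U2 : U x ^+ 2 <= lam ^+ 2 by apply: sqr_norm_le; rewrite ger0_norm// ltW.
  have -> : (lam ^+ 2 - mu x) ^+ 2 - (U x ^+ 2 - mu x) ^+ 2 =
    - (lam - U x) * ((lam + U x) * (2 * mu x - lam ^+ 2 - U x ^+ 2)) by ring.
  rewrite ler_wnM2l//; first by rewrite oppr_le0 subr_ge0 ltW.
  have h1 : 2 * (m - lam ^+ 2) <= 2 * mu x - lam ^+ 2 - U x ^+ 2 by move: m' U2; clear; lra.
  have h2 : lam <= lam + U x by rewrite lerDl.
  have -> : 2 * lam * (m - lam ^+ 2) = lam * (2 * (m - lam ^+ 2)) by ring.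
  by apply: ler_pM => //; [exact: ltW|rewrite mulr_ge0// subr_ge0 ltW].
have e4 : (4 * eps)^-1 * (- (lam - U x) * (2 * lam * (m - lam ^+ 2))) =
    - ((lam - U x) * (lam * (m - lam ^+ 2) / (2 * eps))) by field; rewrite gt_eqF.
have pot' : (4 * eps)^-1 * (lam ^+ 2 - mu x) ^+ 2 - (4 * eps)^-1 * (U x ^+ 2 - mu x) ^+ 2 <=
    - ((lam - U x) * (lam * (m - lam ^+ 2) / (2 * eps))).
  by rewrite -e4 -mulrBr ler_wpM2l// invr_ge0 mulr_ge0// ltW.
have : (lam - U x) * (`|al| * F) < (lam - U x) * (lam * (m - lam ^+ 2) / (2 * eps)).
  by rewrite ltr_pM2l ?subr_gt0// ltr_pdivlMr ?mulr_gt0// mulrC.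
by rewrite /ndens expr0n/= mulr0 add0r; move: g0 lin pot'; clear; lra.
Qed.

(** By [exists_large], [U] exceeds [lam] somewhere on each side of [y]; a value below [lam] at [y]
    would be a dip between the two. *)
Lemma sol_ge {R : realType} (mu U U1 : R -> R) (A B C1b eps al F N y L lam lam2 : R) :
  C1 mu -> lsol mu A B C1b eps al U U1 -> 0 < eps ->
  (forall x, A <= x <= B -> `|forcing mu x| <= F) -> (forall x, A <= x <= B -> `|mu x| <= N) ->
  A <= y - L -> y + L <= B -> 0 < L -> 0 < lam -> lam < lam2 ->
  (forall x, y - L <= x <= y + L -> lam2 ^+ 2 <= mu x) ->
  (forall x, y - L <= x <= y + L -> 0 < U x) ->
  4 * eps <= L ->
  8 * eps * (4 * lam2 ^+ 2 + (N + lam2 ^+ 2) ^+ 2 / 2 + 4 * (`|al| * F * lam2) * L) <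
    (lam2 ^+ 2 - lam ^+ 2) ^+ 2 * L ->
  2 * eps * (`|al| * F) < lam * (lam2 ^+ 2 - lam ^+ 2) ->
  lam <= U y.
Proof.
move=> mu_C1 S e0 f_le mu_le Ay yB L0 l0 ll2 mum Upos eL s1 s2.
rewrite leNgt; apply/negP => Uy.
have ll : lam ^+ 2 < lam2 ^+ 2 by exact: sqr_lt.
have [yL yL'] : y - L <= y /\ y <= y + L by rewrite gerBl lerDl ltW.
have [c /andP[c1 c2] Uc] : exists2 x, y - L <= x <= y - L + L & lam < `|U x|.
  apply: (exists_large mu_C1 S e0 f_le mu_le Ay _ l0 ll2 eL) => //; rewrite subrK.
    exact: le_trans yL' yB.
  by move=> x /andP[x1 x2]; apply: mum; rewrite x1 (le_trans x2).
have [d /andP[d1 d2] Ud] : exists2 x, y <= x <= y + L & lam < `|U x|.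
  apply: (exists_large mu_C1 S e0 f_le mu_le (le_trans Ay yL) yB l0 ll2 eL) => //.
  by move=> x /andP[x1 x2]; apply: mum; rewrite (le_trans yL x1).
rewrite subrK in c2.
rewrite gtr0_norm in Uc; last by apply: Upos; rewrite c1 (le_trans c2).
rewrite gtr0_norm in Ud; last by apply: Upos; rewrite d2 (le_trans yL).
have cy : c < y.
  by rewrite lt_neqAle c2 andbT; apply/eqP => e; move: Uc; rewrite e => /(lt_trans Uy); rewrite ltxx.
have yd : y < d.
  by rewrite lt_neqAle d1 andbT; apply/eqP => e; move: Ud; rewrite -e => /(lt_trans Uy); rewrite ltxx.
have ch : continuous (fun x => lam - U x) := contB (@contC R lam) (cont_derive (ls_der S)).
have [||c' [cc' c'y /eqP Uc' Pc]] := @last_nonpos _ (fun x => lam - U x) c y ch cy.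
- by rewrite subr_le0 ltW.
- by rewrite subr_gt0.
have [||d' [yd' d'd /eqP Ud' Pd]] := @first_nonpos _ (fun x => lam - U x) y d ch yd.
- by rewrite subr_gt0.
- by rewrite subr_le0 ltW.
have c'1 := le_trans c1 cc'; have d'1 := le_trans d'd d2.
have win x : c' < x < d' -> y - L <= x <= y + L.
  by move=> /andP[x1 x2]; rewrite (le_trans c'1 (ltW x1)) (le_trans (ltW x2) d'1).
apply: (@no_dip _ mu U U1 A B C1b eps al F c' d' lam (lam2 ^+ 2)) => //.
- exact: le_trans Ay c'1.
- exact: lt_trans c'y yd'.
- exact: le_trans d'1 yB.
- by move=> x /andP[x1 x2]; apply: mum; rewrite (le_trans c'1 x1) (le_trans x2 d'1).
- by apply/eqP; rewrite eq_sym -subr_eq0.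
- by apply/eqP; rewrite eq_sym -subr_eq0.
move=> x xcd; rewrite ltW ?Upos ?win//=; have /andP[x1 x2] := xcd.
case: (leP x y) => xy.
  by have := Pc x; rewrite x1 xy subr_gt0 => /(_ isT).
by have := Pd x; rewrite x2 (ltW xy) subr_gt0 => /(_ isT).
Qed.

(** * Cost of a transition *)

Section three_halves.
Context {R : realType}.
Implicit Types (g : R -> R) (a b c t x K : R).

Definition pow32 t : R := t * Num.sqrt t.

Lemma pow32_cube t : 0 <= t -> Num.sqrt t ^+ 3 = pow32 t.
Proof. by move=> t0; rewrite /pow32 exprSr sqr_sqrtr. Qed.

Lemma pow32_le a b : 0 <= a -> a <= b -> pow32 a <= pow32 b.
Proof. by move=> a0 ab; apply: ler_pM => //; rewrite ?ler_wsqrtr ?sqrtr_ge0. Qed.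

Lemma sqrt_le K t : 1 <= K -> t <= K -> Num.sqrt t <= K.
Proof.
move=> K1 tK; have K0 : 0 <= K by lra.
rewrite -[leRHS]ger0_norm// -sqrtr_sqr ler_wsqrtr//; apply: (le_trans tK).
by rewrite expr2 ler_peMl.
Qed.

Lemma sqrt_ge k t : 0 <= k -> k <= 1 -> k <= t -> k <= Num.sqrt t.
Proof.
move=> k0 k1 kt; rewrite -[leLHS]ger0_norm// -sqrtr_sqr ler_wsqrtr//.
by apply: le_trans kt; rewrite expr2 ler_piMl.
Qed.

Lemma pow32_lip K a b : 1 <= K -> 0 <= b -> b <= a -> a <= K ->
  pow32 a - pow32 b <= 2 * K * (a - b).
Proof.
move=> K1 b0 ba aK; have a0 := le_trans b0 ba.
rewrite -!pow32_cube// -[X in _ * (X - _)](sqr_sqrtr a0) -[X in _ * (_ - X)](sqr_sqrtr b0).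
have xy := ler_wsqrtr ba; have y0 := sqrtr_ge0 b; have xK := sqrt_le K1 aK.
move: (Num.sqrt a) (Num.sqrt b) xy y0 xK => x y xy y0 xK.
have -> : x ^+ 3 - y ^+ 3 = (x - y) * (x ^+ 2 + x * y + y ^+ 2) by ring.
have -> : 2 * K * (x ^+ 2 - y ^+ 2) = (x - y) * (2 * K * (x + y)) by ring.
rewrite ler_wpM2l ?subr_ge0//.
have h1 : x * x <= K * x by rewrite ler_wpM2r//; lra.
have h2 : x * y <= K * y by rewrite ler_wpM2r//; lra.
have h3 : y * y <= K * y by rewrite ler_wpM2r//; lra.
have : 0 <= K * x by apply: mulr_ge0; lra.
rewrite !expr2; lra.
Qed.

Lemma pow32_gap a b : 0 <= b -> b <= a -> (a - b) * Num.sqrt a <= pow32 a - pow32 b.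
Proof.
move=> b0 ba; have := ler_wpM2l b0 (ler_wsqrtr ba); rewrite /pow32; lra.
Qed.

Lemma Rint_sqrt g g1 a b : a <= b -> (forall x, is_derive x 1 g (g1 x)) -> continuous g1 ->
  (forall x, a <= x <= b -> 0 < g x) ->
  \int[leb R]_(x in `[a, b]) (g1 x * Num.sqrt (g x)) = 2 / 3 * (pow32 (g b) - pow32 (g a)).
Proof.
move=> ab dg cg1 g0.
have cs : continuous (fun x => g1 x * Num.sqrt (g x)).
  apply: contM => // x; apply: (continuous_comp (f := g)); first exact: (cont_derive dg).
  exact: sqrt_continuous.
have d x : a <= x <= b -> is_derive x 1 (fun x => 2 / 3 * (g x * Num.sqrt (g x))) (g1 x * Num.sqrt (g x)).
  move=> xab; have gx := g0 x xab.
  have ds := @der_comp _ Num.sqrt g x _ _ (is_derive1_sqrt gx) (dg x).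
  have := derZ (2 / 3) (derM (dg x) ds).
  set l := (X in is_derive _ _ _ X -> _); suff -> : l = g1 x * Num.sqrt (g x) by [].
  rewrite /l; have s0 : Num.sqrt (g x) != 0 by rewrite gt_eqF// sqrtr_gt0.
  have gs : g x = Num.sqrt (g x) ^+ 2 by rewrite sqr_sqrtr// ltW.
  move: s0 gs; move: (Num.sqrt (g x)) => s s0 ->.
  by field.
by rewrite (Rint_derive ab d (continuous_subspaceT cs)) /pow32; ring.
Qed.

End three_halves.

(** * The bound [K], the tolerance [kap] and the smallness of [eps] *)

Section parameters.
Context {R : realType}.
Implicit Types (K kap eps : R).

(* [mu] varies by at most [kap / 4] on a [window]; [layer] is the half-width, in
   units of [eps], of the transition profile used as a competitor. *)
Definition window K kap : R := kap / (8 * K).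

Definition layer K kap : R := 4 * K / kap.

(** [K] and [kap] are fixed before [eps]. The field [se_large] serves [exists_large], [se_lin] and
    [se_quad] serve the upper bounds, [se_layer] makes the profile and its two ramps fit in a
    window, and [se_pot] and [se_flux] reduce the errors of the profile to the order of [kap]. *)
Record small_eps K kap eps : Prop := {
  se_gt0 : 0 < eps;
  se_window : 4 * eps <= window K kap;
  se_large : 8 * eps * (4 * K + (2 * K) ^+ 2 / 2 + 4 * K ^+ 3 * window K kap) <
    (kap / 2) ^+ 2 * window K kap;
  se_lin : eps * K ^+ 2 <= kap ^+ 2 / 8;
  se_quad : 4 * K * eps ^+ 2 < kap ^+ 2 / 4 * (window K kap / 4) ^+ 2;
  se_layer : (layer K kap + 1) * eps <= window K kap / 4;
  se_pot : layer K kap / 2 * (2 * K + 1) * (2 * K * layer K kap * eps) <= kap;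
  se_flux : 2 * K ^+ 3 * (layer K kap + 1) * eps <= kap }.

Lemma window_gt0 K kap : 1 <= K -> 0 < kap -> 0 < window K kap.
Proof. by move=> K1 k0; apply: divr_gt0 => //; lra. Qed.

Lemma window_le K kap : 1 <= K -> 0 < kap -> 2 * K * window K kap = kap / 4.
Proof. by move=> K1 k0; rewrite /window; field; rewrite gt_eqF; lra. Qed.

Lemma layer_gt0 K kap : 1 <= K -> 0 < kap -> 0 < layer K kap.
Proof. by move=> K1 k0; apply: divr_gt0 => //; lra. Qed.

Lemma near_mul_lt (c d : R) : 0 < d -> \forall eps \near 0^'+, eps * c < d.
Proof.
move=> d0; near=> eps.
have e0 : 0 < eps by [].
apply: (@le_lt_trans _ _ (eps * (`|c| + 1))).
  by rewrite ler_wpM2l ?(ltW e0)// (le_trans (ler_norm c))// lerDl.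
rewrite -ltr_pdivlMr; last by rewrite ltr_wpDl.
near: eps; apply: nbhs_right_lt; apply: divr_gt0 => //; exact: ltr_wpDl.
Unshelve. all: by end_near. Qed.

Lemma near_small_eps K kap : 1 <= K -> 0 < kap -> \forall eps \near 0^'+, small_eps K kap eps.
Proof.
move=> K1 k0.
have w0 := window_gt0 K1 k0; have l0 := layer_gt0 K1 k0.
near=> eps.
have e0 : 0 < eps by [].
have e1 : eps < 1 by near: eps; exact: nbhs_right_lt.
split => //.
- by rewrite mulrC; apply: ltW; near: eps; exact: near_mul_lt.
- set c := (X in 8 * eps * X); have -> : 8 * eps * c = eps * (8 * c) by ring.
  near: eps; apply: near_mul_lt.
  by rewrite mulr_gt0// exprn_gt0// divr_gt0.
- by apply: ltW; near: eps; apply: near_mul_lt; rewrite divr_gt0// exprn_gt0.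
- apply: (@le_lt_trans _ _ (eps * (4 * K))).
    by rewrite expr2 mulrA [leRHS]mulrC; apply: ler_piMr; [apply: mulr_ge0; lra|exact: ltW].
  by near: eps; apply: near_mul_lt; rewrite mulr_gt0// ?exprn_gt0// divr_gt0// exprn_gt0.
- by rewrite mulrC; apply: ltW; near: eps; apply: near_mul_lt; rewrite divr_gt0.
- rewrite mulrA mulrC; apply: ltW; near: eps; exact: near_mul_lt.
- rewrite mulrC; apply: ltW; near: eps; exact: near_mul_lt.
Unshelve. all: by end_near. Qed.

End parameters.

Section uniform_bounds.
Context {R : realType}.
Variable mu : R -> R.
Hypothesis mu_C1 : C1 mu.
Notation f := (forcing mu).
Variables (A B K kap eps : R).
Hypothesis K_ge1 : 1 <= K.
Hypothesis kap_gt0 : 0 < kap.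
Hypothesis kap_le1 : kap <= 1.
Hypothesis E : small_eps K kap eps.
Hypothesis f_le : forall x, A <= x <= B -> `|f x| <= K.
Hypothesis mu_le : forall x, A <= x <= B -> `|mu x| <= K.
Implicit Types (U : R -> R) (a b c x y z t al : R).
Notation L := (window K kap).

Let L_gt0 : 0 < L := window_gt0 K_ge1 kap_gt0.
Let L_le : 2 * K * L = kap / 4 := window_le K_ge1 kap_gt0.

Lemma mu_lip x y : A <= x -> x <= y -> y <= B -> `|mu y - mu x| <= 2 * K * (y - x).
Proof.
move=> Ax xy yB.
have d1 t : x < t < y -> - (2 * K) <= derive1 mu t <= 2 * K.
  move=> /andP[xt ty].
  have : `|f t| <= K by apply: f_le; rewrite (le_trans Ax (ltW xt)) (le_trans (ltW ty) yB).
  rewrite /forcing ler_norml; lra.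
have h1 := @derive_ge _ mu (derive1 mu) x y (- (2 * K)) xy (mu_derive mu_C1).
have h2 := @derive_ge _ (fun x => - mu x) (fun x => - derive1 mu x) x y (- (2 * K)) xy
  (fun t => derN (mu_derive mu_C1 t)).
rewrite ler_norml; apply/andP; split.
  by rewrite -mulNr; apply: h1 => t /d1/andP[].
have : - (2 * K) * (y - x) <= - mu y - - mu x.
  by apply: h2 => t /d1/andP[_ ?]; rewrite lerN2.
lra.
Qed.

Lemma mu_window y t : A <= y - L -> y + L <= B -> y - L <= t <= y + L -> `|mu t - mu y| <= kap / 4.
Proof.
move=> Ay yB /andP[t1 t2]; rewrite -L_le.
have K0 : 0 <= 2 * K by have := K_ge1; lra.
have L0 := L_gt0.
case: (leP t y) => ty.
  by rewrite distrC; apply: le_trans (mu_lip _ ty _) _; [lra|lra|rewrite ler_wpM2l//; lra].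
by apply: le_trans (mu_lip _ (ltW ty) _) _; [lra|lra|rewrite ler_wpM2l//; lra].
Qed.

(** The majorant [t] of [mu y] is required to be nonnegative: [t = mu y] serves where [mu] is
    nonnegative, and [t = 0] where it is not. *)
Lemma lsol_le al U U1 y t : lsol mu A B K eps al U U1 -> `|al| <= K -> A < y - L -> y + L < B ->
  0 <= t -> mu y <= t -> U y <= Num.sqrt (t + kap).
Proof.
move=> S alK Ay yB t0 mut.
have e0 := se_gt0 E; have k0 := kap_gt0; have K1 := K_ge1; have L0 := L_gt0.
have s_ge : kap <= Num.sqrt (t + kap) by apply: sqrt_ge => //; [exact: ltW|lra].
have kk : kap ^+ 2 <= Num.sqrt (t + kap) * kap by rewrite expr2 ler_wpM2r// ltW.
apply: (sol_le S e0 Ay yB L_gt0 (k := kap / 2) (F := K)).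
- by lra.
- by lra.
- move=> s sy; rewrite sqr_sqrtr; last by lra.
  have := mu_window (ltW Ay) (ltW yB) sy; rewrite ler_norml => /andP[_]; lra.
- by move=> s /andP[s1 s2]; apply: f_le; apply/andP; split; lra.
- apply: (@le_trans _ _ (eps * K ^+ 2)).
    rewrite -mulrA expr2; apply: ler_wpM2l; first exact: ltW.
    by apply: ler_wpM2r => //; lra.
  by have := se_lin E; have := sqr_ge0 kap; lra.
- apply: lt_le_trans (se_quad E) _; rewrite ler_wpM2r ?sqr_ge0//; lra.
Qed.

Lemma mul_al al c : `|al| <= K -> 0 <= c -> c <= K -> `|al| * K * c <= K ^+ 3.
Proof.
move=> alK c0 cK; have K1 := K_ge1; have -> : K ^+ 3 = K * K * K by ring.
by apply: ler_pM => //; [apply: mulr_ge0 => //; lra|apply: ler_wpM2r => //; lra].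
Qed.

Lemma large_cond al m : `|al| <= K -> kap <= m -> m <= K ->
  8 * eps * (4 * (m - kap / 2) + (K + (m - kap / 2)) ^+ 2 / 2 +
      4 * (`|al| * K * Num.sqrt (m - kap / 2)) * L) <
    ((m - kap / 2) - (m - kap)) ^+ 2 * L.
Proof.
move=> alK km mK; have k0 := kap_gt0; have K1 := K_ge1.
have -> : (m - kap / 2) - (m - kap) = kap / 2 by field.
apply: le_lt_trans (se_large E).
apply: ler_wpM2l; first by have := se_gt0 E; lra.
apply: lerD; first apply: lerD.
- by have := kap_gt0; lra.
- rewrite ler_pM2r ?invr_gt0// lerXn2r ?nnegrE; have := kap_gt0; have := K_ge1; lra.
- rewrite ler_wpM2r ?(ltW L_gt0)// ler_wpM2l//.
  by apply: mul_al => //; apply: sqrt_le => //; lra.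
Qed.

(** The levels of [exists_large] have squares [m - kap / 2] and [m - kap]; their gap [kap / 2] is
    the one that [se_large] prepares for. *)
Lemma lsol_large al U U1 c m : lsol mu A B K eps al U U1 -> `|al| <= K -> A <= c -> c + L <= B ->
  kap < m -> m <= K -> (forall x, c <= x <= c + L -> m - kap / 2 <= mu x) ->
  exists2 x, c <= x <= c + L & Num.sqrt (m - kap) < `|U x|.
Proof.
move=> S alK Ac cB km mK mum.
have e0 := se_gt0 E.
have k0 := kap_gt0; have K1 := K_ge1.
have p1 : 0 < m - kap by lra.
have p2 : 0 < m - kap / 2 by lra.
apply: (@exists_large R mu U U1 A B K eps al K K c L _ (Num.sqrt (m - kap / 2)) mu_C1 S) => //.
- by rewrite sqrtr_gt0.
- by rewrite ltr_sqrt//; lra.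
- exact: se_window E.
- by move=> x /mum; rewrite sqr_sqrtr// ltW.
- rewrite sqr_sqrtr ?(ltW p2)// sqr_sqrtr ?(ltW p1)//.
  by apply: large_cond => //; exact: ltW.
Qed.

Lemma lsol_ge al U U1 y : lsol mu A B K eps al U U1 -> `|al| <= K -> A <= y - L -> y + L <= B ->
  2 * kap <= mu y -> (forall x, y - L <= x <= y + L -> 0 < U x) -> Num.sqrt (mu y - kap) <= U y.
Proof.
move=> S alK Ay yB muy Upos.
have e0 := se_gt0 E.
have k0 := kap_gt0; have K1 := K_ge1.
have p1 : 0 < mu y - kap by lra.
have p2 : 0 < mu y - kap / 2 by lra.
have L0 := L_gt0.
have muK : mu y <= K by apply: le_trans (ler_norm _) (mu_le _); apply/andP; split; lra.
apply: (@sol_ge R mu U U1 A B K eps al K K y L _ (Num.sqrt (mu y - kap / 2)) mu_C1 S) => //.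
- by rewrite sqrtr_gt0.
- by rewrite ltr_sqrt//; lra.
- by move=> x xy; have := mu_window Ay yB xy; rewrite ler_norml sqr_sqrtr ?(ltW p2)// => /andP[+ _]; lra.
- exact: se_window E.
- rewrite sqr_sqrtr ?(ltW p2)// sqr_sqrtr ?(ltW p1)//.
  by apply: large_cond => //; lra.
- rewrite sqr_sqrtr ?(ltW p2)// sqr_sqrtr ?(ltW p1)//.
  have s_ge : kap <= Num.sqrt (mu y - kap) by apply: sqrt_ge => //; lra.
  apply: (@le_lt_trans _ _ (2 * (kap ^+ 2 / 8))).
    rewrite -mulrA; apply: ler_wpM2l => //; apply: le_trans (se_lin E).
    by rewrite expr2; apply: ler_wpM2l; [exact: ltW|apply: ler_wpM2r => //; have := K_ge1; lra].
  have -> : mu y - kap / 2 - (mu y - kap) = kap / 2 by field.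
  have : kap * kap <= Num.sqrt (mu y - kap) * kap by rewrite ler_wpM2r// ltW.
  have : 0 < kap * kap by exact: mulr_gt0.
  rewrite expr2; lra.
Qed.

End uniform_bounds.

(** * Energy recovered by removing a transition *)

Lemma amgm_wall {R : realType} (eps q d : R) : 0 < eps ->
  Num.sqrt 2 / 2 * (q * d) <= eps / 2 * d ^+ 2 + (4 * eps)^-1 * q ^+ 2.
Proof.
move=> e0; have r2 : Num.sqrt (2 : R) ^+ 2 = 2 by rewrite sqr_sqrtr.
move: (Num.sqrt 2) r2 => r r2.
rewrite -subr_ge0.
have -> : eps / 2 * d ^+ 2 + (4 * eps)^-1 * q ^+ 2 - r / 2 * (q * d) =
    (r * eps * d - q) ^+ 2 / (4 * eps) + eps * d ^+ 2 / 4 * (2 - r ^+ 2).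
  by field; rewrite gt_eqF.
by rewrite r2 subrr mulr0 addr0 divr_ge0 ?sqr_ge0//; lra.
Qed.

Lemma sqr_gap_ge {R : realType} (s u m : R) : u ^+ 2 <= s ^+ 2 -> s ^+ 2 <= m ->
  (s ^+ 2 - m) ^+ 2 + (s ^+ 2 - u ^+ 2) ^+ 2 <= (u ^+ 2 - m) ^+ 2.
Proof. by move: (s ^+ 2) (u ^+ 2) => a b ba am; nra. Qed.

(** The lower bound of [amgm_wall] is kept signed: with $q=s^2-U^2$ and $d=U'$ it is an exact
    derivative, whether or not [U] is monotone. *)
Lemma wall_integral {R : realType} (U U1 : R -> R) (s a b : R) : a <= b ->
  (forall x : R, is_derive x 1 U (U1 x)) -> continuous U1 ->
  itg `[a, b] (fun x => Num.sqrt 2 / 2 * ((s ^+ 2 - U x ^+ 2) * U1 x)) /\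
  \int[leb R]_(x in `[a, b]) (Num.sqrt 2 / 2 * ((s ^+ 2 - U x ^+ 2) * U1 x)) =
    Num.sqrt 2 / 2 * (s ^+ 2 * U b - 3^-1 * U b ^+ 3 - (s ^+ 2 * U a - 3^-1 * U a ^+ 3)).
Proof.
move=> ab dU cU1; have cU := cont_derive dU.
pose P (x : R) := Num.sqrt 2 / 2 * ((s ^+ 2 - U x ^+ 2) * U1 x).
have cP : continuous P.
  by apply: (contM (@contC R _)); apply: contM => //; apply: (contB (@contC R _)); exact: contX.
split; first exact: (itg_cont a b cP).
pose Q (x : R) := Num.sqrt 2 / 2 * (s ^+ 2 * U x - 3^-1 * (U x * (U x * U x))).
have dQ (x : R) : is_derive x 1 Q (P x).
  have := derZ (Num.sqrt 2 / 2) (derB (derZ (s ^+ 2) (dU x)) (derZ 3^-1 (derM (dU x) (derM (dU x) (dU x))))).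
  set l := (X in is_derive _ _ _ X -> _); suff -> : l = P x by [].
  by rewrite /l /P; field.
by rewrite (Rint_derive ab (fun x _ => dQ x) (continuous_subspaceT cP)) /Q; ring.
Qed.

Section wall.
Context {R : realType}.
Variable mu : R -> R.
Hypothesis mu_C1 : C1 mu.
Notation f := (forcing mu).
Variables (A B K kap eps : R).
Hypothesis K_ge1 : 1 <= K.
Hypothesis E : small_eps K kap eps.
Hypothesis f_le : forall x, A <= x <= B -> `|f x| <= K.
Implicit Types (U : R -> R) (a b c x y z t k al : R).
Notation L := (window K kap).

(** Since $U^2\le s^2\le\mu$, the square $(U^2-\mu)^2$ exceeds that of the constant by
    $(s^2-U^2)^2$, which [amgm_wall] combines with the gradient; the two force terms account for
    [2 * K ^+ 3]. *)
Lemma wall_density al U U1 s x k : A <= x <= B -> `|al| <= K -> 0 <= s -> s <= K ->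
  `|U x| <= s -> s ^+ 2 <= mu x -> `|k| = s ->
  ndens mu eps al (fun=> k) (fun=> 0) x + Num.sqrt 2 / 2 * ((s ^+ 2 - U x ^+ 2) * U1 x) - 2 * K ^+ 3
    <= ndens mu eps al U U1 x.
Proof.
move=> xAB alK s0 sK Us smu ks; have K1 := K_ge1; have e0 := se_gt0 E.
have k2 : k ^+ 2 = s ^+ 2 by rewrite -ks real_normK ?num_real.
have U2 : U x ^+ 2 <= s ^+ 2 by rewrite -(real_normK (num_real (U x))) lerXn2r ?nnegrE.
have h1 := amgm_wall (s ^+ 2 - U x ^+ 2) (U1 x) e0.
have h2 : (4 * eps)^-1 * ((s ^+ 2 - mu x) ^+ 2 + (s ^+ 2 - U x ^+ 2) ^+ 2) <=
    (4 * eps)^-1 * (U x ^+ 2 - mu x) ^+ 2.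
  by rewrite ler_wpM2l ?sqr_gap_ge// invr_ge0; lra.
have h3 w : `|w| <= s -> `|al * f x * w| <= K ^+ 3.
  move=> ws; apply: le_trans (linear_bound al (f_le xAB) ws) _.
  by apply: mul_al.
have := h3 _ Us; have := h3 k; rewrite ks lexx => /(_ isT).
rewrite !ler_norml => /andP[h4 _] /andP[_ h5].
rewrite mulrDr in h2; rewrite /ndens k2 expr0n/= mulr0 add0r; lra.
Qed.

End wall.

(** [lsol_large] on each side of [z] provides [a] and [b] where [U] reaches $\mp s$, with
    $s^2=\mu(z)-kap$. Replacing the transition by the constant [s] or [- s] saves
    $\frac{2\sqrt2}3s^3$ up to the force. Both signs are allowed because the half to be flipped
    depends on where the transition moves. *)
Lemma wall_gain {R : realType} (mu U U1 : R -> R) (A B K kap eps al z : R) :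
  C1 mu -> 1 <= K -> 0 < kap -> small_eps K kap eps ->
  (forall x, A <= x <= B -> `|forcing mu x| <= K) -> (forall x, A <= x <= B -> `|mu x| <= K) ->
  lsol mu A B K eps al U U1 -> `|al| <= K ->
  A <= z - window K kap -> z + window K kap <= B -> 2 * kap <= mu z -> U z = 0 ->
  (forall x, z - window K kap <= x < z -> U x < 0) ->
  (forall x, z < x <= z + window K kap -> 0 < U x) ->
  exists a b, [/\ z - window K kap <= a <= z, z <= b <= z + window K kap,
    U a = - Num.sqrt (mu z - kap), U b = Num.sqrt (mu z - kap) &
    forall k, `|k| = Num.sqrt (mu z - kap) -> competitor mu eps al a k b k
      (\int[leb R]_(x in `[a, b]) ndens mu eps al U U1 x
        - 2 * Num.sqrt 2 / 3 * pow32 (mu z - kap) + 4 * K ^+ 3 * window K kap)].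
Proof.
move=> mu_C1 K1 k0 E f_le mu_le S alK; set L := window K kap => Az zB muz Uz Uneg Upos.
have e0 := se_gt0 E.
have L0 : 0 < L by exact: window_gt0.
have cU : continuous U := cont_derive (ls_der S).
have zL : z - L <= z by rewrite gerBl ltW.
have zL' : z <= z + L by rewrite lerDl ltW.
have zAB : A <= z <= B by rewrite (le_trans Az zL) (le_trans zL' zB).
have muK : mu z <= K := le_trans (ler_norm _) (mu_le z zAB).
have muw x : z - L <= x <= z + L -> mu z - kap / 2 <= mu x.
  move=> xz; have := mu_window mu_C1 K1 k0 f_le Az zB xz; rewrite ler_norml => /andP[+ _].
  by move: k0; clear; lra.
have p0 : 0 < mu z - kap by move: muz k0; clear; lra.
set s := Num.sqrt (mu z - kap).
have s0 : 0 < s by rewrite sqrtr_gt0.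
have s2 : s ^+ 2 = mu z - kap by rewrite sqr_sqrtr// ltW.
have sK : s <= K by apply: sqrt_le => //; apply: le_trans muK; rewrite gerBl ltW.
have kmu : kap < mu z by rewrite -subr_gt0.
have large c : z - L <= c -> c <= z -> exists2 x, c <= x <= c + L & s < `|U x|.
  move=> c1 c2; apply: (lsol_large mu_C1 K1 k0 E f_le mu_le S alK) => //.
  - exact: le_trans Az c1.
  - by apply: le_trans zB; rewrite lerD2r.
  - move=> x /andP[x1 x2]; apply: muw; rewrite (le_trans c1 x1) (le_trans x2)//.
    by rewrite lerD2r.
have [x0 /andP[x01 x02] Ux0] := large (z - L) (lexx _) zL.
have [x1 /andP[x11 x12] Ux1] := large z zL (lexx _).
rewrite subrK in x02.
have x0z : x0 < z.
  by rewrite lt_neqAle x02 andbT; apply/eqP => e; move: Ux0; rewrite e Uz normr0 ltNge ltW.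
have zx1 : z < x1.
  by rewrite lt_neqAle x11 andbT; apply/eqP => e; move: Ux1; rewrite -e Uz normr0 ltNge ltW.
have Ux0n : U x0 < 0 by apply: Uneg; rewrite x01.
have Ux1p : 0 < U x1 by apply: Upos; rewrite zx1.
rewrite ltr0_norm// in Ux0; rewrite gtr0_norm// in Ux1.
have h0 : U x0 + s <= 0 by move: Ux0; clear; lra.
have h1 : 0 < U z + s by rewrite Uz add0r.
have h2 : 0 < s - U z by rewrite Uz subr0.
have h3 : s - U x1 <= 0 by rewrite subr_le0 ltW.
have [a [x0a az Ua Pa]] := last_nonpos (contD cU (@contC R s)) x0z h0 h1.
have [b [zb bx1 Ub Pb]] := first_nonpos (contB (@contC R s) cU) zx1 h2 h3.
have Ua' : U a = - s by apply/eqP; rewrite -addr_eq0 Ua.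
have Ub' : U b = s by apply/eqP; rewrite eq_sym -subr_eq0 Ub.
have za := le_trans x01 x0a; have bz := le_trans bx1 x12.
have ab : a <= b := ltW (lt_trans az zb).
have abz x : a <= x <= b -> z - L <= x <= z + L.
  by move=> /andP[x2 x3]; rewrite (le_trans za x2) (le_trans x3 bz).
have abAB x : a <= x <= b -> A <= x <= B.
  by move=> /abz/andP[x2 x3]; rewrite (le_trans Az x2) (le_trans x3 zB).
have Us x : a <= x <= b -> `|U x| <= s.
  move=> xab; have /andP[ax xb] := xab; have /andP[xz1 xz2] := abz x xab.
  rewrite ler_norml; case: (ltgtP x z) => xz.
  - have Un : U x < 0 by apply: Uneg; rewrite xz1.
    rewrite (ltW (lt_trans Un s0)) andbT.
    move: ax; rewrite le_eqVlt => /predU1P[<-|ax]; first by rewrite Ua'.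
    by have := Pa x; rewrite ax ltW// => /(_ isT); rewrite -subr_ge0 opprK => /ltW.
  - have Up : 0 < U x by apply: Upos; rewrite xz.
    rewrite (le_trans _ (ltW Up)) ?oppr_le0 ?(ltW s0)//=.
    move: xb; rewrite le_eqVlt => /predU1P[->|xb]; first by rewrite Ub'.
    by have := Pb x; rewrite (ltW xz) xb => /(_ isT); rewrite subr_gt0 => /ltW.
  - by rewrite xz Uz oppr_le0 (ltW s0).
exists a, b; split; [by rewrite za ltW|by rewrite (ltW zb) bz|by []|by []|].
move=> k ks; have cU1 := ls_cont S.
have cnd : continuous (ndens mu eps al U U1) by exact: ndens_cont.
have cnk : continuous (ndens mu eps al (fun=> k) (fun=> 0)) by apply: ndens_cont => //; exact: contC.
have [iP IP] := wall_integral s ab (ls_der S) cU1.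
have K30 : 0 <= 2 * K ^+ 3 by rewrite mulr_ge0// exprn_ge0// (le_trans ler01).
have cst : \int[leb R]_(x in `[a, b]) (2 * K ^+ 3) <= 4 * K ^+ 3 * L.
  have -> : 4 * K ^+ 3 * L = 2 * K ^+ 3 * (2 * L) by ring.
  by rewrite Rint_cst// ler_wpM2l//; move: za bz; clear; lra.
apply: (competitor_C1 (W := fun=> k) (derC k) (@contC R 0)).
have ik := itg_cont a b cnk.
have ic : itg `[a, b] (fun=> 2 * K ^+ 3) := itg_cst a b _.
have : \int[leb R]_(x in `[a, b]) (ndens mu eps al (fun=> k) (fun=> 0) x
      + Num.sqrt 2 / 2 * ((s ^+ 2 - U x ^+ 2) * U1 x) - 2 * K ^+ 3) <=
    \int[leb R]_(x in `[a, b]) ndens mu eps al U U1 x.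
  apply: Rint_le; [by apply: itgB => //; exact: itgD|exact: itg_cont|].
  move=> x xab; have xAB := abAB x xab.
  apply: (wall_density K1 E f_le U1 xAB alK (ltW s0) sK (Us x xab) _ ks).
  rewrite s2; apply: le_trans (muw x (abz x xab)); rewrite lerD2l lerN2 ler_pdivrMr//.
  by rewrite ler_peMr// ?ler1n// ltW.
have icp := itgD (measurable_itv _) ik iP.
rewrite (RintB icp ic) (RintD ik iP) IP Ua' Ub' -(pow32_cube (ltW p0)) -/s.
by move: cst; clear; lra.
Qed.

(** * Moving the transition to a zero of [mu] *)

Lemma flip_balance {R : realType} (K kap al P Pm Pp I0 I1 I2 J c w : R) :
  1 <= K -> 0 < kap -> 0 <= al -> al <= K ->
  I0 + I1 + I2 <= c + (I1 + 2 * al * J) + (I2 - 2 * Num.sqrt 2 / 3 * Pm + w) ->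
  c <= 4 * kap -> - kap <= I0 -> J <= 3^-1 * Pp -> w <= K ^+ 2 * kap ->
  Pp <= P + 12 * K * kap -> P - 2 * K * kap <= Pm ->
  2 / 3 * (Num.sqrt 2 - al) * P <= 20 * K ^+ 2 * kap.
Proof.
move=> K1 k0 al0 alK H c4 I0k JP wK PpP PmP.
have r0 : 0 <= Num.sqrt (2 : R) := sqrtr_ge0 _.
have r2 : Num.sqrt (2 : R) <= 2 by apply: sqrt_le => //; lra.
have h1 : al * J <= al * (3^-1 * (P + 12 * K * kap)) by rewrite ler_wpM2l//; lra.
have h2 : Num.sqrt 2 * (P - 2 * K * kap) <= Num.sqrt 2 * Pm by rewrite ler_wpM2l.
have h3 : al * (K * kap) <= K * (K * kap) by rewrite ler_wpM2r// mulr_ge0//; lra.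
have h4 : Num.sqrt 2 * (K * kap) <= 2 * (K * kap) by rewrite ler_wpM2r// mulr_ge0//; lra.
have h5 : K * kap <= K * (K * kap) by rewrite ler_peMl// mulr_ge0//; lra.
have h6 : kap <= K * kap by rewrite ler_peMl//; lra.
move: h1 h2 h3 h4 H wK; rewrite expr2 -!mulrA.
move: (K * (K * kap)) (K * kap) h5 h6 => KK Kk h5 h6.
lra.
Qed.

Section inner.
Context {R : realType}.
Variable mu : R -> R.
Hypothesis mu_C1 : C1 mu.
Notation f := (forcing mu).
Variables (A B K kap eps : R).
Hypothesis K_ge1 : 1 <= K.
Hypothesis kap_gt0 : 0 < kap.
Hypothesis E : small_eps K kap eps.
Hypothesis f_le : forall x, A <= x <= B -> `|f x| <= K.
Implicit Types (U : R -> R) (a b c x y z t k al : R).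
Notation L := (window K kap).

Lemma eps_le_window : eps <= L / 4.
Proof. by have := se_window E; lra. Qed.

(** Gradient and potential are nonnegative, so only the force can be negative, and over a length of
    order [eps] it is negligible. *)
Lemma ndens_int_lb al U U1 a b : lsol mu A B K eps al U U1 -> `|al| <= K ->
  A <= a -> a <= b -> b <= B -> b - a <= 2 * (layer K kap + 1) * eps ->
  - kap <= \int[leb R]_(x in `[a, b]) ndens mu eps al U U1 x.
Proof.
move=> S alK Aa ab bB bae.
have K1 := K_ge1; have e0 := se_gt0 E.
have cU : continuous U := cont_derive (ls_der S).
have K3 : 0 <= K ^+ 3 by rewrite exprn_ge0//; lra.
apply: (@le_trans _ _ (- (K ^+ 3) * (b - a))).
  have := se_flux E; have := ler_wpM2l K3 bae; lra.
rewrite -Rint_cst//; apply: Rint_le; [exact: itg_cst|by apply: itg_cont; apply: ndens_cont => //; exact: (ls_cont S)|].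
move=> x /andP[ax xb]; have xAB : A <= x <= B by rewrite (le_trans Aa ax) (le_trans xb bB).
have := ndens_lb al U1 e0 f_le xAB (ls_bd S xAB) (sqr_ge0 _).
rewrite mulr0 sub0r; apply: le_trans; rewrite lerN2; apply: mul_al => //; lra.
Qed.

Lemma short_ramp al a p q D : `|al| <= K -> A <= a -> a + eps <= B -> `|p| <= K -> `|q| <= K ->
  (forall x w, a <= x <= a + eps -> (p - w) * (q - w) <= 0 -> (w ^+ 2 - mu x) ^+ 2 <= D) ->
  competitor mu eps al a p (a + eps) q ((q - p) ^+ 2 / 2 + D / 4 + kap).
Proof.
move=> alK Aa aB pK qK wD.
have K1 := K_ge1; have k0 := kap_gt0; have e0 := se_gt0 E; have l0 := layer_gt0 K1 k0.
have [|W [G [h1 h2 h3 h4 h5]]] := @ramp _ mu mu_C1 eps al K D K a p q e0 pK qK _ wD.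
  by move=> x /andP[x1 x2]; apply: f_le; rewrite (le_trans Aa x1) (le_trans x2 aB).
exists W, G; split=> //; apply: le_trans h5 _; rewrite lerD2l.
have K3 : 0 <= K ^+ 3 * eps by rewrite mulr_ge0 ?exprn_ge0//; lra.
apply: (@le_trans _ _ (K ^+ 3 * eps)).
  by apply: ler_wpM2r; [exact: ltW|apply: mul_al => //; lra].
have := mulr_ge0 K3 (ltW l0); have := se_flux E; lra.
Qed.

Lemma flip_competitor al U U1 a b : lsol mu A B K eps al U U1 -> a <= b ->
  competitor mu eps al a (- U a) b (- U b)
    (\int[leb R]_(x in `[a, b]) ndens mu eps al U U1 x + 2 * al * \int[leb R]_(x in `[a, b]) (f x * U x)).
Proof.
move=> S ab.
have cU : continuous U := cont_derive (ls_der S).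
have cfU : continuous (fun x => f x * U x) by apply: contM => //; exact: f_continuous.
apply: (competitor_C1 (W := fun x => - U x) (G := fun x => - U1 x)).
- by move=> x; apply: derN; exact: ls_der S x.
- by move=> x; apply: cvgN; exact: (ls_cont S).
have i1 : itg `[a, b] (fun x => f x * U x) := itg_cont a b cfU.
have i2 : itg `[a, b] (ndens mu eps al U U1).
  by apply: itg_cont; apply: ndens_cont => //; exact: (ls_cont S).
under eq_Rintegral do rewrite ndens_flip.
by rewrite (RintD i2 (itgZ (2 * al) (measurable_itv _) i1)) (RintZ (2 * al) i1).
Qed.

End inner.

(** The competitor makes its transition in a ramp ending at the zero [l] of [mu], follows [- U] up
    to [a], and replaces the old transition by the positive constant. It saves the cost of that
    transition, proportional to $\sqrt2$, and loses the force between [l] and [a], proportional to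
    [al]. *)
Lemma inner_wall {R : realType} (mu U U1 : R -> R) (A B K kap eps al l z : R) :
  C1 mu -> 1 <= K -> 0 < kap -> kap <= 1 -> small_eps K kap eps ->
  (forall x, A <= x <= B -> `|forcing mu x| <= K) -> (forall x, A <= x <= B -> `|mu x| <= K) ->
  lsol mu A B K eps al U U1 -> 0 <= al -> al <= K ->
  A < l - 2 * window K kap -> l <= z -> z + window K kap < B -> mu l <= 0 ->
  (forall x : R, l - window K kap <= x <= l -> mu x <= 0) -> (forall x, l <= x <= z -> 0 <= mu x) ->
  (forall x, l <= x <= z -> forcing mu x <= 0) -> 2 * kap <= mu z -> U z = 0 ->
  (forall x, A <= x < z -> U x < 0) -> (forall x, z < x <= B -> 0 < U x) ->
  2 / 3 * (Num.sqrt 2 - al) * pow32 (mu z) <= 20 * K ^+ 2 * kap.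
Proof.
move=> mu_C1 K1 k0 k1 E f_le mu_le S al0 alK.
set L := window K kap => Al lz zB mul0 munp mupos fneg muz Uz Uneg Upos.
have e0 := se_gt0 E.
have eL := eps_le_window E; rewrite -/L in eL.
have L0 : 0 < L by exact: window_gt0.
have alK' : `|al| <= K by rewrite ger0_norm.
have [Al1 AlL zL2 lB] : [/\ A <= l - L, A <= l, z + L <= B & l + L < B].
  by move: Al zB lz L0; clear=> *; split; lra.
have cU : continuous U := cont_derive (ls_der S).
have KL := window_le K1 k0.
have l8 : l <= z - L.
  have zB' : z <= B by apply: le_trans zL2; rewrite lerDl ltW.
  have h := mu_lip mu_C1 f_le AlL lz zB'; rewrite ler_norml in h.
  have /andP[_ h2] := h.
  have K20 : 0 < 2 * K by rewrite mulr_gt0// (lt_le_trans ltr01).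
  rewrite lerBrDl addrC -lerBrDl -(ler_pM2l K20) KL.
  by move: h2 muz mul0 k0; clear; lra.
have lzL : A <= z - L := le_trans AlL l8.
have [a [b [/andP[az1 az2] /andP[zb1 zb2] Ua Ub wallk]]] := wall_gain mu_C1 K1 k0 E f_le mu_le S alK' lzL zL2 muz Uz
  (fun x h => Uneg x (introT andP (conj (le_trans lzL (proj1 (andP h))) (proj2 (andP h)))))
  (fun x h => Upos x (introT andP (conj (proj1 (andP h)) (le_trans (proj2 (andP h)) zL2)))).
have la : l <= a := le_trans l8 az1.
have ab : a <= b := le_trans az2 zb1.
have bB : b <= B := le_trans zb2 zL2.
have aB : a <= B := le_trans ab bB.
(* The ramp occupies [[c0, l]] and goes from [U c0] to [- U l]. Near [l] the modulus of [U] is at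
   most [Num.sqrt kap], hence a cost of at most [4 * kap]. *)
pose c0 := l - eps.
have c0l : c0 + eps = l by rewrite /c0 subrK.
have [lc0 c0_l] : l - L <= c0 /\ c0 <= l by rewrite /c0; move: eL L0 e0; clear=> *; split; lra.
have Ac0 : A <= c0 := le_trans Al1 lc0.
have lz' : l < z by apply: le_lt_trans l8 _; rewrite ltrBlDr ltrDl.
have Sn := lsol_neg S.
have alKn : `|- al| <= K by rewrite normrN.
have Unl y t : A < y - L -> y + L < B -> 0 <= t -> mu y <= t -> - U y <= Num.sqrt (t + kap).
  exact: lsol_le Sn alKn.
have rK : Num.sqrt kap <= K by apply: sqrt_le => //; exact: le_trans k1 K1.
have Ur y : l - eps <= y -> y <= l -> `|U y| <= Num.sqrt kap.
  move=> y1 y2; have yz := le_lt_trans y2 lz'.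
  have Ly : l - L <= y by apply: le_trans y1; exact: lc0.
  rewrite ltr0_norm; last by apply: Uneg; rewrite (le_trans Al1 Ly).
  have := Unl y 0; rewrite add0r; apply => //; last by apply: munp; rewrite Ly.
  - by rewrite -/L; move: Ly Al; clear; lra.
  - by rewrite -/L; move: y2 lB; clear; lra.
have Uc0 := Ur c0 (lexx _) c0_l; have Ul := Ur l c0_l (lexx _).
have UlK : `|- U l| <= K by rewrite normrN; exact: le_trans Ul rK.
have ramp1 := @short_ramp R mu mu_C1 A B K kap eps K1 k0 E f_le al c0 (U c0) (- U l) (4 * kap ^+ 2) alK' Ac0.
rewrite c0l in ramp1.
have {ramp1} ramp1 := ramp1 (ltW (lt_trans lz' (le_lt_trans zb1 (le_lt_trans zb2 zB)))) (le_trans Uc0 rK) UlK.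
have r2 : Num.sqrt kap ^+ 2 = kap by rewrite sqr_sqrtr// ltW.
have mul : mu l = 0 by apply: le_anti; rewrite mul0 mupos// lexx lz.
have Dw x w : c0 <= x <= l -> (U c0 - w) * (- U l - w) <= 0 -> (w ^+ 2 - mu x) ^+ 2 <= 4 * kap ^+ 2.
  move=> /andP[x1 x2] pq.
  have w2 : w ^+ 2 <= kap by rewrite -r2; apply: sqr_norm_le; apply: between_norm pq; rewrite ?normrN.
  have xl : l - L <= x <= l + L by rewrite (le_trans lc0 x1) (le_trans x2)// lerDl ltW.
  have := mu_window mu_C1 K1 k0 f_le Al1 (ltW lB) xl.
  rewrite mul subr0 => mux; have -> : 4 * kap ^+ 2 = (2 * kap) ^+ 2 by ring.
  apply: sqr_norm_le; apply: le_trans (ler_normB _ _) _.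
  by rewrite ger0_norm ?sqr_ge0//; move: w2 mux k0; clear; lra.
have {}ramp1 := ramp1 Dw.
have cost : (- U l - U c0) ^+ 2 / 2 + 4 * kap ^+ 2 / 4 + kap <= 4 * kap.
  have h : (- U l - U c0) ^+ 2 <= (2 * Num.sqrt kap) ^+ 2.
    apply: sqr_norm_le; apply: le_trans (ler_normB _ _) _; rewrite normrN.
    by move: Uc0 Ul; clear; lra.
  have h2 : kap ^+ 2 <= kap by rewrite expr2 ler_piMr// ltW.
  have h3 : (2 * Num.sqrt kap) ^+ 2 = 4 * kap by rewrite exprMn r2; ring.
  by rewrite h3 in h; move: h h2 k0; clear; lra.
have flip := flip_competitor mu_C1 S la.
rewrite Ua opprK in flip.
set s := Num.sqrt (mu z - kap) in flip Ua Ub wallk.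
have s0 : 0 <= s := sqrtr_ge0 _.
have wall := wallk s (ger0_norm s0).
have cat1 := competitor_cat mu_C1 c0_l la ramp1 flip.
rewrite -{2}Ub in wall.
have cat2 := competitor_cat mu_C1 (le_trans c0_l la) ab cat1 wall.
have := ls_min S Ac0 (le_trans (le_trans c0_l la) ab) bB cat2.
have ii x y : itg `[x, y] (ndens mu eps al U U1).
  by apply: itg_cont; apply: ndens_cont => //; exact: (ls_cont S).
rewrite (Rint_cat c0_l (le_trans la ab) (ii _ _)) (Rint_cat la ab (ii _ _)).
have I0 : - kap <= \int[leb R]_(x in `[c0, l]) ndens mu eps al U U1 x.
  apply: (ndens_int_lb mu_C1 K1 E f_le S alK' Ac0 c0_l).
    exact: le_trans la aB.
  have := layer_gt0 K1 k0; have := mulr_gt0 (layer_gt0 K1 k0) e0.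
  by rewrite /c0; move: e0; clear; lra.
have cfU : continuous (fun x => forcing mu x * U x) by apply: contM => //; exact: f_continuous.
have mua : mu a <= mu z + kap / 4.
  have := mu_window mu_C1 K1 k0 f_le lzL zL2 (t := a).
  have aw : a <= z + L by rewrite (le_trans az2)// lerDl ltW.
  by rewrite az1 aw ler_norml => /(_ isT)/andP[_]; clear; lra.
(* The bound [- U <= Num.sqrt (mu + kap)] and [f = - mu' / 2] majorize the integrand by an exact
   derivative; the added [kap] keeps the radicand positive at [l], where [mu] vanishes. *)
have J : \int[leb R]_(x in `[l, a]) (forcing mu x * U x) <= 3^-1 * pow32 (mu z + 2 * kap).
  have dm (x : R) : is_derive x 1 (fun x : R => mu x + kap) (derive1 mu x).
    by have := derD (mu_derive mu_C1 x) (derC kap x); rewrite addr0.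
  have mk x : l <= x <= a -> 0 < mu x + kap.
    by move=> /andP[x1 x2]; rewrite ltr_wpDl// mupos// x1 (le_trans x2).
  have := Rint_sqrt la dm (proj2 mu_C1) mk; rewrite mul add0r => JE.
  have csq : continuous (fun x => derive1 mu x * Num.sqrt (mu x + kap)).
    apply: contM; first exact: (proj2 mu_C1).
    move=> x; apply: (continuous_comp (f := fun x => mu x + kap)); first exact: (cont_derive dm).
    exact: sqrt_continuous.
  have : \int[leb R]_(x in `[l, a]) (forcing mu x * U x) <=
      \int[leb R]_(x in `[l, a]) (2^-1 * (derive1 mu x * Num.sqrt (mu x + kap))).
    apply: Rint_le; [exact: itg_cont|by apply: itg_cont; apply: (contM (@contC R _))|].
    move=> x /andP[x1 x2].
    have xz := le_trans x2 az2.
    have -> : 2^-1 * (derive1 mu x * Num.sqrt (mu x + kap)) = - forcing mu x * Num.sqrt (mu x + kap).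
      by rewrite /forcing; field.
    rewrite -mulrNN; apply: ler_wpM2l; first by rewrite oppr_ge0 fneg// x1.
    apply: Unl.
    - by apply: lt_le_trans Al _; move: x1 L0; clear; lra.
    - by move: xz zB; clear; lra.
    - by apply: mupos; rewrite x1.
    - exact: lexx.
  rewrite (RintZ _ (itg_cont _ _ csq)) JE => h; apply: (le_trans h).
  have p1 : pow32 (mu a + kap) <= pow32 (mu z + 2 * kap).
    apply: pow32_le; first by rewrite ltW// mk// la lexx.
    by move: mua k0; clear; lra.
  have p2 : 0 <= pow32 kap by rewrite mulr_ge0 ?sqrtr_ge0// ltW.
  by move: p1 p2; clear; lra.
move=> H; apply: (flip_balance K1 k0 al0 alK _ cost I0 J (w := 4 * K ^+ 3 * L)
  (Pm := pow32 (mu z - kap)) (I1 := \int[leb R]_(x in `[l, a]) ndens mu eps al U U1 x)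
  (I2 := \int[leb R]_(x in `[a, b]) ndens mu eps al U U1 x)).
- by rewrite !addrA in H *.
- have -> : 4 * K ^+ 3 * L = K ^+ 2 * 2 * (2 * K * L) by ring.
  rewrite KL; have := mulr_ge0 (sqr_ge0 K) (ltW k0); clear; lra.
- have muK : mu z <= K by apply: le_trans (ler_norm _) (mu_le z _); rewrite (le_trans AlL lz) (le_trans _ zL2)// lerDl ltW.
  have : pow32 (mu z + 2 * kap) - pow32 (mu z) <= 2 * (3 * K) * (mu z + 2 * kap - mu z).
    by apply: pow32_lip; move: muK K1 k0 k1 muz; clear; lra.
  clear; lra.
- have muK : mu z <= K by apply: le_trans (ler_norm _) (mu_le z _); rewrite (le_trans AlL lz) (le_trans _ zL2)// lerDl ltW.
  have : pow32 (mu z) - pow32 (mu z - kap) <= 2 * K * (mu z - (mu z - kap)).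
    by apply: pow32_lip; move: muK K1 k0 k1 muz; clear; lra.
  clear; lra.
Qed.

(** * The optimal transition profile *)

Section profile.
Context {R : realType}.
Implicit Types (x y s eps : R).

(* The hyperbolic tangent, whose rescaling [s * th (s * x / (sqrt 2 * eps))] is
   the transition of least cost between [- s] and [s]. *)
Definition th y : R := 1 - 2 / (expR (2 * y) + 1).

Lemma expR1_gt0 y : 0 < expR (2 * y) + 1.
Proof. by have := expR_gt0 (2 * y); lra. Qed.

Lemma is_derive_th y : is_derive y 1 th (1 - th y ^+ 2).
Proof.
have e0 := expR1_gt0 y.
have dg : is_derive y 1 (fun y => expR (2 * y) + 1) (expR (2 * y) * (2 * 1) + 0).
  exact: (derD (der_comp (is_derive_expR _) (derZ 2 (derI y))) (derC 1 y)).
have := derB (derC 1 y) (derZ 2 (@is_deriveV _ (fun y => expR (2 * y) + 1) y _ 1 (lt0r_neq0 e0) dg)).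
set l := (X in is_derive _ _ _ X -> _); suff -> : l = 1 - th y ^+ 2 by [].
rewrite /l /th /GRing.scale/=; field; exact: lt0r_neq0.
Qed.

Lemma thN y : th (- y) = - th y.
Proof.
have e0 := expR_gt0 (2 * y).
by rewrite /th mulrN expRN; field; rewrite !gt_eqF//= ?andbT; lra.
Qed.

Lemma th_le1 y : `|th y| <= 1.
Proof.
have e0 := expR_gt0 (2 * y); have e1 := expR1_gt0 y.
have h1 : 0 <= 2 / (expR (2 * y) + 1) by rewrite divr_ge0//; lra.
have h2 : 2 / (expR (2 * y) + 1) <= 2 by rewrite ler_pdivrMr//; lra.
by rewrite /th ler_norml; apply/andP; split; lra.
Qed.

Lemma th_sqr_le1 y : th y ^+ 2 <= 1.
Proof. by rewrite -[leRHS](expr1n _ 2); apply: sqr_norm_le; exact: th_le1. Qed.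

(** Algebraic decay is enough, because the layer may be taken as long as [4 * K / kap] once [kap] is
    fixed. *)
Lemma th_ge y : 0 < y -> 1 - th y <= y^-1.
Proof.
move=> y0; rewrite /th opprB addrC subrK.
have e1 := expR1_gt0 y; have := expR_ge1Dx (2 * y).
by move=> h; rewrite ler_pdivrMr// ler_pdivlMl//; lra.
Qed.

Lemma th_ge0 y : 0 <= y -> 0 <= th y.
Proof.
move=> y0; rewrite /th subr_ge0 ler_pdivrMr; last exact: expR1_gt0.
by have := expR_ge1Dx (2 * y); lra.
Qed.

End profile.

(** The slope chosen here is the equality case of [amgm_wall] when [mu] is frozen at [s]; replacing
    [s] by the true value [m] costs the last term. *)
Lemma profile_density {R : realType} (eps p m s e k r : R) : 0 < eps -> r ^+ 2 = 2 -> 0 < r ->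
  p ^+ 2 <= s -> `|m - s| <= e -> e <= 1 ->
  eps / 2 * ((s - p ^+ 2) / (r * eps)) ^+ 2 + (4 * eps)^-1 * (p ^+ 2 - m) ^+ 2 <=
  r / 2 * ((s - p ^+ 2) * ((s - p ^+ 2) / (r * eps))) + (4 * eps)^-1 * ((2 * s + 1) * e).
Proof.
move=> e0 r2 r0 ps ms e1.
set q := s - p ^+ 2.
have q0 : 0 <= q by rewrite subr_ge0.
have -> : eps / 2 * (q / (r * eps)) ^+ 2 = (4 * eps)^-1 * q ^+ 2 * (2 / r ^+ 2).
  by field; rewrite !gt_eqF.
have -> : r / 2 * (q * (q / (r * eps))) = (4 * eps)^-1 * q ^+ 2 + (4 * eps)^-1 * q ^+ 2.
  by field; rewrite !gt_eqF.
rewrite r2 divff// mulr1 -addrA lerD2l -mulrDr ler_wpM2l//; first by rewrite invr_ge0; lra.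
have -> : p ^+ 2 - m = - (q + (m - s)) by rewrite /q; ring.
have p0 := sqr_ge0 p.
have q_s : q <= s by rewrite /q; lra.
move: (m - s) ms => d; rewrite ler_norml => /andP[d1 d2].
have e_0 : 0 <= e by lra.
have h1 : q * d <= s * e by apply: (@le_trans _ _ (q * e)); [exact: ler_wpM2l|exact: ler_wpM2r].
have h2 : d ^+ 2 <= e.
  apply: (@le_trans _ _ (e ^+ 2)); first by apply: sqr_norm_le; rewrite ler_norml d1.
  by rewrite expr2 ler_piMl.
by rewrite sqrrN sqrrD -mulr_natl; lra.
Qed.

(** The profile solves $p'=(S^2-p^2)/(\sqrt2\,\epsilon)$ with $S^2=\mu(zeta)$ and is truncated at
    distance [layer K kap * eps], where it equals $\pm h$. *)
Lemma profile_competitor {R : realType} (mu : R -> R) (A B K kap eps al zeta : R) :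
  C1 mu -> 1 <= K -> 0 < kap -> kap <= 1 -> small_eps K kap eps ->
  (forall x, A <= x <= B -> `|forcing mu x| <= K) -> (forall x, A <= x <= B -> `|mu x| <= K) ->
  `|al| <= K -> A <= zeta - window K kap -> zeta + window K kap <= B -> 0 < mu zeta ->
  exists h, [/\ 0 <= h, h ^+ 2 <= mu zeta, mu zeta - h ^+ 2 <= kap &
    competitor mu eps al (zeta - layer K kap * eps) (- h) (zeta + layer K kap * eps) h
      (2 * Num.sqrt 2 / 3 * pow32 (mu zeta) + 2 * kap)].
Proof.
move=> mu_C1 K1 k0 k1 E f_le mu_le alK.
set L := window K kap; set N := layer K kap => Az zB muz.
have e0 := se_gt0 E.
have L0 : 0 < L by exact: window_gt0.
have N0 : 0 < N by exact: layer_gt0.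
have NL : N * eps <= L / 4 by have := se_layer E; rewrite -/L -/N; lra.
have KL : 2 * K * L = kap / 4 by exact: window_le.
have r2 : Num.sqrt (2 : R) ^+ 2 = 2 by rewrite sqr_sqrtr.
have r0 : 0 < Num.sqrt (2 : R) by rewrite sqrtr_gt0.
have rle : Num.sqrt (2 : R) <= 2 by apply: sqrt_le => //; lra.
set r := Num.sqrt 2 in r2 r0 rle *.
set S := Num.sqrt (mu zeta).
have S0 : 0 < S by rewrite sqrtr_gt0.
have S2 : S ^+ 2 = mu zeta by rewrite sqr_sqrtr// ltW.
have zAB : A <= zeta <= B by apply/andP; split; move: L0 Az zB; clear; lra.
have muK : mu zeta <= K := le_trans (ler_norm _) (mu_le _ zAB).
have SK : S <= K := sqrt_le K1 muK.
pose a := zeta - N * eps; pose b := zeta + N * eps.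
pose p (x : R) := S * th (S / (r * eps) * x + - (S / (r * eps) * zeta)).
pose p1 (x : R) := (S ^+ 2 - p x ^+ 2) / (r * eps).
have dp (x : R) : is_derive x 1 p (p1 x).
  have D := derD (derZ (S / (r * eps)) (derI x)) (derC (- (S / (r * eps) * zeta)) x).
  have := derZ S (@der_comp _ th (fun x : R => S / (r * eps) * x + - (S / (r * eps) * zeta)) x _ _ (is_derive_th _) D).
  set l := (X in is_derive _ _ _ X -> _); suff -> : l = p1 x by [].
  by rewrite /l /p1 /p; field; rewrite !gt_eqF.
have cp := cont_derive dp.
have cp1 : continuous p1.
  by apply: contM; [apply: contB; [exact: contC|exact: contX]|exact: contC].
set h := S * th (S * N / r).
have pb : p b = h by rewrite /p /h /b; congr (S * th _); field; rewrite !gt_eqF.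
have pa : p a = - h.
  rewrite /p /h -[RHS]mulrN -thN; congr (S * th _); rewrite /a; field; by rewrite !gt_eqF.
have p2 (x : R) : p x ^+ 2 <= S ^+ 2.
  by rewrite /p exprMn ler_piMr ?sqr_ge0 ?th_sqr_le1.
have ab : a <= b by have := mulr_gt0 N0 e0; rewrite /a /b; clear; lra.
exists h; split.
- by rewrite mulr_ge0 ?(ltW S0)// th_ge0// ltW// divr_gt0// mulr_gt0.
- by rewrite -S2 -pb.
(* By [th_ge] the defect is at most $2\sqrt2\,S/N$; the value [4 * K / kap] of [layer] is chosen to
   bring this below [kap]. *)
- have y0 : 0 < S * N / r by rewrite divr_gt0// mulr_gt0.
  have h1 := th_ge y0; have h2 := th_le1 (S * N / r); have h3 := th_ge0 (ltW y0).
  rewrite /h -S2 exprMn.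
  move: (th (S * N / r)) h1 h2 h3 => t h1 h2 h3; rewrite ger0_norm// in h2.
  have -> : S ^+ 2 - S ^+ 2 * t ^+ 2 = S ^+ 2 * ((1 - t) * (1 + t)) by ring.
  apply: (@le_trans _ _ (S ^+ 2 * ((S * N / r)^-1 * 2))).
    by rewrite ler_wpM2l ?sqr_ge0//; apply: ler_pM => //; move: h2 h3; clear; lra.
  have -> : S ^+ 2 * ((S * N / r)^-1 * 2) = 2 * (r * S) / N by field; rewrite !gt_eqF.
  have -> : kap = 2 * (2 * K) / N by rewrite /N /layer; field; rewrite !gt_eqF//; move: K1; clear; lra.
  rewrite ler_pM2r ?invr_gt0// ler_wpM2l//; apply: ler_pM => //; exact: ltW.
rewrite -/a -/b -pa -pb; apply: competitor_C1 => //.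
pose P (x : R) := r / 2 * ((S ^+ 2 - p x ^+ 2) * p1 x).
have [iP EP] := wall_integral S ab dp cp1; rewrite -/r -/P in iP EP.
have IP : \int[leb R]_(x in `[a, b]) P x <= 2 * r / 3 * pow32 (mu zeta).
  rewrite EP -pow32_cube; last exact: ltW.
  rewrite pb pa -/S.
  (* The truncated profile costs less than the full one, by a multiple of
     [(S - h) ^+ 2 * (2 * S + h)]. *)
  have -> : r / 2 * (S ^+ 2 * h - 3^-1 * h ^+ 3 - (S ^+ 2 * - h - 3^-1 * (- h) ^+ 3)) =
    2 * r / 3 * S ^+ 3 - r / 3 * ((S - h) ^+ 2 * (2 * S + h)) by field.
  rewrite gerBl; apply: mulr_ge0; first by apply: divr_ge0 => //; exact: ltW.
  apply: mulr_ge0; first exact: sqr_ge0.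
  have : 0 <= h by rewrite mulr_ge0 ?(ltW S0)// th_ge0// ltW// divr_gt0// mulr_gt0.
  by move: S0; clear; lra.
(* The variation of [mu] across the layer, as [2 * K] bounds its slope. *)
pose e := 2 * K * N * eps.
have e1 : e <= 1.
  have : 2 * K * (N * eps) <= 2 * K * (L / 4) by rewrite ler_wpM2l//; move: K1; clear; lra.
  by rewrite /e; move: KL k1; clear; lra.
pose c := (4 * eps)^-1 * ((2 * K + 1) * e) + K ^+ 3.
have bnd (x : R) : a <= x <= b -> ndens mu eps al p p1 x <= P x + c.
  move=> /andP[ax xb].
  have aL : A <= a by rewrite /a; move: NL L0 Az; clear; lra.
  have bL : b <= B by rewrite /b; move: NL L0 zB; clear; lra.
  have xAB : A <= x <= B by rewrite (le_trans aL ax) (le_trans xb bL).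
  have mx : `|mu x - mu zeta| <= e.
    have K20 : 0 <= 2 * K by move: K1; clear; lra.
    have /andP[Azz zzB] := zAB.
    rewrite /e -mulrA; case: (leP x zeta) => xz.
      rewrite distrC; apply: le_trans (mu_lip mu_C1 f_le (le_trans aL ax) xz zzB) _.
      by rewrite ler_wpM2l//; move: ax; rewrite /a; clear; lra.
    apply: le_trans (mu_lip mu_C1 f_le Azz (ltW xz) (le_trans xb bL)) _.
    by rewrite ler_wpM2l//; move: xb; rewrite /b; clear; lra.
  have px2 : p x ^+ 2 <= mu zeta by rewrite -S2.
  have h1 := @profile_density R eps (p x) (mu x) (mu zeta) e K r e0 r2 r0 px2 mx e1.
  have pS : `|p x| <= K.
    apply: le_trans SK; rewrite -(ger0_norm (ltW S0)) -ler_sqr ?nnegrE//.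
    by rewrite !real_normK ?num_real.
  have h2 := linear_bound al (f_le x xAB) pS.
  have h3 : `|al| * K * K <= K ^+ 3 by apply: mul_al => //; move: K1; clear; lra.
  have h4 : - (al * forcing mu x * p x) <= K ^+ 3.
    by apply: le_trans (le_trans h2 h3); rewrite -normrN; exact: ler_norm.
  have h5 : (4 * eps)^-1 * ((2 * mu zeta + 1) * e) <= (4 * eps)^-1 * ((2 * K + 1) * e).
    rewrite ler_wpM2l ?invr_ge0//; first by move: e0; clear; lra.
    rewrite ler_wpM2r//; last by move: muK; clear; lra.
    by apply: mulr_ge0; [apply: mulr_ge0; [move: K1; clear; lra|exact: ltW]|exact: ltW].
  rewrite /ndens /P /p1 /c S2; move: h1 h4 h5.
  set t1 := _ + _; set t2 := r / 2 * _; clear; lra.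
have cnd : continuous (ndens mu eps al p p1) by exact: ndens_cont.
have ic : itg `[a, b] (fun=> c) := itg_cst a b _.
apply: le_trans (Rint_le (itg_cont a b cnd) (itgD (measurable_itv _) iP ic) bnd) _.
rewrite (RintD iP ic) Rint_cst//; apply: lerD => //.
have -> : c * (b - a) = N / 2 * (2 * K + 1) * (2 * K * N * eps) + 2 * K ^+ 3 * N * eps.
  by rewrite /c /e /b /a; field; rewrite gt_eqF.
have := se_pot E; have := se_flux E; rewrite -/N.
have : 0 <= 2 * K ^+ 3 * eps.
  by apply: mulr_ge0; [apply: mulr_ge0 => //; apply: exprn_ge0; move: K1; clear; lra|exact: ltW].
clear; lra.
Qed.

(** * Moving the transition to the maximum of [mu] *)

Lemma flip_balance_outer {R : realType} (K kap al PM P0 I2 I3 I4 J c1 c2 : R) :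
  1 <= K -> 0 < kap -> 0 <= al -> al <= K ->
  I2 + I3 + I4 <= (I2 - 2 * Num.sqrt 2 / 3 * (P0 - 8 * K * kap) + K ^+ 2 * kap) +
    (I3 + 2 * al * J) + c1 + (2 * Num.sqrt 2 / 3 * PM + 2 * kap) + c2 ->
  c1 <= 6 * kap -> c2 <= 6 * kap -> - kap <= I4 ->
  J <= - (3^-1 * (PM - P0 - 36 * K * kap)) ->
  2 / 3 * (al - Num.sqrt 2) * (PM - P0) <= 60 * K ^+ 2 * kap.
Proof.
move=> K1 k0 al0 alK H c16 c26 I4k JP.
have r0 : 0 <= Num.sqrt (2 : R) := sqrtr_ge0 _.
have r2 : Num.sqrt (2 : R) <= 2 by apply: sqrt_le => //; lra.
have h1 : al * J <= al * - (3^-1 * (PM - P0 - 36 * K * kap)) by rewrite ler_wpM2l//; lra.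
have h3 : al * (K * kap) <= K * (K * kap) by rewrite ler_wpM2r// mulr_ge0//; lra.
have h4 : Num.sqrt 2 * (K * kap) <= 2 * (K * kap) by rewrite ler_wpM2r// mulr_ge0//; lra.
have h5 : K * kap <= K * (K * kap) by rewrite ler_peMl// mulr_ge0//; lra.
have h6 : kap <= K * kap by rewrite ler_peMl//; lra.
move: h1 h3 h4 H; rewrite expr2 -!mulrA.
move: (K * (K * kap)) (K * kap) h5 h6 => KK Kk h5 h6.
lra.
Qed.

Lemma sqr_dist_le {R : realType} (x y s k : R) : 0 <= x -> 0 <= y ->
  `|x ^+ 2 - s| <= k -> `|y ^+ 2 - s| <= k -> (x - y) ^+ 2 <= 2 * k.
Proof.
move=> x0 y0; rewrite !ler_norml => /andP[a1 a2] /andP[b1 b2].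
by case: (leP x y) => xy; nra.
Qed.

Lemma sqr_between {R : realType} (x y w s k : R) : 0 <= x -> 0 <= y ->
  `|x ^+ 2 - s| <= k -> `|y ^+ 2 - s| <= k -> (x - w) * (y - w) <= 0 -> `|w ^+ 2 - s| <= k.
Proof.
move=> x0 y0; rewrite !ler_norml => /andP[a1 a2] /andP[b1 b2] h.
have [[xw wy]|[yw wx]] : (x <= w /\ w <= y) \/ (y <= w /\ w <= x).
  by case: (leP x w) => xw; case: (leP w y) => wy; [left|right|right|right]; split; nra.
  by apply/andP; split; nra.
by apply/andP; split; nra.
Qed.

(** Between two values of the same sign whose squares are close to [mu zeta] the ramp stays near the
    bottom of the potential, so it costs a multiple of [kap]. The sign [e] covers the ramps on both
    sides of the profile. *)
Lemma same_sign_ramp {R : realType} (mu : R -> R) (A B K kap eps al zeta a x y : R) :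
  C1 mu -> 1 <= K -> 0 < kap -> kap <= 1 -> small_eps K kap eps ->
  (forall x, A <= x <= B -> `|forcing mu x| <= K) ->
  `|al| <= K -> A <= zeta - window K kap -> zeta + window K kap <= B ->
  zeta - window K kap <= a -> a + eps <= zeta + window K kap ->
  0 <= x -> x <= K -> 0 <= y -> y <= K -> `|x ^+ 2 - mu zeta| <= 2 * kap -> `|y ^+ 2 - mu zeta| <= 2 * kap ->
  forall e : R, e ^+ 2 = 1 -> `|e| = 1 ->
  competitor mu eps al a (e * x) (a + eps) (e * y) (6 * kap).
Proof.
move=> mu_C1 K1 k0 k1 E f_le alK Az zB az1 az2 x0 xK y0 yK xs ys e e2 e1.
have [|||||W [G [h1 h2 h3 h4 h5]]] := @short_ramp R mu mu_C1 A B K kap eps K1 k0 E f_le al a (e * x) (e * y) ((3 * kap) ^+ 2) alK.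
- exact: le_trans az1.
- exact: le_trans zB.
- by rewrite normrM e1 mul1r ger0_norm.
- by rewrite normrM e1 mul1r ger0_norm.
- move=> t w /andP[t1 t2] pq.
  have pq' : (x - e * w) * (y - e * w) <= 0.
    have -> : (x - e * w) * (y - e * w) = (e * x - w) * (e * y - w) + (1 - e ^+ 2) * (x * y - w ^+ 2) by ring.
    by rewrite e2 subrr mul0r addr0.
  have := sqr_between x0 y0 xs ys pq'; rewrite exprMn e2 mul1r => ws.
  have tw : zeta - window K kap <= t <= zeta + window K kap by rewrite (le_trans az1 t1) (le_trans t2 az2).
  have := mu_window mu_C1 K1 k0 f_le Az zB tw; rewrite distrC => mt.
  apply: sqr_norm_le; rewrite -[w ^+ 2](subrK (mu zeta)) -addrA.
  apply: le_trans (ler_normD _ _) _; move: ws mt k0; clear; lra.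
exists W, G; split=> //; apply: le_trans h5 _.
have := sqr_dist_le y0 x0 ys xs.
have -> : (e * y - e * x) ^+ 2 = (y - x) ^+ 2 by rewrite -mulrBr exprMn e2 mul1r.
have : kap ^+ 2 <= kap by rewrite expr2 ler_piMr// ltW.
have -> : (3 * kap) ^+ 2 = 9 * kap ^+ 2 by ring.
move: k0; clear; lra.
Qed.

Lemma competitor_le {R : realType} (mu : R -> R) (eps al a p b q c d : R) :
  competitor mu eps al a p b q c -> c <= d -> competitor mu eps al a p b q d.
Proof. by case=> [W [G [h1 h2 h3 h4 h5]]] cd; exists W, G; split=> //; exact: le_trans cd. Qed.

Lemma forcing_neg_mono {R : realType} (mu : R -> R) (a b x y : R) : C1 mu ->
  (forall t, a <= t <= b -> forcing mu t <= 0) -> a <= x -> x <= y -> y <= b -> mu x <= mu y.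
Proof.
move=> mu_C1 fneg ax xy yb.
have := @derive_ge _ mu (derive1 mu) x y 0 xy (mu_derive mu_C1); rewrite mul0r subr_ge0; apply.
move=> t /andP[xt ty].
have := fneg t; rewrite (le_trans ax (ltW xt)) (le_trans (ltW ty) yb) => /(_ isT).
by rewrite /forcing; lra.
Qed.

(* Both sides of the transition are given the negative sign; the profitable
   filling of the old transition is available only when [mu z] is not small. *)
Lemma fill_transition {R : realType} (mu U U1 : R -> R) (A B K kap eps al z : R) :
  C1 mu -> 1 <= K -> 0 < kap -> kap <= 1 -> small_eps K kap eps ->
  (forall x, A <= x <= B -> `|forcing mu x| <= K) -> (forall x, A <= x <= B -> `|mu x| <= K) ->
  lsol mu A B K eps al U U1 -> `|al| <= K ->
  A <= z - window K kap -> z + window K kap <= B -> U z = 0 ->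
  (forall x, A <= x < z -> U x < 0) -> (forall x, z < x <= B -> 0 < U x) ->
  exists a b, [/\ A <= a, a <= z, z <= b, b <= z + window K kap &
    competitor mu eps al a (U a) b (- U b) (\int[leb R]_(x in `[a, b]) ndens mu eps al U U1 x
      - 2 * Num.sqrt 2 / 3 * (pow32 (Num.max (mu z) 0) - 8 * K * kap) + K ^+ 2 * kap)].
Proof.
move=> mu_C1 K1 k0 k1 E f_le mu_le S alK; set L := window K kap => Az zB Uz Uneg Upos.
have L0 : 0 < L by exact: window_gt0.
have KL : 2 * K * L = kap / 4 := window_le K1 k0.
have r0 : 0 <= 2 * Num.sqrt (2 : R) / 3 by rewrite divr_ge0 ?mulr_ge0.
have w4 : 4 * K ^+ 3 * L <= K ^+ 2 * kap.
  have -> : 4 * K ^+ 3 * L = K ^+ 2 * 2 * (2 * K * L) by ring.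
  by rewrite KL; have := mulr_ge0 (sqr_ge0 K) (ltW k0); clear; lra.
have w0 : 0 <= K ^+ 2 * kap := mulr_ge0 (sqr_ge0 K) (ltW k0).
have zAB : A <= z <= B by move: L0 Az zB; clear; move=> *; apply/andP; split; lra.
have muK : mu z <= K := le_trans (ler_norm _) (mu_le z zAB).
case: (leP (2 * kap) (mu z)) => muz.
  have [a [b [/andP[az1 az2] /andP[zb1 zb2] Ua Ub wallk]]] := wall_gain mu_C1 K1 k0 E f_le mu_le S alK Az zB muz Uz
  (fun x h => Uneg x (introT andP (conj (le_trans Az (proj1 (andP h))) (proj2 (andP h)))))
  (fun x h => Upos x (introT andP (conj (proj1 (andP h)) (le_trans (proj2 (andP h)) zB)))).
  exists a, b; split=> //; first exact: le_trans Az az1.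
  have s0 : `|- Num.sqrt (mu z - kap)| = Num.sqrt (mu z - kap) by rewrite normrN ger0_norm.
  have := wallk _ s0; rewrite -{1}Ua -Ub => /competitor_le; apply.
  have -> : Num.max (mu z) 0 = mu z by apply/max_idPl; move: muz k0; clear; lra.
  have h1 : pow32 (mu z) - pow32 (mu z - kap) <= 2 * K * (mu z - (mu z - kap)).
    by apply: pow32_lip; move: muK K1 k0 k1 muz; clear; lra.
  have Kk : 0 <= K * kap by apply: mulr_ge0; move: K1 k0; clear; lra.
  have h2 : pow32 (mu z) - 8 * K * kap <= pow32 (mu z - kap) by move: h1 Kk; clear; lra.
  by move: (ler_wpM2l r0 h2) w4; rewrite -/L; clear; lra.
exists z, z; split=> //; [by case/andP: zAB|by rewrite lerDl ltW|].
have := flip_competitor mu_C1 S (lexx z); rewrite !Rint_pt mulr0 addr0 Uz oppr0 => /competitor_le; apply.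
have : 2 * Num.sqrt (2 : R) / 3 * (pow32 (Num.max (mu z) 0) - 8 * K * kap) <= 0.
  rewrite mulr_ge0_le0// subr_le0.
  apply: (@le_trans _ _ (pow32 (2 * kap))).
    apply: pow32_le; first by rewrite le_max lexx orbT.
    by rewrite ge_max (ltW muz)/= mulr_ge0// ltW.
  have : pow32 (2 * kap) - pow32 0 <= 2 * (2 * K) * (2 * kap - 0).
    by apply: pow32_lip; move: K1 k0 k1; clear; lra.
  by rewrite {2}/pow32 mul0r; clear; lra.
move: w0; clear; lra.
Qed.

(* In the flipped region [U >= sqrt (mu - kap)], so the force gains at least
   the integral of [mu' / 2 * sqrt (mu - kap)]. *)
Lemma flip_gain {R : realType} (mu U : R -> R) (K kap b p q z zeta : R) :
  C1 mu -> continuous U -> 1 <= K -> 0 < kap -> z <= b -> b <= p -> p <= q -> q <= zeta ->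
  (forall x, z <= x <= zeta -> forcing mu x <= 0) -> (forall x, b <= x <= p -> 0 <= U x) ->
  (forall x, p <= x <= q -> Num.sqrt (mu x - kap) <= U x) -> kap < mu p ->
  \int[leb R]_(x in `[b, q]) (forcing mu x * U x) <=
    - (3^-1 * (pow32 (mu q - kap) - pow32 (mu p - kap))).
Proof.
move=> mu_C1 cU K1 k0 zb bp pq qz fneg Ub Upq mup.
have cfU : continuous (fun x => forcing mu x * U x) by apply: contM => //; exact: f_continuous.
have dm (x : R) : is_derive x 1 (fun x : R => mu x - kap) (derive1 mu x).
  by have := derB (mu_derive mu_C1 x) (derC kap x); rewrite subr0.
have mk x : p <= x <= q -> 0 < mu x - kap.
  move=> /andP[x1 x2]; rewrite subr_gt0; apply: lt_le_trans mup _.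
  apply: (@forcing_neg_mono _ mu z zeta) => //; first exact: le_trans bp.
  exact: le_trans x2 qz.
have csq : continuous (fun x => derive1 mu x * Num.sqrt (mu x - kap)).
  apply: contM; first exact: (proj2 mu_C1).
  move=> x; apply: (continuous_comp (f := fun x => mu x - kap)); first exact: (cont_derive dm).
  exact: sqrt_continuous.
have := Rint_sqrt pq dm (proj2 mu_C1) mk => JE.
rewrite (Rint_cat bp pq (itg_cont _ _ cfU)).
have h1 : \int[leb R]_(x in `[b, p]) (forcing mu x * U x) <= 0.
  rewrite -(mul0r (p - b)) -Rint_cst//; apply: Rint_le; [exact: itg_cont|exact: itg_cst|].
  move=> x xbp; rewrite mulr_le0_ge0 ?Ub// fneg//; case/andP: xbp => x1 x2.
  by rewrite (le_trans zb x1) (le_trans x2 (le_trans pq qz)).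
have : \int[leb R]_(x in `[p, q]) (forcing mu x * U x) <=
    \int[leb R]_(x in `[p, q]) (- 2^-1 * (derive1 mu x * Num.sqrt (mu x - kap))).
  apply: Rint_le; [exact: itg_cont|by apply: itg_cont; apply: (contM (@contC R _))|].
  move=> x xpq.
  have -> : - 2^-1 * (derive1 mu x * Num.sqrt (mu x - kap)) = forcing mu x * Num.sqrt (mu x - kap).
    by rewrite /forcing; field.
  apply: ler_wnM2l; last exact: Upq.
  by case/andP: xpq => x1 x2; rewrite fneg// (le_trans (le_trans zb bp) x1) (le_trans x2 qz).
rewrite (RintZ _ (itg_cont _ _ csq)) JE; move: h1; clear; lra.
Qed.

(** The competitor fills the old transition with the negative sign, follows [- U] up to the
    neighbourhood of [zeta], and makes the optimal transition there. The extra cost is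
    $\frac{2\sqrt2}3$ times the difference of the two powers of [mu], the gain of force [2 * al / 3]
    times it, up to multiples of [kap]. *)
Lemma outer_wall {R : realType} (mu U U1 : R -> R) (A B K kap eps al zeta z : R) :
  C1 mu -> 1 <= K -> 0 < kap -> kap <= 1 -> small_eps K kap eps ->
  (forall x, A <= x <= B -> `|forcing mu x| <= K) -> (forall x, A <= x <= B -> `|mu x| <= K) ->
  lsol mu A B K eps al U U1 -> 0 <= al -> al <= K ->
  A <= z - window K kap -> z <= zeta -> zeta + 2 * window K kap < B ->
  (forall x, z <= x <= zeta -> forcing mu x <= 0) -> 0 < mu zeta -> U z = 0 ->
  (forall x, A <= x < z -> U x < 0) -> (forall x, z < x <= B -> 0 < U x) ->
  2 / 3 * (al - Num.sqrt 2) * (pow32 (mu zeta) - pow32 (Num.max (mu z) 0)) <= 60 * K ^+ 2 * kap.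
Proof.
move=> mu_C1 K1 k0 k1 E f_le mu_le S al0 alK; set L := window K kap.
move=> Az zz zB fneg muzeta Uz Uneg Upos.
have e0 := se_gt0 E.
have alK' : `|al| <= K by rewrite ger0_norm.
have L0 : 0 < L by exact: window_gt0.
have KL : 2 * K * L = kap / 4 := window_le K1 k0.
have mono x y : z <= x -> x <= y -> y <= zeta -> mu x <= mu y.
  exact: forcing_neg_mono.
have Kk : 0 <= K * kap by apply: mulr_ge0; move: K1 k0; clear; lra.
have zzAB : A <= zeta <= B by move: L0 Az zz zB; clear; move=> *; apply/andP; split; lra.
have muK : mu zeta <= K := le_trans (ler_norm _) (mu_le zeta zzAB).
set M := Num.max (mu z) 0.
have M0 : 0 <= M by rewrite /M le_max lexx orbT.
have mzM : mu z <= M by rewrite /M le_max lexx.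
have Mz : M <= mu zeta by rewrite /M ge_max (ltW muzeta) (mono z zeta).
(* A level between [M + 4 * kap] and [M + 8 * kap]. It exceeds [mu z] enough to put the point [p]
   where [mu] reaches it 16 windows to the right of [z], so that [lsol_ge] applies from [p] on; it
   is close enough to [M] to forfeit only a multiple of [kap] in the gain. *)
set mp := Num.max (mu z) (4 * kap) + 4 * kap.
have mpM : mp <= M + 8 * kap.
  by rewrite /mp /M; case: (leP (mu z) (4 * kap)) => h; case: (leP (mu z) 0) => h'; move: h h' k0; clear; lra.
have mpM' : M + 4 * kap <= mp.
  by rewrite /mp /M; case: (leP (mu z) (4 * kap)) => h; case: (leP (mu z) 0) => h'; move: h h' k0; clear; lra.
have r0 : 0 <= Num.sqrt (2 : R) := sqrtr_ge0 _.
have PM0 : pow32 M <= pow32 (mu zeta) by exact: pow32_le.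
(* If [mu zeta] is within [16 * kap] of [M], the Lipschitz bound on [pow32] gives the claim without
   any competitor. *)
case: (leP (mu zeta) (mp + 8 * kap)) => mm.
  have h1 : pow32 (mu zeta) - pow32 M <= 2 * K * (mu zeta - M) by exact: pow32_lip.
  have h2 : 2 * K * (mu zeta - M) <= 2 * K * (16 * kap).
    by rewrite ler_wpM2l//; [move: K1; clear; lra|move: mm mpM; clear; lra].
  apply: (@le_trans _ _ (2 / 3 * K * (pow32 (mu zeta) - pow32 M))).
    rewrite ler_wpM2r ?subr_ge0// ler_wpM2l//.
    by move: r0 alK; clear; lra.
  have h3 : 2 / 3 * K * (pow32 (mu zeta) - pow32 M) <= 2 / 3 * K * (2 * K * (16 * kap)).
    by rewrite ler_wpM2l//; [move: K1; clear; lra|move: h1 h2; clear; lra].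
  apply: le_trans h3 _; have := mulr_ge0 (sqr_ge0 K) (ltW k0); rewrite expr2; clear; lra.
have zmz : mu z <= mp <= mu zeta by move: mzM mpM' k0 mm; clear; move=> *; apply/andP; split; lra.
have mzz : mu z <= mu zeta := mono z zeta (lexx _) zz (lexx _).
have [p] := @IVT _ mu z zeta mp zz (continuous_subspaceT (cont_derive (mu_derive mu_C1)))
  (etrans (congr2 (fun a b => a <= mp <= b) (min_idPl mzz) (max_idPr mzz)) zmz).
rewrite in_itv/= => /andP[zp pz] mup.
have K20 : 0 < 2 * K by move: K1; clear; lra.
have AzL : A <= z by move: Az L0; clear; lra.
have /andP[Azeta zetaB] := zzAB.
have zp16 : z + 16 * L <= p.
  have := mu_lip mu_C1 f_le AzL zp (le_trans pz zetaB); rewrite ler_norml => /andP[_ h].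
  by rewrite -lerBrDl -(ler_pM2l K20); move: h mup mpM' mzM KL k0; clear; lra.
have pz32 : p + 32 * L <= zeta.
  have := mu_lip mu_C1 f_le (le_trans AzL zp) pz zetaB; rewrite ler_norml => /andP[_ h].
  by rewrite -lerBrDl -(ler_pM2l K20); move: h mup mm KL k0; clear; lra.
set N := layer K kap.
have N0 : 0 < N by exact: layer_gt0.
have NL : N * eps + eps <= L / 4 by have := se_layer E; rewrite -/L -/N mulrDl mul1r.
have Ne0 : 0 < N * eps by exact: mulr_gt0.
(* The profile occupies [[q1, e1]]; ramps of length [eps] on [[q, q1]] and [[e1, e]] join it to
   [- U] and to [U]. *)
pose q1 := zeta - N * eps; pose q := q1 - eps; pose e1 := zeta + N * eps; pose e := e1 + eps.
have Sn := lsol_neg S.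
have cU : continuous U := cont_derive (ls_der S).
have [pq qz q_L q1L e1L] : [/\ p <= q, q <= zeta, zeta - L <= q, q1 <= zeta + L & e1 <= zeta + L].
  by rewrite /q /q1 /e1; split; move: pz32 NL L0 e0 Ne0; clear; lra.
have [Aq qe1 ee1 eB] : [/\ A <= q, q1 <= e1, e <= zeta + L & e <= B].
  by rewrite /e /q /q1 /e1; split; move: pz32 NL L0 e0 Ne0 zB AzL zp zp16; clear; lra.
have Uge (x : R) : p <= x -> x <= zeta + L -> 2 * kap <= mu x -> Num.sqrt (mu x - kap) <= U x.
  move=> px xz mux; apply: (lsol_ge mu_C1 K1 k0 k1 E f_le mu_le S alK') => //.
  - by rewrite -/L; move: px zp16 L0 AzL; clear; lra.
  - by rewrite -/L; move: xz zB L0; clear; lra.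
  - rewrite -/L => t /andP[t1 t2]; apply: Upos.
    by move: px xz t1 t2 zB zp16 L0; clear; move=> *; apply/andP; split; lra.
have muw (x : R) : zeta - L <= x <= zeta + L -> `|mu x - mu zeta| <= kap / 4.
  by apply: (mu_window mu_C1 K1 k0 f_le) => //; rewrite -/L; move: pz32 zp16 AzL zB L0; clear; lra.
have mz12 : 12 * kap <= mu zeta by move: mm mpM' M0 k0; clear; lra.
have Unear (x : R) : p <= x -> zeta - L <= x <= zeta + L ->
    [/\ 0 <= U x, U x <= K & `|U x ^+ 2 - mu zeta| <= 2 * kap].
  move=> px xz; have := muw x xz; rewrite ler_norml => /andP[m1 m2].
  have mux : 2 * kap <= mu x by move: m1 mz12 k0; clear; lra.
  have /andP[x1 x2] := xz.
  have h1 := Uge x px x2 mux.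
  have xAB : A <= x <= B.
    by move: px x2 zp16 AzL zB L0; clear; move=> *; apply/andP; split; lra.
  have U0 : 0 <= U x := le_trans (sqrtr_ge0 _) h1.
  have h2 : U x <= Num.sqrt (mu x + kap).
    apply: (lsol_le mu_C1 K1 k0 k1 E f_le S alK') => //.
    - by rewrite -/L; move: px zp16 AzL L0; clear; lra.
    - by rewrite -/L; move: x2 zB; clear; lra.
    - by move: mux k0; clear; lra.
  split=> //; first by apply: le_trans (ls_bd S xAB); exact: ler_norm.
  have h3 : Num.sqrt (mu x - kap) ^+ 2 <= U x ^+ 2 by rewrite lerXn2r ?nnegrE.
  have h4 : U x ^+ 2 <= Num.sqrt (mu x + kap) ^+ 2 by rewrite lerXn2r ?nnegrE.
  rewrite sqr_sqrtr in h3; last by move: mux k0; clear; lra.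
  rewrite sqr_sqrtr in h4; last by move: mux k0; clear; lra.
  by rewrite ler_norml; move: h3 h4 m1 m2 k0; clear; move=> *; apply/andP; split; lra.
have zLz : A <= zeta - L by move: pz32 zp16 AzL L0; clear; lra.
have zLB : zeta + L <= B by move: zB L0; clear; lra.
have [h [h0 hS hS' prof]] := profile_competitor mu_C1 K1 k0 k1 E f_le mu_le alK' zLz zLB muzeta.
rewrite -/N -/q1 -/e1 in prof.
have hnear : `|h ^+ 2 - mu zeta| <= 2 * kap.
  by rewrite ler_norml; move: hS hS' k0; clear; move=> *; apply/andP; split; lra.
have hK : h <= K.
  by apply: le_trans (sqrt_le K1 muK); rewrite -(ger0_norm h0) -sqrtr_sqr ler_wsqrtr.
have q1e : q + eps = q1 by rewrite /q subrK.
have qw : zeta - L <= q <= zeta + L by rewrite q_L (le_trans qz)// lerDl ltW.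
have [Uq0 UqK Uqn] := Unear q pq qw.
have pe : p <= e by rewrite (le_trans pq)// /e /q /e1 /q1; move: Ne0 e0; clear; lra.
have ew : zeta - L <= e <= zeta + L by rewrite ee1 andbT (le_trans q_L)// /e /q /e1 /q1; move: Ne0 e0; clear; lra.
have [Ue0 UeK Uen] := Unear e pe ew.
have q1L' : q + eps <= zeta + L by rewrite q1e.
have m1n : `|- 1 : R| = 1 by rewrite normrN normr1.
have m1s : (- 1 : R) ^+ 2 = 1 by rewrite sqrrN expr1n.
have ramp1 := same_sign_ramp mu_C1 K1 k0 k1 E f_le alK' zLz zLB q_L q1L' Uq0 UqK h0 hK Uqn hnear m1s m1n.
have e1L' : zeta - L <= e1 by rewrite /e1; move: L0 Ne0; clear; lra.
have ramp2 := same_sign_ramp mu_C1 K1 k0 k1 E f_le alK' zLz zLB e1L' ee1 h0 hK Ue0 UeK hnear Uen (expr1n _ 2) (normr1 _).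
rewrite q1e !mulN1r in ramp1; rewrite -/e !mul1r in ramp2.
have zLB' : z + L <= B by move: zz zLB; clear; lra.
have [a [b [Aa az zb bL fill]]] := fill_transition mu_C1 K1 k0 k1 E f_le mu_le S alK' Az zLB' Uz Uneg Upos.
rewrite -/L in bL.
have bp : b <= p by move: bL zp16 L0; clear; lra.
have bq : b <= q := le_trans bp pq.
have flip := flip_competitor mu_C1 S bq.
have ab : a <= b := le_trans az zb.
have q_q1 : q <= q1 by rewrite -q1e lerDl ltW.
have e1_e : e1 <= e by rewrite /e lerDl ltW.
have aq : a <= q := le_trans ab bq.
have qe : q <= e := le_trans (le_trans q_q1 qe1) e1_e.
have cat1 := competitor_cat mu_C1 ab bq fill flip.
have cat2 := competitor_cat mu_C1 aq q_q1 cat1 ramp1.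
have cat3 := competitor_cat mu_C1 (le_trans aq q_q1) qe1 cat2 prof.
have cat4 := competitor_cat mu_C1 (le_trans (le_trans aq q_q1) qe1) e1_e cat3 ramp2.
have := ls_min S Aa (le_trans aq qe) eB cat4.
have ii x y : itg `[x, y] (ndens mu eps al U U1).
  by apply: itg_cont; apply: ndens_cont => //; exact: (ls_cont S).
rewrite (Rint_cat aq qe (ii _ _)) (Rint_cat ab bq (ii _ _)) => H.
have I4 : - kap <= \int[leb R]_(x in `[q, e]) ndens mu eps al U U1 x.
  apply: (ndens_int_lb mu_C1 K1 E f_le S alK' Aq qe eB).
  by rewrite -/N /e /q /e1 /q1; clear; lra.
have J : \int[leb R]_(x in `[b, q]) (forcing mu x * U x) <=
    - (3^-1 * (pow32 (mu zeta) - pow32 M - 36 * K * kap)).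
  have mupk : kap < mu p by rewrite mup; move: mpM' M0 k0; clear; lra.
  have Ub0 (x : R) : b <= x <= p -> 0 <= U x.
    move=> /andP[x1 x2]; have := le_trans zb x1; rewrite le_eqVlt => /predU1P[<-|zx]; first by rewrite Uz.
    by apply/ltW/Upos; rewrite zx (le_trans x2 (le_trans pz zetaB)).
  have Upq (x : R) : p <= x <= q -> Num.sqrt (mu x - kap) <= U x.
    move=> /andP[x1 x2]; apply: Uge => //; first by rewrite (le_trans x2 (proj2 (andP qw))).
    apply: (@le_trans _ _ (mu p)); first by rewrite mup; move: mpM' M0 k0; clear; lra.
    by apply: mono => //; exact: le_trans x2 qz.
  apply: le_trans (flip_gain mu_C1 cU K1 k0 zb bp pq qz fneg Ub0 Upq mupk) _.
  have := muw q qw; rewrite ler_norml => /andP[m1 _].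
  have muqz : mu q <= mu zeta by apply: mono => //; exact: le_trans zb bq.
  have h1 : pow32 (mu zeta) - pow32 (mu q - kap) <= 2 * K * (mu zeta - (mu q - kap)).
    by apply: pow32_lip => //; move: m1 mz12 muqz k0; clear; lra.
  have h2 : pow32 (mu p - kap) - pow32 M <= 2 * K * (mu p - kap - M).
    apply: pow32_lip => //; rewrite mup; first by move: mpM' k0; clear; lra.
    by move: mm muK k0; clear; lra.
  have h3 : 2 * K * (mu zeta - (mu q - kap)) <= 2 * K * (2 * kap).
    by rewrite ler_wpM2l//; [exact: ltW|move: m1 k0; clear; lra].
  have h4 : 2 * K * (mu p - kap - M) <= 2 * K * (8 * kap).
    by rewrite ler_wpM2l//; [exact: ltW|rewrite mup; move: mpM k0; clear; lra].
  by move: h1 h2 h3 h4 Kk; clear; lra.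
apply: (flip_balance_outer K1 k0 al0 alK H (lexx _) (lexx _) I4 J).
Qed.

(** * Localisation of the zeros *)

Lemma reaction_neg_arith {R : realType} (M T r w m t : R) : 0 <= M -> 0 <= T ->
  1 + M + T <= r -> r < w -> m <= M -> t <= T -> m * w - w ^+ 3 + t < 0.
Proof.
move=> M0 T0 r1 rw mM tT.
have w1 : 1 <= w by lra.
have h1 : m * w <= M * w by rewrite ler_wpM2r//; lra.
have h2 : T <= T * w by rewrite ler_peMr.
have h3 : (1 + M + T) * w <= w * w by rewrite ler_wpM2r//; lra.
have h4 : w * w <= w ^+ 3 by rewrite !exprS expr0 mulr1 mulrA ler_peMr// mulr_ge0//; lra.
lra.
Qed.

Lemma pow4_le {R : realType} (w r : R) : 1 <= r -> w ^+ 4 <= r -> `|w| <= r.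
Proof.
move=> r1 wr; rewrite leNgt; apply/negP => rw.
have : r ^+ 4 < `|w| ^+ 4 by rewrite ltrXn2r ?nnegrE//; lra.
rewrite -normrX [`|w ^+ 4|]ger0_norm ?exprn_even_ge0// ltNge => /negP; apply.
apply: (le_trans wr); apply: ler_eXnr => //.
Qed.

Lemma bounded_itv {R : realType} (F : R -> R) (a b : R) : continuous F -> a <= b ->
  exists2 K, 0 <= K & forall x, a <= x <= b -> `|F x| <= K.
Proof.
move=> cF ab.
have cn : continuous (fun x => `|F x|).
  by move=> x; apply: (continuous_comp (f := F)); [exact: cF|exact: norm_continuous].
have [y _ ymax] := EVT_max ab (continuous_subspaceT (A := `[a, b]%classic) cn).
by exists `|F y| => // x xab; apply: ymax; rewrite in_itv/=.
Qed.

Section regular_solutions.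
Context {R : realType}.
Variable mu : R -> R.
Hypothesis mu_C1 : C1 mu.
Notation f := (forcing mu).
Implicit Types (V U W G : R -> R) (A B C M F T K a b c d x y eps al : R).

Lemma good_lsol C eps al V V1 A B K : good mu C eps al V V1 -> 0 < eps -> 0 < A ->
  (forall x, A <= x <= B -> `|V x| <= K) -> lsol mu A B K eps al V V1.
Proof.
move=> VG e0 A0 VK; split => //.
- exact: gd_der VG.
- by move=> x /andP[Ax _]; apply: (gd_der2 VG); exact: lt_trans Ax.
- exact: gd_cont VG.
- move=> a b c Aa ab _ [W [G [p i Wa Wb e]]]; apply: le_trans e.
  have cV := cont_derive (gd_der VG).
  have cm : itg `[a, b] (fun x => (4 * eps)^-1 * mu x ^+ 2).
    by apply: itg_cont; apply: (contM (@contC R _)); apply: contX; exact: mu_continuous.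
  have split W' G' : prim W' G' -> itg `[a, b] (fun x => G' x ^+ 2) ->
      \int[leb R]_(x in `[a, b]) density mu eps al W' G' x =
      \int[leb R]_(x in `[a, b]) ndens mu eps al W' G' x
        - \int[leb R]_(x in `[a, b]) ((4 * eps)^-1 * mu x ^+ 2).
    move=> p' i'; rewrite -RintB//; last exact: ndens_itg.
    by apply: eq_Rint => x _; rewrite ndens_density ?gt_eqF// addrK.
  have := gd_min VG (le_trans (ltW A0) Aa) ab p i Wa Wb.
  rewrite !split//; first by rewrite lerD2r.
    exact: prim_derive (gd_der VG) (gd_cont VG).
  by apply: itg_cont; apply: contX; exact: gd_cont VG.
Qed.

(** The parameter [al] is kept: [refl] reverses both the sign of the function and that of the odd
    function [f]. A transition from negative to positive remains one. *)
Lemma lsol_refl A B K eps al U U1 : (forall x, mu (- x) = mu x) -> lsol mu A B K eps al U U1 ->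
  lsol mu (- B) (- A) K eps al (refl U) (fun x => U1 (- x)).
Proof.
move=> mu_even S.
have cU := cont_derive (ls_der S).
have f_odd' x : f (- x) = - f x by exact: f_odd.
have cop (H : R -> R) : continuous H -> continuous (fun x => H (- x)).
  by move=> cH x; apply: (continuous_comp (f := -%R)); [exact: opp_continuous|exact: cH].
have ndr W G x : ndens mu eps al (refl W) (fun x => G (- x)) x = ndens mu eps al W G (- x).
  by rewrite /ndens /refl mu_even f_odd'; ring.
split.
- move=> x; have := derN (@der_comp _ U -%R x _ _ (ls_der S (- x)) (derN (derI x))).
  by rewrite mulrN1 opprK.
- move=> x /andP[x1 x2].
  have xAB : A < - x < B by rewrite ltrNr x2 ltrNl x1.
  have := @der_comp _ U1 -%R x _ _ (ls_der2 S xAB) (derN (derI x)).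
  set l := (X in is_derive _ _ _ X -> _).
  suff -> : l = - reaction mu eps al (refl U) x / eps ^+ 2 by [].
  by rewrite /l /reaction /refl mu_even f_odd'; ring.
- exact: cop (ls_cont S).
- move=> a b c Ba ab bA [W [G [p i Wa Wb e]]].
  have ba : - b <= - a by rewrite lerN2.
  have iU : itg `[- b, - a] (ndens mu eps al U U1).
    by apply: itg_cont; apply: ndens_cont => //; exact: ls_cont S.
  under eq_Rintegral do rewrite ndr.
  rewrite (Rint_opp iU).2.
  apply: (ls_min S) => //; [by rewrite lerNr|by rewrite lerNl|].
  have i' : itg `[- b, - a] (fun x => G (- x) ^+ 2).
    have i2 : itg `[- - a, - - b] (fun x => G x ^+ 2) by rewrite !opprK.
    exact: (Rint_opp i2).1.
  exists (refl W), (fun x => G (- x)); split=> //.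
  + exact: prim_opp.
  + by rewrite /refl opprK Wb /refl opprK.
  + by rewrite /refl opprK Wa /refl opprK.
  + under eq_Rintegral do rewrite ndr.
    have i3 : itg `[- - a, - - b] (ndens mu eps al W G) by rewrite !opprK; exact: ndens_itg.
    by rewrite (Rint_opp i3).2 !opprK.
- by move=> x /andP[x1 x2]; rewrite /refl normrN; apply: (ls_bd S); rewrite lerNr x2 lerNl x1.
Qed.

End regular_solutions.

(** The $L^4$ bound gives one point in [[A / 2, A]] and one in [[B, B + 1]] where [|V| <= K]. Where
    [V > K] the cubic term makes the reaction negative, so the maximum principle bounds [V] between
    them; the lower bound is the same argument for [- V]. *)
Lemma good_bound {R : realType} (mu : R -> R) (C M A B T : R) : C1 mu -> 0 < A -> A <= B -> (forall x, `|mu x| <= M) -> 0 <= T ->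
  exists2 K : R, 1 <= K & forall eps al V V1, 0 < eps -> eps <= 1 -> `|al| <= T ->
    good mu C eps al V V1 -> forall x, A <= x <= B -> `|V x| <= K.
Proof.
move=> mu_C1 A0 AB muM T0.
have M0 : 0 <= M := le_trans (normr_ge0 _) (muM 0).
have cf := f_continuous mu_C1.
have AB' : A / 3 <= B + 2 by move: A0 AB; clear; lra.
have [F F0 fF] := bounded_itv cf AB'.
have TF0 : 0 <= T * F by exact: mulr_ge0.
have CA0 : 0 <= 2 * `|C| / A by rewrite divr_ge0 ?mulr_ge0// ltW.
pose K := 1 + M + T * F + 2 * `|C| / A + `|C|.
have K1 : 1 <= K by rewrite /K; have := normr_ge0 C; move: M0 TF0 CA0; clear; lra.
have KMT : 1 + M + T * F <= K by rewrite /K; have := normr_ge0 C; move: CA0; clear; lra.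
exists K => // eps al V V1 e0 e1 alT VG x xAB.
have cV := cont_derive (gd_der VG).
(* This bound depends on [V]: it only makes an [lsol] of it, and the uniform bound comes from the
   maximum principle. *)
have [Z Z0 VZ] := bounded_itv cV AB'.
have A3 : 0 < A / 3 by rewrite divr_gt0.
have S := good_lsol mu_C1 VG e0 A3 VZ.
have [A2_0 A2A] : 0 <= A / 2 /\ A / 2 < A by move: A0; clear=> *; split; lra.
have [c /andP[c1 c2] Vc] := gd_L4 VG A2_0 A2A.
have [B0 BB] : 0 <= B /\ B < B + 1 by rewrite (le_trans (ltW A0) AB) ltrDl.
have [d /andP[d1 d2] Vd] := gd_L4 VG B0 BB.
have VcK : `|V c| <= K.
  apply: pow4_le => //.
  have -> : V c ^+ 4 = V c ^+ 4 * (A - A / 2) * (2 / A) by field; rewrite gt_eqF.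
  apply: (@le_trans _ _ (C * (2 / A))); first by rewrite ler_wpM2r// divr_ge0// ltW.
  apply: (@le_trans _ _ (`|C| * (2 / A))).
    by rewrite ler_wpM2r ?ler_norm// divr_ge0// ltW.
  rewrite /K mulrA (mulrC `|C|); have := normr_ge0 C; move: M0 TF0; clear; lra.
have VdK : `|V d| <= K.
  apply: pow4_le => //; have := Vd; rewrite (addrC B) addrK mulr1 => h.
  apply: (le_trans h); apply: (le_trans (ler_norm C)); rewrite /K; move: M0 TF0 CA0; clear; lra.
have neg al' W t : `|al'| <= T -> A / 3 <= t -> t <= B + 2 -> K < W t -> reaction mu eps al' W t < 0.
  move=> alT' t1 t2 KW; rewrite /reaction.
  apply: (reaction_neg_arith M0 TF0 KMT KW); first exact: le_trans (ler_norm _) (muM t).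
  apply: le_trans (ler_norm _) _; rewrite (normrM _ (forcing mu t)) (normrM eps) (gtr0_norm e0).
  apply: (@le_trans _ _ (1 * T * F)); last by rewrite mul1r.
  apply: ler_pM => //; [by rewrite mulr_ge0// ltW|by apply: ler_pM => //; exact: ltW|].
  by apply: fF; rewrite t1.
have xcd : c <= x <= d by move: c2 d1 xAB => c2 d1 /andP[x1 x2]; rewrite (le_trans c2 x1) (le_trans x2 d1).
have Ac : A / 3 < c by apply: lt_le_trans c1; move: A0; clear; lra.
have dB : d < B + 2 by apply: le_lt_trans d2 _; rewrite ltrD2l ltr1n.
have tcd t : c <= t <= d -> A / 3 <= t /\ t <= B + 2.
  by move=> /andP[t1 t2]; rewrite (le_trans (ltW Ac) t1) (le_trans t2 (ltW dB)).
move: VcK VdK; rewrite !ler_norml => /andP[Vc1 Vc2] /andP[Vd1 Vd2]; apply/andP; split.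
  rewrite lerNl; apply: (@max_principle _ mu (A / 3) (B + 2) _ eps (- al) _ _ (lsol_neg S) e0 c d K) => //.
  - by rewrite lerNl.
  - by rewrite lerNl.
  - by move=> t /tcd[t1 t2]; apply: (neg (- al) (fun x => - V x) t _ t1 t2); rewrite normrN.
apply: (@max_principle _ mu (A / 3) (B + 2) _ eps al _ _ S e0 c d K) => //.
by move=> t /tcd[t1 t2]; exact: (neg al V t alT t1 t2).
Qed.

(** Where [mu <= 0] and [U >= 0], only the force matters: the reaction is at most [- eps * c]. It is
    of order [eps] against [eps ^+ 2] in [upper_principle], so small [eps] suffices. *)
Lemma sign_principle {R : realType} (mu U U1 : R -> R) (A B K eps al y d c : R) :
  lsol mu A B K eps al U U1 -> 0 < eps -> A < y - d -> y + d < B -> 0 < d -> 0 < c ->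
  (forall t : R, y - d <= t <= y + d -> mu t <= 0) ->
  (forall t : R, y - d <= t <= y + d -> al * forcing mu t <= - c) ->
  eps * (4 * K) < c * (d / 4) ^+ 2 ->
  forall t : R, `|t - y| < d / 2 -> U t <= 0.
Proof.
move=> S e0 Ay yB d0 c0 mu0 fc small.
have small' : 4 * K * eps ^+ 2 < eps * c * (d / 4) ^+ 2.
  have -> : 4 * K * eps ^+ 2 = eps * (eps * (4 * K)) by ring.
  by rewrite -[ltRHS]mulrA ltr_pM2l.
have react t : y - d <= t <= y + d -> 0 <= U t -> reaction mu eps al U t <= - (eps * c).
  move=> ty Ut; rewrite /reaction.
  have h1 : mu t * U t <= 0 by rewrite mulr_le0_ge0// mu0.
  have h2 : 0 <= U t ^+ 3 by exact: exprn_ge0.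
  have h3 : eps * (al * forcing mu t) <= eps * - c by rewrite ler_wpM2l ?fc// ltW.
  by move: h1 h2 h3; clear; lra.
have ec0 : 0 < eps * c by exact: mulr_gt0.
have neg := upper_principle S e0 Ay yB d0 ec0 react small'.
move=> t; rewrite ltr_norml => /andP[t1 t2]; apply: neg.
by move: t1 t2; clear; move=> *; apply/andP; split; lra.
Qed.

(** * Signs at fixed points and position of the transition, uniformly in [al] *)

Section localisation.
Context {R : realType}.
Variable mu : R -> R.
Hypothesis mu_C1 : C1 mu.
Hypothesis mu_even : forall x, mu (- x) = mu x.
Variable M : R.
Hypothesis mu_bd : forall x, `|mu x| <= M.
Variables (zeta xi xi' : R).
Hypothesis xi'_gt0 : 0 < xi'.
Hypothesis xi'_lt : xi' < zeta.
Hypothesis xi_gt : zeta < xi.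
Notation f := (forcing mu).
Hypothesis f_neg : forall x : R, 0 < x < zeta -> f x < 0.
Hypothesis f_pos : forall x : R, zeta < x -> 0 < f x.
Hypothesis mu_xi' : mu xi' = 0.
Hypothesis mu_xi : mu xi = 0.
Variables (C T alo : R).
Hypothesis alo_gt0 : 0 < alo.
Hypothesis T_ge0 : 0 <= T.
Implicit Types (V U : R -> R) (A B K a b c d x y z q p eps al : R).

Lemma uniform_constant A B : 0 < A -> A <= B ->
  exists K, [/\ 1 <= K, T <= K, forall x, A <= x <= B -> `|f x| <= K,
    forall x, `|mu x| <= K &
    forall eps al V V1, 0 < eps -> eps <= 1 -> `|al| <= T -> good mu C eps al V V1 ->
      lsol mu A B K eps al V V1].
Proof.
move=> A0 AB.
have [F F0 fF] := bounded_itv (f_continuous mu_C1) AB.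
have [K0 K01 VK] := good_bound C mu_C1 A0 AB mu_bd T_ge0.
have M0 : 0 <= M := le_trans (normr_ge0 _) (mu_bd 0).
exists (K0 + M + T + F); have T0 := T_ge0; split; [lra|lra| | |].
- by move=> x /fF; lra.
- by move=> x; have := mu_bd x; lra.
- move=> eps al V V1 e0 e1 alT VG; apply: (good_lsol mu_C1 VG e0 A0).
  by move=> x /(VK _ _ _ _ e0 e1 alT VG); lra.
Qed.

Lemma mu_lt_left x y : 0 <= x -> x < y -> y <= zeta -> mu x < mu y.
Proof.
move=> x0 xy yz.
have [c] := MVT xy (fun x _ => mu_derive mu_C1 x) (continuous_subspaceT (mu_continuous mu_C1)).
rewrite in_itv/= => /andP[c1 c2] e; rewrite -subr_gt0 e; apply: mulr_gt0; last by rewrite subr_gt0.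
have := f_neg (x := c); rewrite (le_lt_trans x0 c1) (lt_le_trans c2 yz) => /(_ isT).
by rewrite /forcing; lra.
Qed.

Lemma mu_lt_right x y : zeta <= x -> x < y -> mu y < mu x.
Proof.
move=> zx xy.
have [c] := MVT xy (fun x _ => mu_derive mu_C1 x) (continuous_subspaceT (mu_continuous mu_C1)).
rewrite in_itv/= => /andP[c1 c2] e; rewrite -subr_gt0 -opprB e oppr_gt0.
rewrite nmulr_rlt0 ?subr_gt0//.
have := f_pos (le_lt_trans zx c1).
by rewrite /forcing; lra.
Qed.

Lemma mu_le_left x y : 0 <= x -> x <= y -> y <= zeta -> mu x <= mu y.
Proof.
move=> x0; rewrite le_eqVlt => /predU1P[->//|xy] yz; exact/ltW/mu_lt_left.
Qed.

Lemma mu_le_right x y : zeta <= x -> x <= y -> mu y <= mu x.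
Proof.
by move=> zx; rewrite le_eqVlt => /predU1P[->//|xy]; exact/ltW/mu_lt_right.
Qed.

Lemma zeta_gt0 : 0 < zeta. Proof. exact: lt_trans xi'_lt. Qed.

Lemma mu_zeta_gt0 : 0 < mu zeta.
Proof. by rewrite -mu_xi'; apply: mu_lt_left => //; exact: ltW. Qed.

Lemma f_nonpos x : 0 < x -> x <= zeta -> f x <= 0.
Proof.
move=> x0; rewrite le_eqVlt => /predU1P[->|xz]; last by apply/ltW/f_neg/andP.
rewrite leNgt; apply/negP => fz.
have [d d0 dP] := cont_pos (f_continuous mu_C1) fz.
pose t := Num.max (zeta / 2) (zeta - d / 2).
have z0 := zeta_gt0.
have t1 : zeta / 2 <= t by rewrite /t le_max lexx.
have t2 : zeta - d / 2 <= t by rewrite /t le_max lexx orbT.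
have t3 : t < zeta by rewrite /t gt_max; apply/andP; split; lra.
have /dP : `|t - zeta| < d by rewrite ltr_norml; apply/andP; split; lra.
by rewrite ltNge ltW// f_neg//; apply/andP; split; lra.
Qed.

Lemma f_nonneg x : zeta <= x -> 0 <= f x.
Proof.
rewrite le_eqVlt => /predU1P[<-|zx]; last exact/ltW/f_pos.
rewrite leNgt; apply/negP => fz.
have cf : continuous (fun x => - f x) by move=> y; apply: cvgN; exact: f_continuous.
have [|d d0 dP] := cont_pos (x := zeta) cf; first by rewrite oppr_gt0.
have /dP : `|zeta + d / 2 - zeta| < d by rewrite ltr_norml; apply/andP; split; lra.
by rewrite oppr_gt0 ltNge ltW// f_pos//; lra.
Qed.

(** [sign_principle] around [q] gives [V <= 0], and [touch_neg] excludes equality. The lower bound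
    [alo] on [al] and the maximum of [f] near [q] make the threshold on [eps] uniform. *)
Lemma near_sign_neg q : 0 < q -> q < xi' -> \forall eps \near 0^'+,
  forall al V V1, alo <= al -> al <= T -> good mu C eps al V V1 -> V q < 0.
Proof.
move=> q0 qx.
have a0 := alo_gt0; have x'z := xi'_lt.
pose d := Num.min (q / 2) ((xi' - q) / 2).
have d0 : 0 < d by rewrite lt_min; apply/andP; split; lra.
have d1 : d <= q / 2 by rewrite ge_min lexx.
have d2 : d <= (xi' - q) / 2 by rewrite ge_min lexx orbT.
have A0 : 0 < q / 4 by lra.
have AB : q / 4 <= xi' by lra.
have Ay : q / 4 < q - d by lra.
have yB : q + d < xi' by lra.
have d20 : 0 < d / 2 by lra.
have [K [K1 TK _ _ KV]] := uniform_constant A0 AB.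
have qd : q - d <= q + d by lra.
have win t : q - d <= t <= q + d -> 0 < t < xi' by move=> /andP[t1 t2]; apply/andP; split; lra.
have win' t : q - d <= t <= q + d -> 0 < t < zeta.
  by move=> /win/andP[-> /lt_trans]; exact.
have [y yq ymax] := EVT_max qd (continuous_subspaceT (A := `[q - d, q + d]%classic) (f_continuous mu_C1)).
have fy : f y < 0 by apply: f_neg; apply: win'; move: yq; rewrite in_itv.
have fq : f q < 0 by apply: f_neg; rewrite q0 (lt_trans qx).
have c0 : 0 < alo * - f y by rewrite mulr_gt0// oppr_gt0.
have c0d : 0 < alo * - f y * (d / 4) ^+ 2.
  by rewrite mulr_gt0 ?exprn_gt0// divr_gt0.
near=> eps => al V V1 alo_al alT VG.
have e0 : 0 < eps by [].
have e1 : eps <= 1 by apply: ltW; near: eps; exact: nbhs_right_lt.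
have al0 : 0 < al := lt_le_trans a0 alo_al.
have alT' : `|al| <= T by rewrite gtr0_norm.
have S := KV _ _ _ _ e0 e1 alT' VG.
have es : eps * (4 * K) < alo * - f y * (d / 4) ^+ 2 by near: eps; exact: near_mul_lt.
have neg : forall t : R, `|t - q| < d / 2 -> V t <= 0.
  apply: (sign_principle S e0 Ay yB d0 c0 _ _ es) => t tq.
    have /andP[t0 tx] := win t tq.
    by rewrite -mu_xi'; apply: mu_le_left; exact: ltW.
  rewrite mulrN opprK; apply: (@le_trans _ _ (al * f y)).
    by rewrite ler_pM2l//; apply: ymax; rewrite in_itv.
  by rewrite ler_wnM2r// ltW.
rewrite lt_neqAle neg ?subrr ?normr0// andbT; apply/eqP => Vq.
exact: (touch_neg VG e0 al0 q0 Vq fq d20).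
Unshelve. all: by end_near. Qed.

Lemma near_sign_pos p : xi < p -> \forall eps \near 0^'+,
  forall al V V1, alo <= al -> al <= T -> good mu C eps al V V1 -> 0 < V p.
Proof.
move=> xp.
have a0 := alo_gt0; have z0 := zeta_gt0; have zxi := xi_gt.
pose d := (p - xi) / 2.
have d0 : 0 < d by rewrite /d; lra.
have A0 : 0 < xi by lra.
have AB : xi <= p + 2 * d by rewrite /d; lra.
have Ay : xi < p - d by rewrite /d; lra.
have yB : p + d < p + 2 * d by lra.
have d20 : 0 < d / 2 by lra.
have p0 : 0 < p := lt_trans A0 xp.
have [K [K1 TK _ _ KV]] := uniform_constant A0 AB.
have qd : p - d <= p + d by lra.
have win t : p - d <= t <= p + d -> xi < t by move=> /andP[t1 _]; exact: lt_le_trans t1.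
have [y yq ymin] := EVT_min qd (continuous_subspaceT (A := `[p - d, p + d]%classic) (f_continuous mu_C1)).
have fy : 0 < f y by apply: f_pos; apply: lt_trans (win y _) => //; move: yq; rewrite in_itv.
have fp : 0 < f p by apply: f_pos; exact: lt_trans xp.
have c0 : 0 < alo * f y by rewrite mulr_gt0.
have c0d : 0 < alo * f y * (d / 4) ^+ 2.
  by rewrite mulr_gt0 ?exprn_gt0// divr_gt0.
near=> eps => al V V1 alo_al alT VG.
have e0 : 0 < eps by [].
have e1 : eps <= 1 by apply: ltW; near: eps; exact: nbhs_right_lt.
have al0 : 0 < al := lt_le_trans a0 alo_al.
have alT' : `|al| <= T by rewrite gtr0_norm.
have S := lsol_neg (KV _ _ _ _ e0 e1 alT' VG).
have es : eps * (4 * K) < alo * f y * (d / 4) ^+ 2 by near: eps; exact: near_mul_lt.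
have neg : forall t : R, `|t - p| < d / 2 -> - V t <= 0.
  apply: (sign_principle S e0 Ay yB d0 c0 _ _ es) => t tq.
    have xt := win t tq.
    by rewrite -mu_xi; apply: mu_le_right; exact: ltW.
  rewrite mulNr lerN2; apply: (@le_trans _ _ (al * f y)).
    by rewrite ler_wpM2r// ltW.
  by rewrite ler_pM2l//; apply: ymin; rewrite in_itv.
rewrite lt_neqAle eq_sym -oppr_le0 neg ?subrr ?normr0// andbT; apply/eqP => Vp.
apply: (touch_pos VG e0 al0 p0 Vp fp d20) => x /neg.
by rewrite oppr_le0.
Unshelve. all: by end_near. Qed.

Lemma window_small K kap : 1 <= K -> 0 < kap -> window K kap <= kap / 8.
Proof.
move=> K1 k0; rewrite /window invfM mulrA ler_piMr ?invf_le1//; last by lra.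
by rewrite divr_ge0// ltW.
Qed.

Lemma exists_small (a b c K : R) : 0 < a -> 0 < b -> 0 < c -> 1 <= K ->
  exists kap : R, [/\ 0 < kap, kap <= 1, kap <= a, kap <= b & 60 * K ^+ 2 * kap < c].
Proof.
move=> a0 b0 c0 K1.
have K2 : 0 < 100 * K ^+ 2 by rewrite mulr_gt0// exprn_gt0//; lra.
have d0 : 0 < c / (100 * K ^+ 2) by rewrite divr_gt0.
exists (Num.min (Num.min 1 a) (Num.min b (c / (100 * K ^+ 2)))); split.
- by rewrite !lt_min ltr01 a0 b0 d0.
- by rewrite !ge_min lexx.
- by rewrite !ge_min lexx orbT.
- by rewrite !ge_min lexx !orbT.
apply: (@le_lt_trans _ _ (60 * K ^+ 2 * (c / (100 * K ^+ 2)))).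
  by rewrite ler_wpM2l ?ge_min ?lexx ?orbT// mulr_ge0// sqr_ge0.
have -> : 60 * K ^+ 2 * (c / (100 * K ^+ 2)) = 60 / 100 * c by field; rewrite gt_eqF//; lra.
by lra.
Qed.

Notation A := (xi' / 4).
Notation B := (xi + 3).

Lemma mu_pos_range z : 0 < z -> 0 < mu z -> xi' < z < xi.
Proof.
move=> z0 mz; apply/andP; split; rewrite ltNge; apply/negP => h.
  by have := mu_le_left (ltW z0) h (ltW xi'_lt); rewrite mu_xi' leNgt mz.
by have := mu_le_right (ltW xi_gt) h; rewrite mu_xi leNgt mz.
Qed.

Lemma refl_transition V z : V z = 0 -> (forall x, A <= x < z -> V x < 0) -> (forall x, z < x -> 0 < V x) ->
  [/\ refl V (- z) = 0, forall x, - B <= x < - z -> refl V x < 0 &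
    forall x, - z < x <= - A -> 0 < refl V x].
Proof.
move=> Vz Vneg Vpos; split; first by rewrite /refl opprK Vz oppr0.
  by move=> x /andP[_ xz]; rewrite /refl oppr_lt0 Vpos// ltrNr.
by move=> x /andP[zx xA]; rewrite /refl oppr_gt0 Vneg// lerNr xA ltrNl.
Qed.

Lemma near_inner ahi d : 0 < d -> ahi < Num.sqrt 2 -> \forall eps \near 0^'+,
  forall al V V1 z, alo <= al -> al <= T -> al <= ahi -> good mu C eps al V V1 ->
  xi' / 2 < z -> z < xi + 1 -> V z = 0 ->
  (forall x, A <= x < z -> V x < 0) -> (forall x, z < x -> 0 < V x) -> mu z < d.
Proof.
move=> d0 ahi2.
have x0 := xi'_gt0; have x'z := xi'_lt; have zx := xi_gt; have a0 := alo_gt0.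
have A0 : 0 < A by lra.
have AB : A <= B by lra.
have [K [K1 TK fK muK KV]] := uniform_constant A0 AB.
have g0 : 0 < 2 / 3 * (Num.sqrt 2 - ahi) * pow32 d.
  by rewrite !mulr_gt0 ?subr_gt0 ?sqrtr_gt0.
have d2 : 0 < d / 2 by lra.
have [kap [k0 k1 kd kx kg]] := exists_small d2 x0 g0 K1.
have Lk := window_small K1 k0.
have L0 := window_gt0 K1 k0.
have LA : A < xi' - 2 * window K kap by lra.
have LX : 0 <= xi' - window K kap by lra.
have LB : zeta + window K kap < B by lra.
have LB' : - B < - xi - 2 * window K kap by lra.
have LA' : - zeta + window K kap < - A by lra.
near=> eps => al V V1 z alo_al alT al_ahi VG z1 z2 Vz Vneg Vpos.
have e0 : 0 < eps by [].
have e1 : eps <= 1 by apply: ltW; near: eps; exact: nbhs_right_lt.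
have E : small_eps K kap eps by near: eps; exact: near_small_eps.
have al0 : 0 < al := lt_le_trans a0 alo_al.
have alT' : `|al| <= T by rewrite gtr0_norm.
have alK : al <= K := le_trans alT TK.
have S := KV _ _ _ _ e0 e1 alT' VG.
rewrite ltNge; apply/negP => dmu.
have mz0 : 0 < mu z := lt_le_trans d0 dmu.
have z0 : 0 < z by apply: lt_trans z1; rewrite divr_gt0.
have /andP[z3 z4] := mu_pos_range z0 mz0.
have kmu : 2 * kap <= mu z.
  by apply: le_trans dmu; rewrite mulrC -ler_pdivlMr.
have muK' x : A <= x <= B -> `|mu x| <= K by [].
suff H : 2 / 3 * (Num.sqrt 2 - al) * pow32 (mu z) <= 20 * K ^+ 2 * kap.
  have h1 : 2 / 3 * (Num.sqrt 2 - ahi) * pow32 d <= 2 / 3 * (Num.sqrt 2 - al) * pow32 (mu z).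
    have p1 : pow32 d <= pow32 (mu z) by apply: pow32_le => //; exact: ltW.
    apply: ler_pM => //.
    - by rewrite mulr_ge0 ?divr_ge0// subr_ge0 ltW.
    - by rewrite mulr_ge0 ?sqrtr_ge0// ltW.
    - by rewrite ler_wpM2l ?divr_ge0// lerD2l lerN2.
  have h2 : 20 * K ^+ 2 * kap <= 60 * K ^+ 2 * kap.
    by rewrite ler_wpM2r ?(ltW k0)// ler_wpM2r ?sqr_ge0// ler_nat.
  by have := le_lt_trans (le_trans h1 (le_trans H h2)) kg; rewrite ltxx.
case: (leP z zeta) => zz.
  have zB : z + window K kap < B by apply: le_lt_trans LB; rewrite lerD2r.
  apply: (inner_wall mu_C1 K1 k0 k1 E fK muK' S (ltW al0) alK LA (ltW z3) zB) => //.
  - by rewrite mu_xi'.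
  - move=> x /andP[x1 x2]; rewrite -mu_xi'; apply: mu_le_left => //; last exact: ltW.
    exact: le_trans LX x1.
  - move=> x /andP[x1 x2]; rewrite -mu_xi'; apply: mu_le_left => //; first exact: ltW.
    exact: le_trans x2 zz.
  - move=> x /andP[x1 x2]; apply: f_nonpos; first exact: lt_le_trans x1.
    exact: le_trans x2 zz.
  - by move=> x /andP[x1 x2]; exact: Vpos.
have [Uz Uneg Upos] := refl_transition Vz Vneg Vpos.
have Sr := lsol_refl mu_C1 mu_even S.
rewrite -mu_even.
have fK' x : - B <= x <= - A -> `|f x| <= K.
  move=> /andP[x1 x2]; have := fK (- x); rewrite (f_odd mu_C1 mu_even) normrN; apply.
  by rewrite lerNr x2 lerNl x1.
have muK2 x : - B <= x <= - A -> `|mu x| <= K by [].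
have zB : - z + window K kap < - A by apply: lt_trans LA'; rewrite ltrD2r ltrN2.
have xz : - xi <= - z by rewrite lerN2 ltW.
apply: (inner_wall mu_C1 K1 k0 k1 E fK' muK2 Sr (ltW al0) alK LB' xz zB) => //.
- by rewrite mu_even mu_xi.
- move=> x /andP[x1 x2]; rewrite -mu_even -mu_xi; apply: mu_le_right; first exact: ltW.
  by rewrite lerNr.
- move=> x /andP[x1 x2]; rewrite -[mu x]mu_even -mu_xi; apply: mu_le_right.
    by apply: (le_trans (ltW zz)); rewrite lerNr.
  by rewrite lerNl.
- move=> x /andP[x1 x2]; rewrite -[x]opprK (f_odd mu_C1 mu_even) oppr_le0; apply: f_nonneg.
  by apply: (le_trans (ltW zz)); rewrite lerNr.
- by rewrite mu_even.
Unshelve. all: by end_near. Qed.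

(** If [z] were at distance at least [d] from [zeta], monotonicity on each side would keep [mu z]
    below a level strictly less than [mu zeta], against [outer_wall] for [V] or for its
    reflection. *)
Lemma near_outer amin d : 0 < d -> d < zeta -> Num.sqrt 2 < amin -> \forall eps \near 0^'+,
  forall al V V1 z, amin <= al -> al <= T -> good mu C eps al V V1 ->
  xi' / 2 < z -> z < xi + 1 -> V z = 0 ->
  (forall x, A <= x < z -> V x < 0) -> (forall x, z < x -> 0 < V x) -> `|z - zeta| < d.
Proof.
move=> d0 dz amin2.
have x0 := xi'_gt0; have x'z := xi'_lt; have zx := xi_gt; have a0 := alo_gt0.
have A0 : 0 < A by lra.
have AB : A <= B by lra.
have [K [K1 TK fK muK KV]] := uniform_constant A0 AB.
(* The level in question; the maximum with 0 accounts for positions [z] where [mu] is negative. *)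
pose m1 := Num.max (Num.max (mu (zeta - d)) (mu (zeta + d))) 0.
have m10 : 0 <= m1 by rewrite le_max lexx orbT.
have mz0 := mu_zeta_gt0.
have m1z : m1 < mu zeta.
  rewrite !gt_max mz0 andbT; apply/andP; split.
    by apply: mu_lt_left; [rewrite subr_ge0 ltW|rewrite ltrBlDr ltrDl|].
  by apply: mu_lt_right; rewrite ?lexx// ltrDl.
have g0 : 0 < 2 / 3 * (amin - Num.sqrt 2) * (pow32 (mu zeta) - pow32 m1).
  rewrite !mulr_gt0 ?subr_gt0//.
  rewrite -subr_gt0; apply: lt_le_trans (pow32_gap m10 (ltW m1z)).
  by rewrite mulr_gt0 ?subr_gt0 ?sqrtr_gt0.
have [kap [k0 k1 _ kx kg]] := exists_small d0 x0 g0 K1.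
have Lk := window_small K1 k0.
have L0 := window_gt0 K1 k0.
have LA : A <= xi' / 2 - window K kap by lra.
have LB : zeta + 2 * window K kap < B by lra.
have LB' : - B <= - (xi + 1) - window K kap by lra.
have LA' : - zeta + 2 * window K kap < - A by lra.
near=> eps => al V V1 z amin_al alT VG z1 z2 Vz Vneg Vpos.
have e0 : 0 < eps by [].
have e1 : eps <= 1 by apply: ltW; near: eps; exact: nbhs_right_lt.
have E : small_eps K kap eps by near: eps; exact: near_small_eps.
have al2 : Num.sqrt 2 < al := lt_le_trans amin2 amin_al.
have al0 : 0 < al := le_lt_trans (sqrtr_ge0 _) al2.
have alT' : `|al| <= T by rewrite gtr0_norm.
have alK : al <= K := le_trans alT TK.
have S := KV _ _ _ _ e0 e1 alT' VG.
have z0 : 0 < z by apply: lt_trans z1; rewrite divr_gt0.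
have muK' x : A <= x <= B -> `|mu x| <= K by [].
suff H : 2 / 3 * (al - Num.sqrt 2) * (pow32 (mu zeta) - pow32 (Num.max (mu z) 0)) <= 60 * K ^+ 2 * kap.
  rewrite ltNge; apply/negP => dmu.
  have mzm : Num.max (mu z) 0 <= m1.
    rewrite ge_max m10 andbT !le_max.
    case: (leP z zeta) => zz.
      rewrite ler0_norm ?subr_le0// opprB in dmu.
      rewrite (_ : mu z <= mu (zeta - d))//; apply: mu_le_left; first exact: ltW.
        by rewrite lerBrDr addrC -lerBrDr.
      by rewrite gerBl ltW.
    rewrite gtr0_norm ?subr_gt0// in dmu.
    rewrite (_ : mu z <= mu (zeta + d)) ?orbT//; apply: mu_le_right; first by rewrite lerDl ltW.
    by rewrite addrC -lerBrDr.
  have p1 : pow32 (Num.max (mu z) 0) <= pow32 m1 by apply: pow32_le => //; rewrite le_max lexx orbT.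
  have p2 : pow32 m1 <= pow32 (mu zeta) by apply: pow32_le => //; exact: ltW.
  have h1 : 2 / 3 * (amin - Num.sqrt 2) * (pow32 (mu zeta) - pow32 m1) <=
      2 / 3 * (al - Num.sqrt 2) * (pow32 (mu zeta) - pow32 (Num.max (mu z) 0)).
    apply: ler_pM => //.
    - by rewrite mulr_ge0 ?divr_ge0// subr_ge0 ltW.
    - by rewrite subr_ge0.
    - by rewrite ler_wpM2l ?divr_ge0// lerD2r.
    - by rewrite lerD2l lerN2.
  by have := lt_le_trans kg (le_trans h1 H); rewrite ltxx.
case: (leP z zeta) => zz.
  have Az : A <= z - window K kap by apply: (le_trans LA); rewrite lerD2r ltW.
  apply: (outer_wall mu_C1 K1 k0 k1 E fK muK' S (ltW al0) alK Az zz LB) => //.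
  - move=> x /andP[x1 x2]; apply: f_nonpos => //; exact: lt_le_trans x1.
  - by move=> x /andP[x1 x2]; exact: Vpos.
have [Uz Uneg Upos] := refl_transition Vz Vneg Vpos.
have Sr := lsol_refl mu_C1 mu_even S.
rewrite -(mu_even z) -(mu_even zeta).
have fK' x : - B <= x <= - A -> `|f x| <= K.
  move=> /andP[x1 x2]; have := fK (- x); rewrite (f_odd mu_C1 mu_even) normrN; apply.
  by rewrite lerNr x2 lerNl x1.
have muK2 x : - B <= x <= - A -> `|mu x| <= K by [].
have Bz : - B <= - z - window K kap.
  by apply: (le_trans LB'); rewrite lerD2r lerN2 ltW.
have zz' : - z <= - zeta by rewrite lerN2 ltW.
apply: (outer_wall mu_C1 K1 k0 k1 E fK' muK2 Sr (ltW al0) alK Bz zz' LA') => //.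
- move=> x /andP[x1 x2]; rewrite -[x]opprK (f_odd mu_C1 mu_even) oppr_le0; apply: f_nonneg.
  by rewrite lerNr.
- by rewrite mu_even.
Unshelve. all: by end_near. Qed.

End localisation.

(** * From two half-lines to three zeros *)

Lemma ae_le_everywhere {R : realType} (F : R -> R) (M : R) : continuous F ->
  (\forall x \ae leb R, F x <= M) -> forall x, F x <= M.
Proof.
move=> cF /= ae x; rewrite leNgt; apply/negP => Fx.
have cG : continuous (fun x => F x - M) by apply: contB => //; exact: contC.
have [|d d0 dP] := cont_pos (x := x) cG; first by rewrite subr_gt0.
have : (leb R).-negligible `]x, (x + d)[%classic.
  apply: negligibleS ae => t /=; rewrite in_itv/= => /andP[t1 t2]; apply/negP.
  rewrite -ltNge -subr_gt0; apply: dP; rewrite ltr_norml; apply/andP; split; lra.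
move=> /measure_negligible => /(_ (measurable_itv _)).
have /= := @lebesgue_measure_itv R (Interval (BRight x) (BLeft (x + d))).
rewrite lte_fin ltrDl d0 -EFinD addrAC subrr add0r => E.
by rewrite [leb R `]x, (x + d)[%classic]E => /eqP; rewrite eqe gt_eqF.
Qed.

Lemma Lfun_oo_bounded {R : realType} (F : R -> R) : continuous F -> F \in Lfun (leb R) +oo%E ->
  exists M : R, forall x, `|F x| <= M.
Proof.
move=> cF; rewrite inE => /andP[_]; rewrite inE/= /finite_norm unlock /Lnorm.
have -> : (0 < leb R [set: R])%E.
  have /= E := @lebesgue_measure_itv R (Interval -oo%O +oo%O).
  by rewrite -set_itvNyy [leb R _]E ltry.
move=> h; have [M] := @ess_supr_bounded _ _ _ (leb R) (fun x => `|F x|) h.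
move=> ae; exists M; apply: ae_le_everywhere => //.
by move=> x; apply: (continuous_comp (f := F)); [exact: cF|exact: norm_continuous].
Qed.

Lemma exactly_three_zeros_inj {R : realType} (w : R -> R) (a b c a' b' c' : R) :
  exactly_three_zeros w a b c -> exactly_three_zeros w a' b' c' -> [/\ a = a', b = b' & c = c'].
Proof.
move=> [ab bc H] [ab' bc' H'].
have [Ha Hb Hc] : [/\ [\/ a = a', a = b' | a = c'], [\/ b = a', b = b' | b = c'] & [\/ c = a', c = b' | c = c']].
  split; apply/H'; apply/H; [by constructor 1|by constructor 2|by constructor 3].
move=> {H H'}.
by case: Ha Hb Hc ab bc => -> [] -> [] -> ab bc; split => //; lra.
Qed.

Section assembly.
Context {R : realType}.
Variable mu : R -> R.
Hypothesis mu_C1 : C1 mu.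
Hypothesis mu_even : forall x, mu (- x) = mu x.
Variable M : R.
Hypothesis mu_bd : forall x, `|mu x| <= M.
Variables (zeta xi xi' : R).
Hypothesis xi'_gt0 : 0 < xi'.
Hypothesis xi'_lt : xi' < zeta.
Hypothesis xi_gt : zeta < xi.
Notation f := (forcing mu).
Hypothesis f_neg : forall x : R, 0 < x < zeta -> f x < 0.
Hypothesis f_pos : forall x : R, zeta < x -> 0 < f x.
Hypothesis mu_xi' : mu xi' = 0.
Hypothesis mu_xi : mu xi = 0.
Variables (C T alo : R).
Hypothesis alo_gt0 : 0 < alo.
Hypothesis T_ge0 : 0 <= T.
Implicit Types (V U w : R -> R) (A B K a b c d x y z q p eps al : R).

(** The halves [V] and [V'] have opposite values at the origin, so [middle_zero] cannot place a zero
    inside both. It is at 0 if [V 0 = 0], and otherwise in the half whose value at 0 is positive. *)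
Lemma zeros_of_halves w V V' V1 V1' eps al q z z' :
  0 < eps -> 0 < al -> good mu C eps al V V1 -> good mu C eps al V' V1' ->
  (forall x, 0 <= x -> V x = w x) -> (forall x, 0 <= x -> V' x = refl w x) ->
  0 < q -> q < zeta ->
  [/\ q < z, V z = 0, forall x, q <= x < z -> V x < 0 & forall x, z < x -> 0 < V x] ->
  [/\ q < z', V' z' = 0, forall x, q <= x < z' -> V' x < 0 & forall x, z' < x -> 0 < V' x] ->
  exists2 m, `|m| < q & exactly_three_zeros w (- z') m z.
Proof.
move=> e0 al0 VG VG' Vw Vw' q0 qz [qz1 Vz Vn Vp] [qz' Vz' Vn' Vp'].
have Vq : V q < 0 by apply: Vn; rewrite lexx.
have Vq' : V' q < 0 by apply: Vn'; rewrite lexx.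
have V00 : V' 0 = - V 0 by rewrite Vw'// Vw// /refl oppr0.
have wpos x : 0 <= x -> w x = V x by move=> x0; rewrite Vw.
have wneg x : 0 <= x -> w (- x) = - V' x by move=> x0; rewrite Vw'// /refl opprK.
have [m [mq wm wx]] : exists m, [/\ `|m| < q, w m = 0 & forall x, `|x| <= q -> w x = 0 -> x = m].
  have [[V0 Vn1]|[V0 [a [a0 aq Va Va1 Va2]]]] := middle_zero mu_C1 f_neg VG e0 al0 q0 qz Vq;
  have [[V0' Vn1']|[V0' [a' [a0' aq' Va' Va1' Va2']]]] := middle_zero mu_C1 f_neg VG' e0 al0 q0 qz Vq'.
  - exists 0; split; [by rewrite normr0| |].
      by rewrite -Vw//; apply: le_anti; rewrite V0 -oppr_le0 -V00 V0'.
    move=> x; rewrite ler_norml => /andP[x1 x2] wx.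
    case: (ltgtP x 0) => // x0.
      have := Vn1' (- x); rewrite oppr_gt0 x0 lerNl x1 => /(_ isT).
      by rewrite -oppr_gt0 -wneg ?oppr_ge0 ?(ltW x0)// opprK wx ltxx.
    by have := Vn1 x; rewrite x0 x2 -wpos ?(ltW x0)// wx ltxx => /(_ isT).
  - exists (- a'); split; first by rewrite normrN gtr0_norm.
      by rewrite wneg ?Va' ?oppr0// ltW.
    move=> x; rewrite ler_norml => /andP[x1 x2] wx.
    have V0n : V 0 < 0 by rewrite -oppr_gt0 -V00.
    case: (leP 0 x) => x0.
      suff : V x < 0 by rewrite -wpos// wx ltxx.
      move: x0; rewrite le_eqVlt => /predU1P[<-//|x0]; by apply: Vn1; rewrite x0.
    have V'x : V' (- x) = 0.
      by apply/eqP; rewrite -oppr_eq0 -wneg ?oppr_ge0 ?(ltW x0)// opprK wx.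
    case: (ltgtP (- x) a') => xa; last by rewrite -xa opprK.
      by have := Va1' (- x); rewrite V'x ltxx oppr_ge0 (ltW x0) xa => /(_ isT).
    by have := Va2' (- x); rewrite V'x ltxx xa lerNl x1 => /(_ isT).
  - exists a; split; first by rewrite gtr0_norm.
      by rewrite wpos ?Va// ltW.
    move=> x; rewrite ler_norml => /andP[x1 x2] wx.
    case: (leP 0 x) => x0.
      have Vx : V x = 0 by rewrite -wpos.
      case: (ltgtP x a) => xa //.
        by have := Va1 x; rewrite Vx ltxx x0 xa => /(_ isT).
      by have := Va2 x; rewrite Vx ltxx xa x2 => /(_ isT).
    have := Vn1' (- x); rewrite oppr_gt0 x0 lerNl x1 => /(_ isT).
    by rewrite -oppr_gt0 -wneg ?oppr_ge0 ?(ltW x0)// opprK wx ltxx.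
  - by move: V0'; rewrite V00 oppr_gt0 ltNge ltW.
exists m => //.
have z'm : - z' < m by move: mq; rewrite ltr_norml => /andP[+ _]; apply: lt_trans; rewrite ltrN2.
have mz : m < z by move: mq; rewrite ltr_norml => /andP[_ ?]; exact: lt_trans qz1.
split=> // x; split; last first.
  case=> ->; [|by []|]; last by rewrite wpos ?Vz// ltW// (lt_trans q0).
  by rewrite wneg ?Vz' ?oppr0// ltW// (lt_trans q0).
move=> w0; case: (leP `|x| q) => xq; first by constructor 2; exact: wx.
case: (leP 0 x) => x0.
  rewrite ger0_norm// in xq.
  have Vx : V x = 0 by rewrite -wpos.
  constructor 3; case: (ltgtP x z) => // xz.
    by have := Vn x; rewrite Vx ltxx (ltW xq) xz => /(_ isT).
  by have := Vp x xz; rewrite Vx ltxx.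
rewrite ltr0_norm// in xq.
have V'x : V' (- x) = 0.
  by apply/eqP; rewrite -oppr_eq0 -wneg ?oppr_ge0 ?(ltW x0)// opprK w0.
constructor 1; case: (ltgtP (- x) z') => xz; last by rewrite -xz opprK.
  by have := Vn' (- x); rewrite V'x ltxx (ltW xq) xz => /(_ isT).
by have := Vp' (- x) xz; rewrite V'x ltxx.
Qed.

Definition right_transition V z : Prop :=
  [/\ xi' / 2 < z, z < xi + 1, V z = 0, forall x, xi' / 4 <= x < z -> V x < 0 &
      forall x, z < x -> 0 < V x].

(** The signs at [q] and [xi + 1] produce the zero, and those at [xi' / 2] and [xi + 1] confine it
    to a range independent of [q]. Hence [q] can later be taken as small as the middle zero
    requires. *)
Lemma near_right_zero q : 0 < q -> q <= xi' / 4 -> \forall eps \near 0^'+,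
  forall al V V1, alo <= al -> al <= T -> good mu C eps al V V1 ->
  exists z, right_transition V z /\
    [/\ q < z, V z = 0, forall x, q <= x < z -> V x < 0 & forall x, z < x -> 0 < V x].
Proof.
move=> q0 qx; have x0 := xi'_gt0.
have qx' : q < xi' by lra.
have h0 : 0 < xi' / 2 by lra.
have hx : xi' / 2 < xi' by lra.
have qh : q < xi' / 2 by lra.
have x1 : xi < xi + 1 by rewrite ltrDl.
have N1 := near_sign_neg mu_C1 mu_bd xi'_lt f_neg mu_xi' C alo_gt0 T_ge0 q0 qx'.
have N2 := near_sign_neg mu_C1 mu_bd xi'_lt f_neg mu_xi' C alo_gt0 T_ge0 h0 hx.
have N3 := near_sign_pos mu_C1 mu_bd xi'_gt0 xi'_lt xi_gt f_pos mu_xi C alo_gt0 T_ge0 x1.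
apply: filterS2 (filterI N1 N2) (filterI N3 (nbhs_right_gt 0)) => eps [n1 n2] [n3 e0].
move=> al V V1 alo_al alT VG.
have al0 : 0 < al := lt_le_trans alo_gt0 alo_al.
have Vq := n1 al V V1 alo_al alT VG.
have Vh := n2 al V V1 alo_al alT VG.
have Vp := n3 al V V1 alo_al alT VG.
have z0 : 0 < zeta := lt_trans xi'_gt0 xi'_lt.
have qz : q < zeta := lt_trans qx' xi'_lt.
have qp : q < xi + 1 := lt_trans qz (lt_trans xi_gt x1).
have [z [qz' Vz Vn Vpz]] := right_sign_change mu_C1 z0 f_neg f_pos VG e0 al0 q0 qz Vq qp Vp.
exists z; split; split=> //.
- rewrite ltNge; apply/negP; rewrite le_eqVlt => /predU1P[e|zh].
    by move: Vh; rewrite -e Vz ltxx.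
  by have := Vpz _ zh; rewrite ltNge ltW.
- rewrite ltNge; apply/negP; rewrite le_eqVlt => /predU1P[e|zh].
    by move: Vp; rewrite e Vz ltxx.
  by have := Vn (xi + 1); rewrite (ltW qp) zh => /(_ isT); rewrite ltNge ltW.
- by move=> x /andP[x2 x3]; apply: Vn; rewrite (le_trans qx x2).
Qed.

(** Abstracts what is known of the position of a transition, so that the counting of zeros is done
    once for both regimes of [alpha0]. *)
Definition near_transitions (P : R -> Prop) : Prop :=
  \forall eps \near 0^'+, forall al V V1 z, alo <= al -> al <= T -> good mu C eps al V V1 ->
    right_transition V z -> P z.

(** The signs at [xi' - r] and [xi + r] confine [z] between these points, and [mu z < m] keeps it
    away from the middle of that interval, where [mu >= m]. *)
Lemma near_transitions_inner d : 0 < d -> T < Num.sqrt 2 ->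
  near_transitions (fun z => Num.min `|z - xi'| `|z - xi| < d).
Proof.
move=> d0 T2.
have x0 := xi'_gt0; have x'z := xi'_lt; have zx := xi_gt.
pose r := Num.min (d / 2) (xi' / 4).
have r0 : 0 < r by rewrite lt_min; apply/andP; split; lra.
have rd : r < d by rewrite gt_min; apply/orP; left; lra.
have rx : r <= xi' / 4 by rewrite ge_min lexx orbT.
have [h1 h2 h3] : [/\ 0 < xi' - r, xi' - r < xi' & xi < xi + r] by split; lra.
have h4 : xi' / 4 <= xi' - r by lra.
have h5 : 0 < xi' + r by lra.
have h6 : xi' / 4 <= xi + r by lra.
(* The minimum and the maximum with [zeta] keep each point on its monotone branch of [mu], even when
   [xi' + r] or [xi - r] passes [zeta]. *)
pose m := Num.min (mu (Num.min (xi' + r) zeta)) (mu (Num.max (xi - r) zeta)).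
have m0 : 0 < m.
  rewrite lt_min; apply/andP; split.
    rewrite -mu_xi'; apply: (mu_lt_left mu_C1 f_neg); first exact: ltW.
      by rewrite lt_min x'z andbT ltrDl.
    by rewrite ge_min lexx orbT.
  rewrite -mu_xi; apply: (mu_lt_right mu_C1 f_pos); first by rewrite le_max lexx orbT.
  by rewrite gt_max zx andbT gtrBl.
have N1 := near_sign_neg mu_C1 mu_bd xi'_lt f_neg mu_xi' C alo_gt0 T_ge0 h1 h2.
have N3 := near_sign_pos mu_C1 mu_bd xi'_gt0 xi'_lt xi_gt f_pos mu_xi C alo_gt0 T_ge0 h3.
have N2 := near_inner mu_C1 mu_even mu_bd xi'_gt0 xi'_lt xi_gt f_neg f_pos mu_xi' mu_xi C alo_gt0 T_ge0 m0 T2.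
apply: filterS2 (filterI N1 N2) (filterI N3 (nbhs_right_gt 0)) => eps [n1 n2] [n3 e0].
move=> al V V1 z alo_al alT VG [z1 z2 Vz Vn Vp].
have Vq := n1 al V V1 alo_al alT VG.
have Vr := n3 al V V1 alo_al alT VG.
have mz := n2 al V V1 z alo_al alT alT VG z1 z2 Vz Vn Vp.
have zq : xi' - r <= z.
  by rewrite leNgt; apply/negP => /Vp; rewrite ltNge ltW.
have zr : z <= xi + r.
  rewrite leNgt; apply/negP => zr; have := Vn (xi + r); rewrite zr h6 => /(_ isT).
  by rewrite ltNge (ltW Vr).
rewrite gt_min; case: (leP z (xi' + r)) => c1.
  by apply/orP; left; apply: le_lt_trans rd; rewrite ler_norml lerBrDr addrC zq lerBlDr addrC c1.
case: (leP (xi - r) z) => c2.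
  by apply/orP; right; apply: le_lt_trans rd; rewrite ler_norml lerBrDr addrC c2 lerBlDr addrC zr.
move: mz; rewrite lt_min; case: (leP z zeta) => zz.
  suff : mu (Num.min (xi' + r) zeta) <= mu z by rewrite leNgt => /negbTE ->.
  apply: (mu_le_left mu_C1 f_neg) => //; first by rewrite le_min (ltW h5) ltW// (lt_trans x0).
  by rewrite ge_min (ltW c1).
suff : mu (Num.max (xi - r) zeta) <= mu z by rewrite leNgt andbC => /negbTE ->.
by apply: (mu_le_right mu_C1 f_pos); [exact: ltW|rewrite le_max (ltW c2)].
Qed.

Lemma near_transitions_outer d : 0 < d -> Num.sqrt 2 < alo ->
  near_transitions (fun z => `|z - zeta| < d).
Proof.
move=> d0 alo2.
have z0 : 0 < zeta := lt_trans xi'_gt0 xi'_lt.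
pose r := Num.min d (zeta / 2).
have r0 : 0 < r by rewrite lt_min d0 divr_gt0.
have rd : r <= d by rewrite ge_min lexx.
have rx : r < zeta by rewrite gt_min; apply/orP; right; lra.
have N := near_outer mu_C1 mu_even mu_bd xi'_gt0 xi'_lt xi_gt f_neg f_pos mu_xi' C alo_gt0 T_ge0 r0 rx alo2.
apply: filterS N => eps n al V V1 z alo_al alT VG [z1 z2 Vz Vn Vp].
by apply: lt_le_trans rd; exact: (n al V V1).
Qed.

End assembly.

(** A threshold on [eps] that is uniform for [al] in [[alo, T]] gives a neighbourhood in the product
    filter. *)
Lemma near_pair {R : realType} (alpha0 alo T : R) (Q : R -> R -> Prop) : alo < alpha0 -> alpha0 < T ->
  (\forall eps \near 0^'+, forall al, alo <= al -> al <= T -> Q eps al) ->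
  \forall p \near small_eps_near alpha0, Q p.1 p.2.
Proof.
move=> a1 a2 N.
exists ([set eps | forall al, alo <= al -> al <= T -> Q eps al], [set al | alo <= al <= T]).
  split=> //=; have := @near_in_itvoo R alo T alpha0; rewrite in_itv/= a1 a2 => /(_ isT).
  by apply: filterS => al /=; rewrite in_itv/= => /andP[/ltW -> /ltW ->].
by move=> [e a] /= [h /andP[h1 h2]]; exact: h.
Qed.

(** * Families of minimizers and passage to the limit *)

Section family.
Context {R : realType}.
Variable mu : R -> R.
Hypothesis mu_C1 : C1 mu.
Hypothesis mu_even : forall x, mu (- x) = mu x.
Variable M : R.
Hypothesis mu_bd : forall x, `|mu x| <= M.
Variables (zeta xi xi' : R).
Hypothesis xi'_gt0 : 0 < xi'.
Hypothesis xi'_lt : xi' < zeta.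
Hypothesis xi_gt : zeta < xi.
Notation f := (forcing mu).
Hypothesis f_L43 : itg setT (fun x => `|f x| `^ (4 / 3)).
Hypothesis f_neg : forall x : R, 0 < x < zeta -> f x < 0.
Hypothesis f_pos : forall x : R, zeta < x -> 0 < f x.
Hypothesis mu_xi' : mu xi' = 0.
Hypothesis mu_xi : mu xi = 0.
Variable w : R -> R -> R -> R.
Hypothesis w_half : forall eps al, 0 < eps -> 0 <= al ->
  (exists g, half_minimal mu eps al (w eps al) g) /\
  (exists g, half_minimal mu eps al (refl (w eps al)) g).
Implicit Types (alo T al eps d : R).

Lemma mu_outside x : xi < `|x| -> mu x <= 0.
Proof.
have h y : xi < y -> mu y <= 0.
  by move=> xy; rewrite -mu_xi; apply: (mu_le_right mu_C1 f_pos); exact: ltW.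
by case: (leP 0 x) => x0; [rewrite ger0_norm//; exact: h|rewrite ltr0_norm// -mu_even; exact: h].
Qed.

(** The right zero comes from [w], the left one from its reflection with the sign changed, which is
    why [P] is stated at [- x1]. *)
Lemma near_three_zeros alo T (P : R -> Prop) d : 0 < alo -> 1 <= T -> 0 < d ->
  near_transitions mu xi xi' (L4_bound mu T) T alo P ->
  \forall eps \near 0^'+, forall al, alo <= al -> al <= T -> exists x1 x2 x3,
    [/\ exactly_three_zeros (w eps al) x1 x2 x3, `|x2| < d, P x3 & P (- x1)].
Proof.
rewrite /near_transitions => a0 T1 d0 N.
have T0 : 0 <= T := le_trans ler01 T1.
pose q := Num.min d (xi' / 4).
have q0 : 0 < q by rewrite lt_min d0 divr_gt0.
have qd : q <= d by rewrite ge_min lexx.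
have qx : q <= xi' / 4 by rewrite ge_min lexx orbT.
have qz : q < zeta.
  by apply: le_lt_trans qx (lt_trans _ xi'_lt); rewrite ltr_pdivrMr// ltr_pMr// ltr1n.
have N1 := near_right_zero mu_C1 mu_bd xi'_gt0 xi'_lt xi_gt f_neg f_pos mu_xi' mu_xi (L4_bound mu T) a0 T0 q0 qx.
apply: filterS3 N N1 (filterI (nbhs_right_gt 0) (nbhs_right_lt ltr01)) => eps n n1 [e0 /ltW e1].
move=> al alo_al alT.
have al0 : 0 < al := lt_le_trans a0 alo_al.
have [[g Hg] [g' Hg']] := w_half e0 (ltW al0).
have [V [V1 [Vw VG]]] := half_minimal_good mu_C1 mu_bd f_L43 mu_outside Hg e0 e1 T1 al0 alT.
have [V' [V1' [Vw' VG']]] := half_minimal_good mu_C1 mu_bd f_L43 mu_outside Hg' e0 e1 T1 al0 alT.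
have [z [tz Hz]] := n1 al V V1 alo_al alT VG.
have [z' [tz' Hz']] := n1 al V' V1' alo_al alT VG'.
have [m mq E] := zeros_of_halves mu_C1 f_neg e0 al0 VG VG' Vw Vw' q0 qz Hz Hz'.
exists (- z'), m, z; split=> //; first exact: lt_le_trans qd.
  exact: (n al V V1 z alo_al alT VG tz).
by rewrite opprK; exact: (n al V' V1' z' alo_al alT VG' tz').
Qed.

(** The three zeros are selected at each pair of parameters, uniquely by [exactly_three_zeros_inj];
    the default is met only when there are not exactly three, which eventually does not happen. *)
Let zeros eps al : R * R * R := xget (0, 0, 0)
  [set t | exactly_three_zeros (w eps al) t.1.1 t.1.2 t.2].

Lemma zerosP eps al x1 x2 x3 : exactly_three_zeros (w eps al) x1 x2 x3 ->
  zeros eps al = (x1, x2, x3).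
Proof.
move=> H; have := @xgetPex _ (0, 0, 0) [set t | exactly_three_zeros (w eps al) t.1.1 t.1.2 t.2].
move=> /(_ (ex_intro _ (x1, x2, x3) H)) /=; rewrite -/(zeros eps al).
by case: (zeros eps al) => [[a b] c] /= /(exactly_three_zeros_inj H)[-> -> ->].
Qed.

Lemma family_asymptotics alpha0 : 0 < alpha0 -> three_zeros_asymptotics zeta xi xi' alpha0 w.
Proof.
move=> a0.
have near (alo T : R) P d : 0 < alo -> alo < alpha0 -> alpha0 < T -> 1 <= T -> 0 < d ->
    near_transitions mu xi xi' (L4_bound mu T) T alo P ->
    \forall p \near small_eps_near alpha0,
      [/\ exactly_three_zeros (w p.1 p.2) (zeros p.1 p.2).1.1 (zeros p.1 p.2).1.2 (zeros p.1 p.2).2,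
        `|(zeros p.1 p.2).1.2| < d, P (zeros p.1 p.2).2 & P (- (zeros p.1 p.2).1.1)].
  move=> alo0 alo1 T0 T1 d0 N; have := near_pair alo1 T0 (near_three_zeros alo0 T1 d0 N).
  by apply: filterS => p [x1 [x2 [x3 [E h2 h3 h4]]]]; rewrite (zerosP E).
have half0 : 0 < alpha0 / 2 by rewrite divr_gt0.
have half1 : alpha0 / 2 < alpha0 by rewrite ltr_pdivrMr// ltr_pMr// ltr1n.
have a1 : alpha0 < alpha0 + 1 by rewrite ltrDl.
have T1 : 1 <= alpha0 + 1 by rewrite lerDr ltW.
have triv C alo T : near_transitions mu xi xi' C T alo (fun=> True) by apply: nearW.
have c2 : (zeros p.1 p.2).1.2 @[p --> small_eps_near alpha0] --> (0 : R).
  apply/cvgr0Pnorm_lt => d d0.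
  by apply: filterS (near _ _ _ _ half0 half1 a1 T1 d0 (triv _ _ _)) => p [].
exists (fun e a => (zeros e a).1.1), (fun e a => (zeros e a).1.2), (fun e a => (zeros e a).2); split.
- by apply: filterS (near _ _ _ _ half0 half1 a1 T1 ltr01 (triv _ _ _)) => p [].
- move=> a2.
  (* The $L^4$ bound asks for [1 <= T] and the comparison for [T < Num.sqrt 2]; both can hold
     because 1 is less than $\sqrt2$. *)
  pose T := Num.max 1 ((alpha0 + Num.sqrt 2) / 2).
  have T1' : 1 <= T by rewrite le_max lexx.
  have aT : alpha0 < T by rewrite lt_max; apply/orP; right; lra.
  have T2 : T < Num.sqrt 2.
    rewrite gt_max; apply/andP; split; last by lra.
    by rewrite -{1}[1 : R]sqrtr1 ltr_sqrt// ltr1n.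
  have T0 : 0 <= T := le_trans ler01 T1'.
  have N d (d0 : 0 < d) := near_transitions_inner mu_C1 mu_even mu_bd xi'_gt0 xi'_lt xi_gt
    f_neg f_pos mu_xi' mu_xi (L4_bound mu T) half0 T0 d0 T2.
  have flip (x c : R) : `|- x - c| = `|x - - c| by rewrite -normrN opprB !opprK addrC.
  split=> //; apply/cvgr0Pnorm_lt => d d0.
    apply: filterS (near _ _ _ _ half0 half1 aT T1' d0 (N d d0)) => p [_ _ _] /= h.
    by rewrite ger0_norm ?le_min ?normr_ge0// minC -!flip.
  apply: filterS (near _ _ _ _ half0 half1 aT T1' d0 (N d d0)) => p [_ _ h _].
  by rewrite ger0_norm ?le_min ?normr_ge0.
- move=> a2.
  pose alo := (alpha0 + Num.sqrt 2) / 2.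
  have [alo1 alo2] : Num.sqrt 2 < alo /\ alo < alpha0 by rewrite /alo; split; lra.
  have alo0 : 0 < alo := le_lt_trans (sqrtr_ge0 _) alo1.
  have T0 : 0 <= alpha0 + 1 := le_trans ler01 T1.
  have N d (d0 : 0 < d) := near_transitions_outer mu_C1 mu_even mu_bd xi'_gt0 xi'_lt xi_gt
    f_neg f_pos mu_xi' (L4_bound mu (alpha0 + 1)) alo0 T0 d0 alo1.
  split=> //; apply/cvgrPdist_lt => d d0.
    apply: filterS (near _ _ _ _ alo0 alo2 a1 T1 d0 (N d d0)) => p [_ _ _].
    by rewrite addrC.
  apply: filterS (near _ _ _ _ alo0 alo2 a1 T1 d0 (N d d0)) => p [_ _ h _].
  by rewrite distrC.
Qed.

End family.

Theorem theorem4p3 (R : realType) (mu : R -> R) (zeta xi xi' : R)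
    (mu_C1 : C1 mu)
    (mu_bounded : mu \in Lfun (leb R) +oo%E)
    (mu_even : forall x, mu (- x) = mu x)
    (zeta_gt0 : 0 < zeta)
    (mu_decr : forall x, zeta < x -> derive1 mu x < 0)
    (mu_incr : forall x, 0 < x < zeta -> 0 < derive1 mu x)
    (xi_gt : zeta < xi)
    (xi_zero : forall x, zeta < x -> (mu x = 0 <-> x = xi))
    (f_L43 : forcing mu \in Lfun (leb R) (4 / 3)%:E)
    (f_diff0 : derivable (forcing mu) 0 1)
    (f'0_lt0 : derive1 (forcing mu) 0 < 0)
    (mu_sign_change : exists a b : R,
       [/\ 0 <= a <= zeta, 0 <= b <= zeta, mu a < 0 & 0 < mu b])
    (xi'_itv : 0 < xi' < zeta)
    (xi'_zero : forall x, 0 < x < zeta -> (mu x = 0 <-> x = xi'))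
    (v u : R -> R -> R -> R)
    (v_min : forall eps alpha, 0 < eps -> 0 <= alpha ->
       global_minimizer mu eps alpha (v eps alpha))
    (u_min : forall eps alpha, 0 < eps -> 0 <= alpha ->
       odd_minimizer mu eps alpha (u eps alpha))
    (alpha0 : R) (alpha0_gt0 : 0 < alpha0) :
  three_zeros_asymptotics zeta xi xi' alpha0 v /\
  three_zeros_asymptotics zeta xi xi' alpha0 u.
Proof.
have [M mu_bd] := Lfun_oo_bounded (mu_continuous mu_C1) mu_bounded.
have le43 : 1 <= 4 / 3 :> R by lra.
have fL := Lfun_integrable le43 f_L43.
have [xi'_gt0 xi'_lt] := andP xi'_itv.
have f_neg x : 0 < x < zeta -> forcing mu x < 0.
  by move=> /mu_incr; rewrite /forcing; lra.
have f_pos x : zeta < x -> 0 < forcing mu x.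
  by move=> /mu_decr; rewrite /forcing; lra.
have mu_xi' : mu xi' = 0 by exact/(xi'_zero _ xi'_itv).
have mu_xi : mu xi = 0 by exact/(xi_zero _ xi_gt).
have main := family_asymptotics mu_C1 mu_even mu_bd xi'_gt0 xi'_lt xi_gt fL f_neg f_pos mu_xi' mu_xi.
split; apply: main => // eps al e0 al0.
- have vm := v_min _ _ e0 al0; split.
    exact: (global_half_minimal mu_C1 mu_bd fL vm).
  exact: (global_half_minimal mu_C1 mu_bd fL (global_minimizer_refl mu_C1 mu_even mu_bd fL vm)).
- have um := u_min _ _ e0 al0.
  (* An odd minimizer is its own reflection, so its two halves are the same function. *)
  have ru : refl (u eps al) = u eps al.
    by apply/funext => x; rewrite /refl; case: um => [[[_ ->] _] _]; rewrite opprK.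
  by rewrite ru; split; exact: (odd_half_minimal mu_C1 mu_even mu_bd fL um).
Qed.
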